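(* Let $\mathcal{Q}_0\in(0,\infty)^N$ and suppose that Assumptions (i)–(iv) of the context hold. Then, as $n\to\infty$, the sequence of rescaled queue-length processes $\{\overline{Q}^{(n)}\}_{n\ge1}$ converges in probability, uniformly on compact subsets of $\mathbb{R}_+$, to a deterministic limit $\mathcal{Q}=(\mathcal{Q}^1,\dots,\mathcal{Q}^N)$, i.e. for all $T>0$ and $\varepsilon>0$, $\mathbb{P}\big(\sup_{t\in[0,T]}|\overline{Q}^{(n)}_t-\mathcal{Q}_t|>\varepsilon\big)\to0$. The limit $\mathcal{Q}$ satisfies the fluid equations $$\mathcal{Q}^i_t=\mathcal{Q}^i_0+b^{d,i}\lambda_i t+b^o\Lambda\int_0^t\chi_i(\mathcal{Q}_s)\,ds-v\int_0^t\mu_i(\mathcal{Q}_s)\,ds,\qquad t\ge0,\ i\in[N].$$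
   Context: Notation: $[N]=\{1,\dots,N\}$, $\mathbb{R}_+=[0,\infty)$, $\inf\emptyset=\infty$, $\sup\emptyset=-\infty$, $a\wedge b=\min\{a,b\}$, $a^+=\max\{a,0\}$, $|\cdot|$ is a norm on $\mathbb{R}^N$, $x\cdot y$ is the dot product. Parameters: $N\ge1$; $\mu,\Lambda,\lambda_i>0$; weights $\beta=(\beta_1,\dots,\beta_N)$ with all $\beta_i>0$; rebates $r_0<0$ and pairwise different $r_i\ge0$, $i\in[N]$; $F$ is the cumulative distribution function of an atomless distribution on $(0,\infty)$ (investor types); mean order sizes $v,b^{d,i},b^o>0$. Routing and rates: for $q\in\mathbb{R}_+^N$ with $\beta\cdot q>0$, $\mu_i(q)=\mu\,\beta_iq^i/(\beta\cdot q)$, and $\mu_i(0)=0$. For $\gamma>0$, $i^*(\gamma,q)$ is a maximizer over $i\in[N]\cup\{0\}$ of $\gamma r_i-d_i(q)$, where $d_0(q)=0$ and $d_i(q)=\frac{q^i}{v\mu_i(q)}=\frac{\beta\cdot q}{v\mu\beta_i}$ for $i\in[N]$ (the last expression is used also when $q^i=0$). The maximizer is unique for all but $F$-null many $\gamma$. Set $\mathcal{S}^i(q)=\{\gamma>0: i=i^*(\gamma,q)\}$ and $\chi_i(q)=\int_{\mathcal{S}^i(q)}dF(\gamma)$, $i\in[N]$. Discrete systems: on a filtered probability space satisfying the usual conditions, for each $n\ge1$ take mutually independent primitives: Poisson processes $N^{d,i,(n)}$ of rate $n\lambda_i$ ($i\in[N]$), a Poisson process $N^{o,(n)}$ of rate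 $n\Lambda$ with jump times $\tau_k$, i.i.d. order sizes $B^{d,i}_k$ (mean $b^{d,i}$), $B^o_k$ (mean $b^o$) and $V^i_k$ (mean $v$), all $\mathbb{N}$-valued with finite second moments, i.i.d. types $\gamma_k$ with distribution function $F$, and unit-rate Poisson processes $\tilde N^i$; let $M^i(t)=\sum_{k=1}^{\tilde N^i_t}V^i_k$. The nonnegative queue-length processes $Q^{(n)}=(Q^{1,(n)},\dots,Q^{N,(n)})$ satisfy $$Q^{i,(n)}_t=\big(Q^{i,(n)}_0+A^{d,i,(n)}_t+A^{o,i,(n)}_t-D^{i,(n)}_t\big)^+,$$ with $A^{d,i,(n)}_t=\sum_{k=1}^{N^{d,i,(n)}_t}B^{d,i}_k$, $A^{o,i,(n)}_t=\sum_{k=1}^{N^{o,(n)}_t}B^o_k\mathbf 1_{\{i^*(\gamma_k,\overline{Q}^{(n)}_{\tau_k-})=i\}}$, $D^{i,(n)}_t=M^i\big(n\int_0^t\mu_i(\overline{Q}^{(n)}_s)ds\big)$, and $\overline{Q}^{(n)}=n^{-1}Q^{(n)}$. Stationary point and constants: $\mathcal{Q}^*\in\mathbb{R}_+^N$ denotes the stationary point of the fluid equations, i.e. the unique solution (existence and uniqueness being taken from earlier work of Maglaras et al.) of $b^{d,i}\lambda_i+b^o\Lambda\chi_i(\mathcal{Q}^* )-v\mu_i(\mathcal{Q}^* )=0$, $i\in[N]$; $\mathcal{W}^*=\beta\cdot\mathcal{Q}^*>0$ and $\mathcal{W}_0=\beta\cdot\mathcal{Q}_0$. Let $\beta_{\min}=\min_i\beta_i$,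 $\beta_{\max}=\max_i\beta_i$, $\kappa=\beta_{\min}\beta_{\max}^{-1}(\mathcal{W}_0\wedge\mathcal{W}^* )$. With $\mathcal{R}_i^-=\{j\in[N]\cup\{0\}:r_j<r_i\}$ and $\mathcal{R}_i^+=\{j\in[N]:r_j>r_i\}$, $$a_i^+=\min_{j\in\mathcal{R}_i^+}\frac{1}{r_j-r_i}\Big(\frac1{\mu\beta_jv}-\frac1{\mu\beta_iv}\Big),\qquad a_i^-=\max_{j\in\mathcal{R}_i^-}\frac1{r_i-r_j}\Big(\frac1{\mu\beta_iv}-\frac{\mathbf 1_{\{j\ne0\}}}{\mu\beta_jv}\Big),$$ and $a^-=\min_{i\in[N]}a_i^->0$. Assumptions: (i) $F$ has a density $f=F'$ and $\gamma\mapsto\gamma f(\gamma)$ is strictly decreasing on $[a^-\kappa,\infty)$. (ii) $\sum_{i}b^{d,i}\lambda_i<v\mu<\sum_{i}b^{d,i}\lambda_i+b^o\Lambda$. (iii) $n^{-1}Q_0^{i,(n)}\to\mathcal{Q}_0^i$ almost surely for each $i\in[N]$. (iv) $a_i^+\ge a_i^-$ for all $i\in[N]$. *)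

(* Defs.v *)
From HB Require Import structures.
From mathcomp Require Import all_boot all_order all_algebra.
From mathcomp Require Import all_classical all_reals all_analysis.
Set Implicit Arguments.
Unset Strict Implicit.
Unset Printing Implicit Defensive.
Import Order.TTheory GRing.Theory Num.Theory.
Import numFieldNormedType.Exports.

Local Open Scope classical_set_scope.
Local Open Scope ring_scope.

(* Conventions.  An index in [N] is an i : 'I_N; an index in [N] u {0} is an
   element of option 'I_N, None standing for 0.  Vectors of R^N are row
   vectors.  Time is R restricted to t >= 0 by hypotheses.  A sequence indexed
   by k >= 1 on paper is indexed from 0, so index k here is k + 1 on paper. *)

Record norm_axioms (R : realType) (N : nat) (nrm : 'rV[R]_N -> R) : Prop := {
  nrm_eq0 : forall x, nrm x = 0 -> x = 0;
  nrm_scale : forall a x, nrm (a *: x) = `|a| * nrm x;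
  nrm_triangle : forall x y, nrm (x + y) <= nrm x + nrm y }.

Record lob (R : realType) (N : nat) := Lob {
  mo_rate : R;                               (* mu *)
  inv_rate : R;                              (* Lambda *)
  ded_rate : 'I_N -> R;                      (* lambda_i *)
  weight : 'rV[R]_N;                         (* beta *)
  rebate : option 'I_N -> R;                 (* r_0 and r_i *)
  mo_size : R;                               (* v *)
  ded_size : 'I_N -> R;                      (* b^{d,i} *)
  inv_size : R;                              (* b^o *)
  type_dist : probability R R;  (* the measure dF *)
  route : R -> 'rV[R]_N -> option 'I_N       (* i^* *) }.

Section routing.
Context {R : realType} {N : nat}.
Implicit Types (m : lob R N) (q : 'rV[R]_N) (i j : 'I_N).

Definition dotv (x y : 'rV[R]_N) : R := \sum_(i < N) x 0 i * y 0 i.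

Definition nonnegv q : Prop := forall i, 0 <= q 0 i.

(* At q = 0 the value is 0 since 0^-1 = 0. *)
Definition serv m q i : R :=
  mo_rate m * (weight m 0 i * q 0 i) / dotv (weight m) q.

(* d_i(q), in the closed form that is also meant when q^i = 0. *)
Definition delay m q (o : option 'I_N) : R :=
  if o is Some i
  then dotv (weight m) q / (mo_size m * mo_rate m * weight m 0 i)
  else 0.

(* All maximizers are allowed: ties are broken arbitrarily. *)
Definition route_maximizes m : Prop :=
  forall g q o, 0 < g -> nonnegv q ->
    g * rebate m o - delay m q o
      <= g * rebate m (route m g q) - delay m q (route m g q).

Definition type_set m q i : set R :=
  [set g | 0 < g /\ route m g q = Some i].

Definition chi m q i : R := fine (type_dist m (type_set m q i)).

Definition type_cdf m (x : R) : R := fine (type_dist m [set` `]-oo, x]]).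

Record lob_axioms m : Prop := {
  mo_rate_gt0 : 0 < mo_rate m;
  inv_rate_gt0 : 0 < inv_rate m;
  ded_rate_gt0 : forall i, 0 < ded_rate m i;
  weight_gt0 : forall i, 0 < weight m 0 i;
  rebate0_lt0 : rebate m None < 0;
  rebate_ge0 : forall i, 0 <= rebate m (Some i);
  rebate_inj : injective (rebate m);
  mo_size_gt0 : 0 < mo_size m;
  ded_size_gt0 : forall i, 0 < ded_size m i;
  inv_size_gt0 : 0 < inv_size m;
  type_dist_pos : type_dist m [set` `]0, +oo[] = 1%E;
  type_dist_atomless : forall x, type_dist m [set x] = 0%E;
  routeP : route_maximizes m }.

Definition balanced m q : Prop :=
  forall i, ded_size m i * ded_rate m i + inv_size m * inv_rate m * chi m q i
              - mo_size m * serv m q i = 0.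

Definition stationary_point m q : Prop :=
  unique (fun q' => nonnegv q' /\ balanced m q') q.

Definition fluid_equations m (q0 : 'rV[R]_N) (q : R -> 'rV[R]_N) : Prop :=
  forall t i, 0 <= t ->
    q t 0 i = q0 0 i + ded_size m i * ded_rate m i * t
      + inv_size m * inv_rate m
          * \int[lebesgue_measure]_(s in `[0, t]) chi m (q s) i
      - mo_size m * \int[lebesgue_measure]_(s in `[0, t]) serv m (q s) i.

(* The extended reals carry the conventions min {} = +oo and max {} = -oo. *)
Definition a_plus m i : \bar R :=
  \big[Order.min/+oo%E]_(j < N | rebate m (Some i) < rebate m (Some j))
    ((rebate m (Some j) - rebate m (Some i))^-1
      * ((mo_rate m * weight m 0 j * mo_size m)^-1
           - (mo_rate m * weight m 0 i * mo_size m)^-1))%:E.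

Definition a_minus m i : \bar R :=
  \big[Order.max/-oo%E]_(o : option 'I_N | rebate m o < rebate m (Some i))
    ((rebate m (Some i) - rebate m o)^-1
      * ((mo_rate m * weight m 0 i * mo_size m)^-1
           - (if o is Some j
              then (mo_rate m * weight m 0 j * mo_size m)^-1 else 0)))%:E.

Definition a_minus_min m : \bar R := \big[Order.min/+oo%E]_(i < N) a_minus m i.

Definition weight_min m : R :=
  fine (\big[Order.min/+oo%E]_(i < N) (weight m 0 i)%:E).

Definition weight_max m : R :=
  fine (\big[Order.max/-oo%E]_(i < N) (weight m 0 i)%:E).

Definition kappa m q0 qstar : R :=
  weight_min m / weight_max m
    * Num.min (dotv (weight m) q0) (dotv (weight m) qstar).

(* f is a density of F with f = F'; as a density is only determined up to null
   sets, the latter is required almost everywhere. *)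
Record cdf_density m (f : R -> R) : Prop := {
  density_measurable : measurable_fun setT f;
  density_ge0 : forall x, 0 <= f x;
  density_cdf : forall x,
    (type_cdf m x)%:E = (\int[lebesgue_measure]_(y in `]-oo, x]) (f y)%:E)%E;
  density_derive : {ae lebesgue_measure, forall x : R,
    is_derive x 1 (type_cdf m) (f x)} }.

Definition decreasing_density m q0 qstar : Prop :=
  exists2 f : R -> R, cdf_density m f &
    forall x y, (a_minus_min m * (kappa m q0 qstar)%:E <= x%:E)%E -> x < y ->
      y * f y < x * f x.

Definition moderate_traffic m : Prop :=
  \sum_(i < N) ded_size m i * ded_rate m i < mo_size m * mo_rate m
    < \sum_(i < N) ded_size m i * ded_rate m i + inv_size m * inv_rate m.

Definition no_dominated_venue m : Prop :=
  forall i, (a_minus m i <= a_plus m i)%E.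

End routing.

Section probability.
Context {R : realType} {d : measure_display} {Omega : measurableType d}.
Context (P : probability Omega R).

Record usual_filtration (Fil : R -> set (set Omega)) : Prop := {
  fil_sigma : forall t, 0 <= t -> sigma_algebra setT (Fil t);
  fil_sub : forall t, 0 <= t -> Fil t `<=` measurable;
  fil_mono : forall s t, 0 <= s -> s <= t -> Fil s `<=` Fil t;
  fil_right : forall t, 0 <= t ->
    \bigcap_(s in [set s | t < s]) Fil s = Fil t;
  fil_complete : P.-negligible `<=` Fil 0 }.

Definition mutually_independent (I : Type) (G : I -> set (set Omega)) : Prop :=
  forall (m : nat) (f : 'I_m -> I) (A : 'I_m -> set Omega),
    injective f -> (forall j, G (f j) (A j)) ->
    P (\bigcap_(j in [set: 'I_m]) A j) = (\prod_(j < m) fine (P (A j)))%:E.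

Definition sigma_rv d' (T : measurableType d') (X : Omega -> T)
  : set (set Omega) := preimage_set_system setT X measurable.

Definition sigma_process d' (T : measurableType d') (X : R -> Omega -> T)
  : set (set Omega) := <<s \bigcup_(t in [set t | 0 <= t]) sigma_rv (X t) >>.

Record poisson_process (rate : R) (X : R -> Omega -> nat) : Prop := {
  pp_measurable : forall t, 0 <= t -> measurable_fun setT (X t);
  pp_path : {ae P, forall w,
    [/\ X 0 w = 0%N,
        forall s t, 0 <= s -> s <= t -> (X s w <= X t w)%N &
        forall t, 0 <= t -> \forall s \near t^'+, X s w = X t w]};
  pp_increments : forall (m : nat) (t : nat -> R),
    0 <= t 0%N -> (forall j, t j <= t j.+1) ->
    mutually_independent
      (fun j : 'I_m => sigma_rv (fun w => (X (t j.+1) w - X (t j) w)%N));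
  pp_law : forall s t k, 0 <= s -> s < t ->
    P [set w | (X t w - X s w)%N = k] = (poisson_pmf (rate * (t - s)) k)%:E }.

(* Identically distributed order sizes; their independence is part of the joint
   independence of the primitives. *)
Record order_sizes (B : nat -> Omega -> nat) (b : R) : Prop := {
  os_measurable : forall k, measurable_fun setT (B k);
  os_law : forall k l (A : set nat), P (B k @^-1` A) = P (B l @^-1` A);
  os_mean : forall k, ('E_P[fun w => (B k w)%:R] = b%:E)%E;
  os_second : forall k, ('E_P[fun w => ((B k w)%:R ^+ 2)%R] < +oo)%E }.

Record investor_types (nu : probability R R)
  (g : nat -> Omega -> R) : Prop := {
  it_measurable : forall k,
    measurable_fun setT (g k);
  it_law : forall k (A : set R), measurable A ->
    P (g k @^-1` A) = nu A }.

(* A measure has no meaningful value at a nonmeasurable set, so measurability of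
   the events is asserted as well. *)
Definition ucp_converges (N : nat) (nrm : 'rV[R]_N -> R)
  (Y : nat -> R -> Omega -> 'rV[R]_N) (y : R -> 'rV[R]_N) : Prop :=
  forall T e : R, 0 < T -> 0 < e ->
    let E n := [set w |
      (e%:E < ereal_sup [set (nrm (Y n t w - y t))%:E | t in `[0%R, T]])%E] in
    (forall n, (0 < n)%N -> measurable (E n)) /\
    P (E n) @[n --> \oo] --> 0%E.

End probability.

Record primitives (R : realType) (d : measure_display)
  (Omega : measurableType d) (N : nat) := Primitives {
  Nd : nat -> 'I_N -> R -> Omega -> nat;     (* N^{d,i,(n)} *)
  No : nat -> R -> Omega -> nat;             (* N^{o,(n)} *)
  Nm : 'I_N -> R -> Omega -> nat;            (* tilde N^i *)
  Bd : 'I_N -> nat -> Omega -> nat;          (* B^{d,i}_k *)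
  Bo : nat -> Omega -> nat;                  (* B^o_k *)
  Vm : 'I_N -> nat -> Omega -> nat;          (* V^i_k *)
  gam : nat -> Omega -> R                    (* gamma_k *) }.

Inductive label (N : nat) : Type :=
| LNd of 'I_N | LNo | LNm of 'I_N
| LBd of 'I_N & nat | LBo of nat | LVm of 'I_N & nat | Lgam of nat.

Arguments LNo {N}.
Arguments LBo {N}.
Arguments Lgam {N}.

Section systems.
Context {R : realType} {d : measure_display} {Omega : measurableType d}.
Context {N : nat}.
Implicit Types (m : lob R N) (X : primitives R Omega N) (P : probability Omega R)
  (Q : R -> Omega -> 'rV[R]_N).

Definition sigma_primitive X (n : nat) (l : label N) : set (set Omega) :=
  match l with
  | LNd i => sigma_process (Nd X n i)
  | LNo => sigma_process (No X n)
  | LNm i => sigma_process (Nm X i)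
  | LBd i k => sigma_rv (Bd X i k)
  | LBo k => sigma_rv (Bo X k)
  | LVm i k => sigma_rv (Vm X i k)
  | Lgam k => sigma_rv (gam X k)
  end.

Record primitives_axioms m P X : Prop := {
  prim_Nd : forall n i, (0 < n)%N ->
    poisson_process P (n%:R * ded_rate m i) (Nd X n i);
  prim_No : forall n, (0 < n)%N ->
    poisson_process P (n%:R * inv_rate m) (No X n);
  prim_Nm : forall i, poisson_process P 1 (Nm X i);
  prim_Bd : forall i, order_sizes P (Bd X i) (ded_size m i);
  prim_Bo : order_sizes P (Bo X) (inv_size m);
  prim_Vm : forall i, order_sizes P (Vm X i) (mo_size m);
  prim_gam : investor_types P (type_dist m) (gam X);
  prim_indep : forall n, (0 < n)%N ->
    mutually_independent P (sigma_primitive X n) }.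

(* tau_(k+1); only used for k < c t, when the set below is nonempty. *)
Definition jump_time (c : R -> nat) (k : nat) : R :=
  inf [set t | 0 <= t /\ (k < c t)%N].

Definition left_limit (q : R -> 'rV[R]_N) (t : R) : 'rV[R]_N :=
  lim (q s @[s --> t^'-]).

Definition rescaled (n : nat) Q : R -> Omega -> 'rV[R]_N :=
  fun t w => n%:R^-1 *: Q t w.

Definition ded_arrivals X n i (t : R) (w : Omega) : R :=
  \sum_(k < Nd X n i t w) (Bd X i k w)%:R.

Definition inv_arrivals m X n Q i (t : R) (w : Omega) : R :=
  \sum_(k < No X n t w) (Bo X k w)%:R
    * (route m (gam X k w)
         (left_limit (rescaled n Q ^~ w) (jump_time (No X n ^~ w) k))
       == Some i)%:R.

Definition cum_services X i (s : R) (w : Omega) : R :=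
  \sum_(k < Nm X i s w) (Vm X i k w)%:R.

Definition departures m X n Q i (t : R) (w : Omega) : R :=
  cum_services X i
    (n%:R * \int[lebesgue_measure]_(s in `[0, t]) serv m (rescaled n Q s w) i)
    w.

Record queue_process m P X (n : nat) Q : Prop := {
  queue_measurable : forall t i, 0 <= t ->
    measurable_fun setT ((fun w => Q t w 0 i));
  queue_ge0 : forall t w, 0 <= t -> nonnegv (Q t w);
  queue_eq : {ae P, forall w, forall t i, 0 <= t ->
    Q t w 0 i = Num.max (Q 0 w 0 i + ded_arrivals X n i t w
      + inv_arrivals m X n Q i t w - departures m X n Q i t w) 0} }.

Definition initial_convergence P (Q : nat -> R -> Omega -> 'rV[R]_N)
  (q0 : 'rV[R]_N) : Prop :=
  forall i, {ae P, forall w,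
    (n%:R^-1 * Q n 0 w 0 i) @[n --> \oo] --> q0 0 i}.

End systems.

(* Main.v *)
Require Import Defs.
From mathcomp Require Import all_boot all_order all_algebra.
From mathcomp Require Import all_classical all_reals all_analysis.
From mathcomp Require Import measurable_realfun ring lra.
Import Order.TTheory GRing.Theory Num.Theory.
Import numFieldNormedType.Exports.
Local Open Scope classical_set_scope.
Local Open Scope ring_scope.

Set Implicit Arguments.
Unset Strict Implicit.
Unset Printing Implicit Defensive.

(* An investor of type g joins a venue of rebate at most r_i iff g is below a
   threshold proportional to the weighted queue W = beta . q.  So chi_i is a
   difference of values of the cdf F at multiples of W, of slope at least a^-.
   The total inflow is nonincreasing in W and balances the constant service rate
   at W*, which keeps every fluid path above the level kappa; there all
   arguments of F lie in [a^- kappa, oo), where F is Lipschitz since its density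
   is bounded, and service rates are Lipschitz too.  By Gronwall, two paths that
   satisfy the fluid equations on [0, T] up to a small error are close.

   With high probability the arrival and service flows, split by investor type,
   obey the law of large numbers uniformly on [0, T] and in the type.  On that
   event the rescaled queue satisfies the fluid equations up to a small error:
   over a short step W hardly moves, so the routed flow is squeezed between
   flows with frozen thresholds.  In particular there are paths solving the
   fluid equations with error 1/k on [0, k]; they form a Cauchy sequence, and
   its limit solves the fluid equations and attracts the rescaled queues. *)

(** * Integrals on segments, Gronwall's inequality *)

(** Two obstacles shape the argument. Approximate solutions may dip below the level kappa by an
    amount proportional to their error, and there F is only known to be uniformly continuous. Hence
    the estimates on chi have the form of a Lipschitz constant times a distance plus om, where the
    Lipschitz constant is chosen before om: Gronwall's exponential stays fixed while om tends to 0.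
    The second obstacle is that the route of an order depends on the past of the queues, so no law
    of large numbers applies to the routed flow itself. It is applied instead to the flow of orders
    of type at most x, whose types are independent, and uniformity in x is required because the
    values of x used afterwards are thresholds frozen at random queue states. Since no solution of
    the fluid equations is known beforehand, a single stability estimate for approximate solutions
    has to give uniqueness, existence and convergence. It is deterministic; probability enters only
    through the event that the flows are close to their means. *)

Section integrals_on_segments.
Context {R : realType}.
Implicit Types (f g h : R -> R) (s t u T K : R).
Notation mu := (@lebesgue_measure R).

Definition bounded_upto T K g :=
  measurable_fun `[0, T] g /\ forall s, 0 <= s <= T -> 0 <= g s <= K.

Lemma bounded_upto_integrable T K g s t : bounded_upto T K g ->
  0 <= s -> t <= T -> mu.-integrable `[s, t] (EFin \o g).
Proof.
move=> [mg gK] s0 tT; apply: (@integrableS _ _ _ mu `[0, T]) => //.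
  by apply: subset_itv; rewrite bnd_simp.
apply: measurable_bounded_integrable => //.
  rewrite /= lebesgue_measure_itv /=; case: ifP => // _.
  by rewrite -EFinD ltry.
exists K; split; first exact: num_real.
move=> x Kx u /=; rewrite in_itv /= => uT.
have /andP[g0 gle] := gK u uT.
by rewrite ger0_norm// (le_trans gle)// ltW.
Qed.

Lemma segment_measure s t : s <= t -> fine (mu `[s, t]) = t - s.
Proof.
move=> st; rewrite lebesgue_measure_itv /= lte_fin.
by case: ltgtP st => //= -> _; rewrite subrr.
Qed.

Lemma Rintegral_segment T K g s t : bounded_upto T K g ->
  0 <= s <= t -> t <= T ->
  \int[mu]_(u in `[0, t]) g u - \int[mu]_(u in `[0, s]) g u =
  \int[mu]_(u in `[s, t]) g u.
Proof.
move=> gb /andP[s0 st] tT; rewrite Rintegral_itvB ?bnd_simp//; last first.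
  exact: (bounded_upto_integrable gb).
rewrite Rintegral_itv_obnd_cbnd//.
apply: (@integrableS _ _ _ mu `[s, t]) => //.
  by apply: subset_itv; rewrite bnd_simp.
exact: (bounded_upto_integrable gb).
Qed.

(** The bounds are asked only strictly after s, which is all that is known when s is a supremum of
    good times; the endpoint is a null set. *)
Lemma Rintegral_between T K g s t a b : bounded_upto T K g ->
  0 <= s <= t -> t <= T -> (forall u, s < u <= t -> a <= g u <= b) ->
  a * (t - s) <= \int[mu]_(u in `[0, t]) g u - \int[mu]_(u in `[0, s]) g u
    <= b * (t - s).
Proof.
move=> gb /andP[s0 st] tT ab.
rewrite (Rintegral_segment gb) ?s0//.
have oc : [set` `]s, t]] `<=` [set` `[s, t]] by apply: subset_itv; rewrite bnd_simp.
have ig : mu.-integrable `]s, t] (EFin \o g).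
  exact: (@integrableS _ _ _ mu `[s, t]) (bounded_upto_integrable gb s0 tT).
have ic c : mu.-integrable `[s, t] (EFin \o cst c).
  apply: (@measurable_bounded_integrable _ _ _ _ (cst c)) => //.
    rewrite /= lebesgue_measure_itv /=; case: ifP => // _.
    by rewrite -EFinD ltry.
  by exists `|c|; split; [exact: num_real|move=> x Kx u _ /=; exact: ltW].
have ic' c : mu.-integrable `]s, t] (EFin \o cst c).
  exact: (@integrableS _ _ _ mu `[s, t]).
rewrite -(segment_measure st) -!Rintegral_cst//.
rewrite -!Rintegral_itv_obnd_cbnd; try exact: ig; try exact: ic'.
apply/andP; split.
  by apply: (le_Rintegral _ (ic' a) ig) => // u /=; rewrite in_itv /= => /ab/andP[].
by apply: (le_Rintegral _ ig (ic' b)) => // u /=; rewrite in_itv /= => /ab/andP[].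
Qed.

Lemma Rintegral_upto_bounds T K g s t : bounded_upto T K g ->
  0 <= s <= t -> t <= T ->
  0 <= \int[mu]_(u in `[0, t]) g u - \int[mu]_(u in `[0, s]) g u <= K * (t - s).
Proof.
move=> gb st tT; have /andP[s0 st'] := st.
rewrite -[X in X <= _](mul0r (t - s)).
apply: (Rintegral_between gb) => // u /andP[su ut]; apply: gb.2.
by rewrite (le_trans s0 (ltW su))//= (le_trans ut).
Qed.

Lemma Rintegral_at0 g : \int[mu]_(u in `[0, 0]) g u = 0.
Proof. by rewrite set_itv1 Rintegral_set1. Qed.

Lemma bounded_upto_sum T K (I : finType) (h : I -> R -> R) :
  (forall i, bounded_upto T K (h i)) ->
  bounded_upto T (#|I|%:R * K) (fun u => \sum_i h i u).
Proof.
move=> hb; split; first by apply: measurable_sum => i; case: (hb i).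
move=> s sT; rewrite sumr_ge0/=; last by move=> i _; case/andP: ((hb i).2 s sT).
rewrite mulr_natl -sumr_const; apply: ler_sum => i _.
by case/andP: ((hb i).2 s sT).
Qed.

Lemma Rintegral_sum T K (I : finType) (h : I -> R -> R) t : 0 <= t <= T ->
  (forall i, bounded_upto T K (h i)) ->
  \sum_i \int[mu]_(u in `[0, t]) h i u = \int[mu]_(u in `[0, t]) \sum_i h i u.
Proof.
move=> /andP[t0 tT] hb; rewrite /Rintegral.
under [in RHS]eq_integral => u _ do rewrite -sumEFin.
rewrite (@integral_sum _ _ _ mu `[0, t])//; last first.
  by move=> i; exact: (bounded_upto_integrable (hb i)).
rewrite sum_fine// => i _.
by apply: integrable_fin_num => //; exact: (bounded_upto_integrable (hb i)).
Qed.

Lemma normr_RintegralB T K K' g h t c f : bounded_upto T K g ->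
  bounded_upto T K' h -> 0 <= t <= T ->
  mu.-integrable `[0, t] (EFin \o f) ->
  (forall s, 0 <= s <= t -> `|g s - h s| <= f s + c) ->
  `|\int[mu]_(u in `[0, t]) g u - \int[mu]_(u in `[0, t]) h u| <=
  \int[mu]_(u in `[0, t]) f u + c * t.
Proof.
move=> gb hb /andP[t0 tT] mf ghf.
have ig := bounded_upto_integrable gb (lexx 0) tT.
have ih := bounded_upto_integrable hb (lexx 0) tT.
have ic : mu.-integrable `[0, t] (EFin \o cst c).
  apply: (@measurable_bounded_integrable _ _ _ _ (cst c)) => //.
    rewrite /= lebesgue_measure_itv /=; case: ifP => // _.
    by rewrite -EFinD ltry.
  by exists `|c|; split; [exact: num_real|move=> x Kx u _ /=; exact: ltW].
have igh : mu.-integrable `[0, t] (EFin \o (fun s => g s - h s)).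
  exact: (integrableB _ ig ih).
have ifc : mu.-integrable `[0, t] (EFin \o (fun s => f s + c)).
  exact: (integrableD _ mf ic).
rewrite -RintegralB// -[X in _ * X]subr0 -(segment_measure t0) -Rintegral_cst//.
rewrite -RintegralD//.
apply: (le_trans (le_normr_Rintegral _ igh)) => //.
apply: (le_Rintegral _ _ ifc) => //; first exact: (integrable_norm igh).
Qed.

Lemma integral_expR L t : 0 < L -> 0 <= t ->
  mu.-integrable `[0, t] (EFin \o (fun s => expR (L * s))) /\
  \int[mu]_(s in `[0, t]) expR (L * s) = L^-1 * (expR (L * t) - 1).
Proof.
move=> L0 t0.
have ce : continuous (fun s : R => expR (L * s)).
  move=> s; apply: continuous_comp; last exact: continuous_expR.
  by apply: cvgM; [exact: cvg_cst|exact: cvg_id].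
have dv (s : R) : is_derive s 1 (fun u : R => L^-1 * expR (L * u)) (expR (L * s)).
  apply: is_derive_eq.
  by rewrite /GRing.scale /=; field; rewrite gt_eqF.
split.
  apply: continuous_compact_integrable; first exact: segment_compact.
  exact: continuous_subspaceT.
have [->|tn0] := eqVneq t 0.
  by rewrite Rintegral_at0 mulr0 expR0 subrr mulr0.
rewrite /Rintegral.
rewrite (@continuous_FTC2 _ _ (fun u : R => L^-1 * expR (L * u)) 0 t).
- by rewrite /= mulr0 expR0 mulrBr mulr1.
- by rewrite lt_neqAle eq_sym tn0.
- exact: continuous_subspaceT.
- split.
  + by move=> x _; case: (dv x).
  + apply: cvg_at_right_filter.
    by apply: cvgM; [exact: cvg_cst|exact: ce].
  + apply: cvg_at_left_filter.
    by apply: cvgM; [exact: cvg_cst|exact: ce].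
- by move=> x _; rewrite derive1E; exact: derive_val.
Qed.

(* With the weight exp (-2 L t), half of the supremum of g reappears on the
   right-hand side. *)
Lemma gronwall T K L a g : 0 <= T -> 0 < L -> 0 <= a -> bounded_upto T K g ->
  (forall t, 0 <= t <= T -> g t <= a + L * \int[mu]_(s in `[0, t]) g s) ->
  forall t, 0 <= t <= T -> g t <= 2 * a * expR (2 * L * t).
Proof.
move=> T0 L0 a0 gb hg.
pose E := [set expR (- (2 * L * t)) * g t | t in `[0, T]].
have L2 : 0 < 2 * L by rewrite mulr_gt0.
have Eub : has_ubound E.
  exists K => x [t /=]; rewrite in_itv /= => tT <-.
  have /andP[g0 gK] := gb.2 t tT.
  apply: le_trans gK; rewrite ler_piMl// -[leRHS]expR0 ler_expR oppr_le0.
  by rewrite mulr_ge0 ?(ltW L2)//; case/andP: tT.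
have En0 : E !=set0.
  by exists (expR (- (2 * L * 0)) * g 0); exists 0 => //=; rewrite in_itv /= lexx.
have gE t : 0 <= t <= T -> g t <= sup E * expR (2 * L * t).
  move=> tT; rewrite -ler_pdivrMr ?expR_gt0// -expRN mulrC.
  by apply: (ub_le_sup Eub); exists t => //=; rewrite in_itv.
have E0 : 0 <= sup E.
  apply: le_trans (ub_le_sup Eub _); last by exists 0 => //=; rewrite in_itv /= lexx.
  have /gb.2/andP[g0 _] : 0 <= (0 : R) <= T by rewrite lexx.
  by rewrite mulr_ge0 ?expR_ge0.
suff : sup E <= a + sup E / 2.
  move=> supE t tT; apply: (le_trans (gE t tT)).
  by rewrite ler_pM2r ?expR_gt0//; lra.
apply: ge_sup => // x [t /=]; rewrite in_itv /= => tT <-.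
have /andP[t0 tT'] := tT.
have [ie ie'] := integral_expR L2 t0.
have ie2 : mu.-integrable `[0, t] (EFin \o (fun s => sup E * expR (2 * L * s))).
  exact: (integrableZl _ (sup E) ie).
have : \int[mu]_(s in `[0, t]) g s <= sup E * ((2 * L)^-1 * (expR (2 * L * t) - 1)).
  rewrite -ie' -RintegralZl//; apply: (le_Rintegral _ _ ie2) => //.
  - exact: (bounded_upto_integrable gb).
  - move=> s /=; rewrite in_itv /= => /andP[s0 st].
    by apply: gE; rewrite s0 (le_trans st).
have := hg t tT.
set I := \int[mu]_(s in _) _ => h1 h2.
have e1 : 1 <= expR (2 * L * t).
  by rewrite -[leLHS]expR0 ler_expR mulr_ge0 ?(ltW L2).
rewrite expRN mulrC ler_pdivrMr ?expR_gt0//; apply: (le_trans h1).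
have -> : (a + sup E / 2) * expR (2 * L * t) =
  a * expR (2 * L * t) + L * (sup E * ((2 * L)^-1 * expR (2 * L * t))).
  by field; rewrite gt_eqF.
apply: lerD; first by rewrite ler_peMr.
rewrite ler_pM2l//; apply: (le_trans h2).
rewrite ler_wpM2l// ler_wpM2l ?invr_ge0 ?(ltW L2)//.
by rewrite gerBl.
Qed.

(** Let s be the supremum of the times up to t at which G is at least b. The Lipschitz bound carries
    [b <= G] over to s itself, and on ]s, t] the path lies below b, so that G s <= G t. *)
Lemma barrier T C b (G : R -> R) : 0 <= C -> b <= G 0 ->
  (forall s t, 0 <= s <= t -> t <= T -> `|G t - G s| <= C * (t - s)) ->
  (forall s t, 0 <= s <= t -> t <= T -> (forall u, s < u <= t -> G u < b) ->
    G s <= G t) ->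
  forall t, 0 <= t <= T -> b <= G t.
Proof.
move=> C0 b0 lip inc t /andP[t0 tT].
pose E := [set s | 0 <= s <= t /\ b <= G s].
have E0 : E 0 by split=> //; rewrite lexx.
have supE : has_sup E.
  by split; [exists 0|exists t => s [/andP[]]].
have u0 : 0 <= sup E by exact: (sup_upper_bound supE).
have ut : sup E <= t by apply: ge_sup; [exists 0|move=> s [/andP[]]].
apply: (@le_trans _ _ (G (sup E))); last first.
  apply: inc => //; first by rewrite u0.
  move=> u /andP[su ut']; rewrite ltNge; apply/negP => bu.
  have : u <= sup E.
    by apply: (sup_upper_bound supE); split=> //; rewrite (le_trans u0 (ltW su)).
  by rewrite leNgt su.
apply/ler_addgt0Pr => e e0.
have e1 : 0 < e / (C + 1) by rewrite divr_gt0// ltr_wpDl.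
have [s [/andP[s0 st] bs] us] := sup_adherent e1 supE.
have su : s <= sup E by apply: (sup_upper_bound supE); split=> //; rewrite s0.
have := lip s (sup E); rewrite s0 su => /(_ isT (le_trans ut tT)).
rewrite ler_norml => /andP[+ _] => h.
apply: (le_trans bs); rewrite -lerBlDl; apply: le_trans (_ : C * (sup E - s) <= _).
  by lra.
apply: (@le_trans _ _ (C * (e / (C + 1)))); first by rewrite ler_wpM2l//; lra.
by rewrite mulrCA ler_piMr ?(ltW e0)// ler_pdivrMr ?mul1r ?lerDl// ltr_wpDl.
Qed.

End integrals_on_segments.

(** * Routing thresholds *)

Section thresholds.
Context {R : realType} {N : nat}.
Implicit Types (m : lob R N) (q : 'rV[R]_N) (K : pred (option 'I_N)).

Definition delay_coef m (o : option 'I_N) : R :=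
  if o is Some i then (mo_rate m * weight m 0 i * mo_size m)^-1 else 0.

(** All delays are multiples of the weighted queue, so up to ties the choice of venue depends on q
    through that number only. *)
Lemma delayE m q o : delay m q o = dotv (weight m) q * delay_coef m o.
Proof.
case: o => [i|] /=; last by rewrite mulr0.
by congr (_ * _^-1); ring.
Qed.

Lemma dotv_ge0 m q : lob_axioms m -> nonnegv q -> 0 <= dotv (weight m) q.
Proof.
by move=> hm q0; apply: sumr_ge0 => i _; rewrite mulr_ge0// ltW// weight_gt0.
Qed.

(** Venue 0 always competes, and its term is positive because it has a smaller rebate and no
    delay. *)
Lemma a_minus_gt0 m i : lob_axioms m -> (0 < a_minus m i)%E.
Proof.
move=> hm; rewrite /a_minus.
have r0i : rebate m None < rebate m (Some i).
  by rewrite (lt_le_trans (rebate0_lt0 hm))// rebate_ge0.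
apply: (lt_le_trans _ (le_bigmax_cond _ _ r0i)); rewrite subr0 lte_fin.
by rewrite mulr_gt0// invr_gt0 ?subr_gt0// !mulr_gt0// ?mo_rate_gt0 ?weight_gt0 ?mo_size_gt0.
Qed.

(** Draw each venue as the point (rebate, delay coefficient) and take k whose slope from the point
    of venue 0 is smallest. A venue j of lower rebate than k lies on or above that line, so the
    slope from j to k is at most the slope from 0 to k: the maximum defining [a_minus m k] is
    reached at venue 0. *)
Lemma a_minus_min_le m i : lob_axioms m ->
  (a_minus_min m <=
   ((rebate m (Some i) - rebate m None)^-1 * delay_coef m (Some i))%:E)%E.
Proof.
move=> hm; pose ratio j :=
  (rebate m (Some j) - rebate m None)^-1 * delay_coef m (Some j).
have [k _ kmin] := @arg_minP _ _ _ i predT ratio isT.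
apply: (@le_trans _ _ (ratio k)%:E); last by rewrite lee_fin kmin.
have r0 j : 0 < rebate m (Some j) - rebate m None.
  by rewrite subr_gt0 (lt_le_trans (rebate0_lt0 hm))// rebate_ge0.
have cE j : delay_coef m (Some j) = ratio j * (rebate m (Some j) - rebate m None).
  by rewrite /ratio mulrAC mulVf ?mul1r// gt_eqF.
apply: (@le_trans _ _ (a_minus m k)); first exact: bigmin_le_cond.
apply: bigmax_le => [|[j|] jk]; first exact: leNye.
  rewrite -!/(delay_coef m (Some _)) !cE lee_fin mulrC ler_pdivrMr ?subr_gt0//.
  have := kmin j isT; have := r0 j.
  set x := rebate m (Some j); set y := rebate m (Some k).
  set z := rebate m None => zx.
  rewrite -(ler_pM2r zx); lra.
by rewrite subr0.
Qed.

Lemma a_minus_minE m : (0 < N)%N -> lob_axioms m ->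
  exists2 a : R, 0 < a & a_minus_min m = a%:E.
Proof.
move=> N0 hm.
have a0 : (0 < a_minus_min m)%E.
  by apply: lt_bigmin => [|i _]; [exact: ltry|exact: a_minus_gt0].
have := a_minus_min_le (Ordinal N0) hm.
by case: (a_minus_min m) a0 => // a; rewrite lte_fin; exists a.
Qed.

(* [None] stands for an infinite threshold. *)
Definition is_threshold m K (th : option R) := forall g q, 0 < g -> nonnegv q ->
  if th is Some t then
    (g < t * dotv (weight m) q -> K (route m g q)) /\
    (t * dotv (weight m) q < g -> ~~ K (route m g q))
  else K (route m g q).

(* The threshold is the max over j in K of the min over k outside K of the
   type, per unit of weighted queue, that is indifferent between j and k. *)
Lemma threshold_exists m K : lob_axioms m -> K None ->
  (forall j k, K j -> ~~ K k -> rebate m j < rebate m k) ->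
  exists2 th, is_threshold m K th &
    forall t, th = Some t -> (a_minus_min m <= t%:E)%E.
Proof.
move=> hm K0 hK.
have [Kfull|] := pselect (forall o, K o).
  by exists None => // g q g0 q0; exact: Kfull.
move/existsNP => [k0 /negP nK0].
pose ratio j k := (rebate m k - rebate m j)^-1 * (delay_coef m k - delay_coef m j).
pose best j := [arg min_(k < k0 | ~~ K k) ratio j k]%O.
have bestP j : ~~ K (best j) /\ forall k, ~~ K k -> ratio j (best j) <= ratio j k.
  by rewrite /best; case: arg_minP.
have [j Kj jmax] := @arg_maxP _ _ _ None K (fun j => ratio j (best j)) K0.
exists (Some (ratio j (best j))); last first.
  (* The maximum over K dominates its value at [None], which is a slope from venue 0. *)
  move=> _ [<-]; have := jmax None K0; rewrite /= -lee_fin; apply: le_trans.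
  have [nb _] := bestP None; case: (best None) nb => [i _|]; last by rewrite K0.
  by rewrite /ratio subr0; exact: a_minus_min_le.
move=> g q g0 q0; set W := dotv _ _.
have W0 : 0 <= W by exact: dotv_ge0.
have max o := routeP hm o g0 q0.
split=> hg.
  case: (boolP (K _)) => // nK; set k := route m g q in nK.
  have := max j; rewrite -/k !delayE -/W leNgt => /negP[].
  have rjk := hK _ _ Kj nK.
  have : g < ratio j k * W.
    by apply: (lt_le_trans hg); rewrite ler_wpM2r//; exact: (bestP j).2.
  rewrite /ratio -mulrA mulrC ltr_pdivlMr ?subr_gt0//; lra.
apply/negP => Kr; set j' := route m g q in Kr.
have [nK hb] := bestP j'; set k := best j' in nK hb.
have := max k; rewrite -/j' !delayE -/W leNgt => /negP[].
have rjk := hK _ _ Kr nK.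
have : ratio j' k * W < g.
  by apply: (le_lt_trans _ hg); rewrite ler_wpM2r//; exact: jmax.
rewrite /ratio -mulrA mulrC ltr_pdivrMr ?subr_gt0//; lra.
Qed.

End thresholds.

(** * Mass of the types that join a set of venues *)

Lemma probabilityU d (T : measurableType d) (R : realType)
  (P : probability T R) (A B : set T) : measurable A -> measurable B ->
  A `&` B = set0 -> P (A `|` B) = (P A + P B)%E.
Proof. exact: measureU. Qed.

Lemma probabilityD d (T : measurableType d) (R : realType)
  (P : probability T R) (A B : set T) : measurable A -> measurable B ->
  B `<=` A -> P (A `\` B) = (P A - P B)%E.
Proof.
move=> mA mB BA; rewrite -[in RHS](setIidr BA).
by apply: measureD => //; rewrite ltey_eq fin_num_measure.
Qed.

Lemma probability_bigU d (T : measurableType d) (R : realType)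
  (P : probability T R) (J : finType) (A : J -> set T) :
  (forall i, measurable (A i)) -> trivIset setT A ->
  P (\bigcup_i A i) = (\sum_i P (A i))%E.
Proof.
move=> mA dA.
suff H s : uniq s -> P (\bigcup_(i in [set` s]) A i) = (\sum_(i <- s) P (A i))%E.
  rewrite -big_enum /= -H ?enum_uniq//; congr (P _).
  by apply: eq_bigcupl; split => i //= _; rewrite mem_enum.
elim: s => [_|i s IH /= /andP[iNs us]].
  by rewrite big_nil set_nil bigcup_set0 measure0.
rewrite big_cons -IH// !bigcup_seq big_cons probabilityU//.
  by apply: bigsetU_measurable.
rewrite -bigcup_seq -subset0 => x [Ax [j /= js Ajx]].
have /(dA i j I I) ij : A i `&` A j !=set0 by exists x.
by rewrite ij js in iNs.
Qed.

Section type_distribution.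
Context {R : realType} {N : nat}.
Variables (m : lob R N).
Hypothesis hm : lob_axioms m.
Notation F := (type_cdf m).
Implicit Types (q : 'rV[R]_N) (K : pred (option 'I_N)) (x y t : R) (th : option R).

Lemma type_cdfE x : type_dist m `]-oo, x]%classic = (F x)%:E.
Proof. by rewrite /type_cdf fineK// fin_num_measure. Qed.

Lemma type_cdf_ge0 x : 0 <= F x.
Proof. by rewrite /type_cdf fine_ge0. Qed.

Lemma type_cdf_le1 x : F x <= 1.
Proof. by rewrite -lee_fin -type_cdfE probability_le1. Qed.

Lemma type_cdf_nd : {homo F : x y / x <= y}.
Proof.
move=> x y xy; rewrite -lee_fin -!type_cdfE le_measure ?inE//.
by apply: subset_itv; rewrite bnd_simp.
Qed.

Lemma type_dist_nonpos x : x <= 0 -> type_dist m `]-oo, x]%classic = 0%E.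
Proof.
move=> x0; apply/eqP; rewrite eq_le measure_ge0 andbT.
have : (type_dist m (`]-oo, x] `|` `]0%R, +oo[)%classic <= 1)%E.
  by apply: probability_le1; exact: measurableU.
rewrite probabilityU//; first by rewrite type_dist_pos// type_cdfE -EFinD !lee_fin; lra.
rewrite -subset0 => y [] /=; rewrite !in_itv /= andbT => yx y0.
by have := lt_le_trans y0 (le_trans yx x0); rewrite ltxx.
Qed.

Lemma type_cdf_nonpos x : x <= 0 -> F x = 0.
Proof. by move=> x0; rewrite /type_cdf type_dist_nonpos. Qed.

Definition cdf_at th := if th is Some x then F x else 1.

Lemma cdf_at_bounds th : 0 <= cdf_at th <= 1.
Proof. by case: th => [x|] /=; rewrite ?type_cdf_ge0 ?type_cdf_le1 ?ler01 ?lexx. Qed.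

Definition scale_threshold th (W : R) := omap (fun t => t * W) th.

(** Ties are broken arbitrarily, so nothing is known about the indifferent type x. Whether or not it
    belongs to A, the set A is one of two intervals, hence measurable, and x carries no mass. *)
Lemma pos_interval_measure (A : set R) x : `]0, x[ `<=` A -> A `<=` `]0, x] ->
  measurable A /\ type_dist m A = (F x)%:E.
Proof.
move=> lA Au.
have eo (B : set R) : measurable B -> `]0, x[ `<=` B -> B `<=` `]0, x] ->
    type_dist m B = (F x)%:E.
  move=> mB lB Bu; rewrite -type_cdfE.
  have -> : type_dist m `]-oo, x]%classic = type_dist m (`]-oo, x] `&` `]0%R, +oo[)%classic.
    rewrite [in LHS](_ : [set` `]-oo, x]] =
        (`]-oo, x] `&` `]0%R, +oo[) `|` (`]-oo, x] `&` `]-oo, 0%R])); last first.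
      apply/seteqP; split => y /=; rewrite !in_itv /= ?andbT.
        by move=> yx; have [y0|y0] := ltP 0 y; [left|right].
      by case=> -[].
    rewrite probabilityU; [|exact: measurableI|exact: measurableI|]; last first.
      rewrite -subset0 => y [] /=; rewrite !in_itv /= andbT => -[_ y0] [_].
      by rewrite leNgt y0.
    rewrite -[RHS]adde0; congr (_ + _)%E.
    apply/eqP; rewrite eq_le measure_ge0 andbT -(type_dist_nonpos (lexx 0)).
    by apply: le_measure; rewrite ?inE//; exact: measurableI.
  have BS : B `<=` `]-oo, x] `&` `]0%R, +oo[.
    by move=> y /Bu /=; rewrite !in_itv /= andbT => /andP[].
  apply/eqP; rewrite eq_le; apply/andP; split.
    by apply: le_measure; rewrite ?inE//; exact: measurableI.
  apply: (@le_trans _ _ (type_dist m (B `|` [set x]))).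
    apply: le_measure; rewrite ?inE//; [exact: measurableI|exact: measurableU|].
    move=> y [] /=; rewrite !in_itv /= andbT => yx y0.
    have [->|yNx] := eqVneq y x; first by right.
    by left; apply: lB; rewrite /= in_itv /= y0 lt_neqAle yNx.
  have : (type_dist m (B `|` [set x]) <= type_dist m B + type_dist m [set x])%E.
    exact: measureU2.
  by rewrite type_dist_atomless// adde0.
suff mA : measurable A by split => //; exact: eo.
have [xA|xA] := pselect (A x).
  have [x0|x0] := ltP 0 x.
    rewrite (_ : A = `]0, x]%classic)//; apply/seteqP; split => // y /=.
    rewrite in_itv /= => /andP[y0]; rewrite le_eqVlt => /predU1P[->//|yx].
    by apply: lA; rewrite /= in_itv /= y0.
  by have := Au _ xA; rewrite /= in_itv /= ltNge x0.
rewrite (_ : A = `]0, x[%classic)//; apply/seteqP; split => // y Ay /=.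
have := Au _ Ay; rewrite /= !in_itv /= => /andP[-> ] /=; rewrite le_eqVlt => /predU1P[yx|//].
by rewrite -yx in xA.
Qed.

Lemma lower_types_measure K th q : is_threshold m K th -> nonnegv q ->
  measurable [set g | 0 < g /\ K (route m g q)] /\
  type_dist m [set g | 0 < g /\ K (route m g q)] =
  (cdf_at (scale_threshold th (dotv (weight m) q)))%:E.
Proof.
move=> hth q0; set W := dotv _ _; case: th hth => [t|] hth /=.
  apply: pos_interval_measure => g /=; rewrite in_itv /=.
    by move=> /andP[g0 gt]; split => //; exact: (hth g q g0 q0).1.
  move=> [g0 gK]; rewrite g0 /= leNgt; apply/negP => /(hth g q g0 q0).2.
  by rewrite gK.
rewrite (_ : [set g | _] = `]0%R, +oo[%classic); first by rewrite type_dist_pos.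
apply/seteqP; split => g /=; rewrite in_itv /= andbT; first by case.
by move=> g0; split => //; exact: hth.
Qed.

(** Rebates are distinct, so venue i is chosen iff the chosen rebate is at most r_i but not smaller.
    Both sets of venues are closed under lowering the rebate and contain [None], as r_0 < 0 <= r_i,
    and so have thresholds. *)
Lemma chi_thresholds i : exists ths : option R * option R,
  [/\ is_threshold m (fun o => rebate m o <= rebate m (Some i)) ths.1,
      is_threshold m (fun o => rebate m o < rebate m (Some i)) ths.2,
      forall t, ths.1 = Some t \/ ths.2 = Some t -> (a_minus_min m <= t%:E)%E &
      forall q, nonnegv q -> measurable (type_set m q i) /\
        chi m q i = cdf_at (scale_threshold ths.1 (dotv (weight m) q)) -
                    cdf_at (scale_threshold ths.2 (dotv (weight m) q))].
Proof.
have r0i : rebate m None < rebate m (Some i).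
  by rewrite (lt_le_trans (rebate0_lt0 hm))// rebate_ge0.
have [th1 h1 l1] : exists2 th,
    is_threshold m (fun o => rebate m o <= rebate m (Some i)) th &
    forall t, th = Some t -> (a_minus_min m <= t%:E)%E.
  apply: threshold_exists => //; first exact: ltW.
  by move=> j k jK; rewrite -ltNge; exact: le_lt_trans.
have [th2 h2 l2] : exists2 th,
    is_threshold m (fun o => rebate m o < rebate m (Some i)) th &
    forall t, th = Some t -> (a_minus_min m <= t%:E)%E.
  apply: threshold_exists => //.
  by move=> j k jK; rewrite -leNgt; exact: lt_le_trans.
exists (th1, th2); split => //; first by move=> t [/l1|/l2].
move=> q q0.
have [m1 e1] := lower_types_measure h1 q0.
have [m2 e2] := lower_types_measure h2 q0.
have -> : type_set m q i =
    [set g | 0 < g /\ rebate m (route m g q) <= rebate m (Some i)] `\`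
    [set g | 0 < g /\ rebate m (route m g q) < rebate m (Some i)].
  apply/seteqP; split => g /=.
    by move=> [g0 ->]; split=> // -[_]; rewrite ltxx.
  move=> [[g0 gle] gn]; split=> //; apply: (rebate_inj hm); apply/eqP.
  rewrite eq_le gle /= leNgt; apply/negP => glt; exact: gn.
split; first exact: measurableD.
rewrite /chi (_ : type_set m q i =
    [set g | 0 < g /\ rebate m (route m g q) <= rebate m (Some i)] `\`
    [set g | 0 < g /\ rebate m (route m g q) < rebate m (Some i)]).
  rewrite probabilityD//; last by move=> g /= [g0 /ltW].
  by rewrite e1 e2 -EFinB.
apply/seteqP; split => g /=.
  by move=> [g0 ->]; split=> // -[_]; rewrite ltxx.
move=> [[g0 gle] gn]; split=> //; apply: (rebate_inj hm); apply/eqP.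
rewrite eq_le gle /= leNgt; apply/negP => glt; exact: gn.
Qed.

(** A positive type joins exactly one venue or is routed to [None]. The total is thus governed by
    one threshold, which makes it monotone in the weighted queue although a single chi_i need not
    be. *)
Lemma sum_chi : exists2 th : option R,
  forall q, nonnegv q -> \sum_(i < N) chi m q i =
    1 - cdf_at (scale_threshold th (dotv (weight m) q)) &
  forall t, th = Some t -> (a_minus_min m <= t%:E)%E.
Proof.
have [th hth lth] : exists2 th, is_threshold m (pred1 None) th &
    forall t, th = Some t -> (a_minus_min m <= t%:E)%E.
  apply: threshold_exists => // j k /eqP -> ; case: k => [k _|] //.
  by rewrite (lt_le_trans (rebate0_lt0 hm))// rebate_ge0.
exists th => // q q0.
have [mE eE] := lower_types_measure hth q0.
have mt i : measurable (type_set m q i).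
  by have [ths [_ _ _ /(_ q q0)[]]] := chi_thresholds i.
apply/(@EFin_inj R); rewrite EFinB -eE -sumEFin.
under eq_bigr => i _ do rewrite /chi fineK ?fin_num_measure//.
rewrite -probability_bigU//; last first.
  move=> i j _ _ [g [[_ gi] [_ gj]]].
  by move: gi; rewrite gj => -[].
rewrite -(type_dist_pos hm).
rewrite (_ : [set` `]0, +oo[] = (\bigcup_i type_set m q i) `|`
   [set g | 0 < g /\ (pred1 None) (route m g q)]).
  rewrite probabilityU//.
  - by rewrite addeK// fin_num_measure.
  - by apply: fin_bigcup_measurable.
  - rewrite -subset0 => g [[i _ [_ gi]] [_] /=].
    by rewrite gi.
apply/seteqP; split => g /=.
  rewrite in_itv /= andbT => g0.
  case E : (route m g q) => [i|]; last by right.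
  by left; exists i.
by case=> [[i _ [g0 _]]|[g0 _]]; rewrite in_itv /= g0.
Qed.

End type_distribution.

Lemma finite_scale (R : realType) (I : finType) (P : I -> R -> Prop) :
  (forall i x y, 0 < y -> y <= x -> P i x -> P i y) ->
  (forall i, exists2 x, 0 < x & P i x) -> exists2 x, 0 < x & forall i, P i x.
Proof.
move=> Pd Pex; have [x x0 Px] : exists2 x : I -> R, (forall i, 0 < x i) & forall i, P i (x i).
  have [x hx] := choice (fun i => let: ex_intro2 x x0 Px := Pex i in
    ex_intro (fun x => 0 < x /\ P i x) x (conj x0 Px)).
  by exists x => i; case: (hx i).
have m0 : 0 < \big[Order.min/1]_i x i by apply: lt_bigmin => // i _; exact: x0.
exists (\big[Order.min/1]_i x i) => // i.
by apply: Pd (Px i) => //; exact: bigmin_le_cond.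
Qed.

Lemma finite_bound (R : realType) (I : finType) (P : I -> R -> Prop) :
  (forall i x y, x <= y -> P i x -> P i y) ->
  (forall i, exists x, P i x) -> exists2 x, 0 < x & forall i, P i x.
Proof.
move=> Pu Pex; have [x hx] := choice Pex.
exists (1 + \sum_i `|x i|).
  by rewrite ltr_pwDl// sumr_ge0.
move=> i; apply: Pu (hx i); rewrite (bigD1 i)//=.
have : 0 <= \sum_(j | j != i) `|x j| by rewrite sumr_ge0.
by have := ler_norm (x i); lra.
Qed.

(** * Regularity of the drift *)

Section drift.
Context {R : realType} {N : nat}.
Variables (m : lob R N).
Hypothesis hm : lob_axioms m.
Notation F := (type_cdf m).
Notation mu := (@lebesgue_measure R).
Implicit Types (q : 'rV[R]_N) (x y t : R) (th : option R).

Section density.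
Variable f : R -> R.
Hypothesis hf : cdf_density m f.

Lemma density_integrable x : mu.-integrable `]-oo, x] (EFin \o f).
Proof.
apply/integrableP; split.
  by apply/measurable_EFinP; apply: measurable_funTS; exact: density_measurable hf.
under eq_integral => y _ do rewrite /= ger0_norm ?(density_ge0 hf)//.
by rewrite -(density_cdf hf) ltry.
Qed.

(** Monotone convergence along ]-oo, n], where the integrals are values of F and hence at most 1. *)
Lemma density_integrableT : mu.-integrable setT (EFin \o f).
Proof.
apply/integrableP; split.
  by apply/measurable_EFinP; exact: density_measurable hf.
under eq_integral => y _ do rewrite /= ger0_norm ?(density_ge0 hf)//.
have -> : [set: R] = \bigcup_n [set` `]-oo, (n%:R : R)]].
  apply/seteqP; split => // x _; exists (Num.truncn `|x|).+1 => //=.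
  rewrite in_itv /= (le_trans (ler_norm _))// ltW//.
  by apply: truncnS_gt.
set I := (X in (X < _)%E).
have : (\int[mu]_(y in `]-oo, (n%:R : R)]) (f y)%:E @[n --> \oo] --> I)%E.
  apply: ge0_nondecreasing_set_cvg_integral => //.
  - move=> n p np; apply/subsetPset/subset_itv; rewrite bnd_simp//.
    by rewrite ler_nat.
  - by move=> n; apply/measurable_EFinP; apply: measurable_funTS; exact: density_measurable hf.
  - by move=> n x _; rewrite lee_fin (density_ge0 hf).
move=> cI; apply: (@le_lt_trans _ _ 1%E); last exact: ltry.
apply: (cvge_to_le cI); apply: nearW => n.
by rewrite -(density_cdf hf) lee_fin type_cdf_le1.
Qed.

Lemma type_cdfB x y : x <= y -> F y - F x = \int[mu]_(u in `]x, y]) f u.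
Proof.
move=> xy; rewrite -(@Rintegral_itvB _ f -oo%O (BRight y) x) ?bnd_simp//.
  by rewrite /Rintegral -!(density_cdf hf).
exact: density_integrable.
Qed.

(** Absolute continuity of the integral of the density. It covers arguments slightly below
    [a * kappa], where the density may be unbounded. *)
Lemma type_cdf_uniform_continuous (e : R) : 0 < e ->
  exists2 d : R, 0 < d & forall x y, `|x - y| <= d -> `|F x - F y| <= e.
Proof.
move=> e0; have [d [d0 hd]] := integral_normr_continuous density_integrableT e0.
exists (d / 2); first by rewrite divr_gt0.
suff H x y : x <= y -> y - x <= d / 2 -> `|F x - F y| <= e.
  move=> x y; have [xy|/ltW yx] := leP x y.
    by rewrite distrC ger0_norm ?subr_ge0//; exact: H.
  by rewrite ger0_norm ?subr_ge0// distrC; exact: H.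
move=> xy yx; rewrite distrC type_cdfB//.
have ixy : mu.-integrable `]x, y] (EFin \o f) by exact: integrableS density_integrableT.
apply: (le_trans (le_normr_Rintegral _ ixy)) => //.
apply/ltW/hd => //; rewrite /= lebesgue_measure_itv /= lte_fin.
case: ifP => // _; rewrite ?lte_fin//; lra.
Qed.

(** For u > z > 0 the hypothesis gives z f(u) <= u f(u) < z f(z), so f(z) bounds the density on [z,
    +oo[. *)
Lemma type_cdf_lipschitz z : 0 < z ->
  (forall x y, z <= x -> x < y -> y * f y < x * f x) ->
  forall x y, z <= x -> z <= y -> `|F x - F y| <= f z * `|x - y|.
Proof.
move=> z0 zf; suff H x y : z <= x -> x <= y -> `|F x - F y| <= f z * `|x - y|.
  move=> x y zx zy; have [xy|/ltW yx] := leP x y; first exact: H.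
  by rewrite distrC [X in _ * X]distrC; exact: H.
move=> zx xy; rewrite distrC type_cdfB//.
rewrite [X in _ * X]distrC (ger0_norm (_ : 0 <= y - x)) ?subr_ge0//.
have ixy : mu.-integrable `]x, y] (EFin \o f) by exact: integrableS density_integrableT.
have muxy : mu `]x, y] = (y - x)%:E.
  rewrite lebesgue_measure_itv /= lte_fin; case: ltgtP xy => // -> _.
  by rewrite subrr.
rewrite ger0_norm; last by apply: Rintegral_ge0 => u _; exact: density_ge0 hf _.
rewrite -[y - x]/(fine (y - x)%:E) -muxy -Rintegral_cst//.
apply: le_Rintegral => //.
  apply: (@measurable_bounded_integrable _ _ _ _ (cst (f z))) => //.
    by rewrite /= muxy ltry.
  by exists `|f z|; split; [exact: num_real|move=> K Kx u _ /=; exact: ltW].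
move=> u /=; rewrite in_itv /= => /andP[xu uy].
have zu : z < u by exact: le_lt_trans xu.
have := zf z u (lexx _) zu; have := density_ge0 hf u => fu0 h.
rewrite -(ler_pM2l z0); apply: le_trans (ltW h).
by rewrite ler_wpM2r// ltW.
Qed.

End density.

(** The l1 distance, for which coordinatewise estimates simply add up; the norm of the theorem is
    compared with it only in the last part. *)
Definition ldist q q' : R := \sum_i `|q 0 i - q' 0 i|.

Lemma ldist_ge0 q q' : 0 <= ldist q q'.
Proof. exact: sumr_ge0. Qed.

Lemma coord_le_ldist q q' i : `|q 0 i - q' 0 i| <= ldist q q'.
Proof. by rewrite /ldist (bigD1 i)//= lerDl sumr_ge0. Qed.

Variables a kappa : R.
Hypotheses (a0 : 0 < a) (aE : a_minus_min m = a%:E) (kappa0 : 0 < kappa).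
Hypothesis Fuc : forall e : R, 0 < e ->
  exists2 d : R, 0 < d & forall x y, `|x - y| <= d -> `|F x - F y| <= e.
Hypothesis Flip : exists L : R,
  forall x y, a * kappa <= x -> a * kappa <= y -> `|F x - F y| <= L * `|x - y|.

Lemma normr_maxB x y z : `|Num.max x z - Num.max y z| <= `|x - y|.
Proof.
rewrite /Num.max; case: ltP => h1; case: ltP => h2; rewrite ?subrr ?normr0 ?normr_ge0//.
- rewrite distrC [leRHS]distrC !ger0_norm; lra.
- rewrite !ger0_norm; lra.
Qed.

(** Replacing W by the maximum of W and kappa moves the argument of F by at most [eta * t], which
    costs [om / 2] by uniform continuity. After the replacement the arguments are at least
    [a * kappa], where F is Lipschitz. L is fixed before om; only eta shrinks with om. *)
Lemma threshold_modulus th :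
  (forall t, th = Some t -> (a_minus_min m <= t%:E)%E) ->
  exists L : R, forall om, 0 < om -> exists2 eta, 0 < eta &
  forall W W', kappa - eta <= W -> kappa - eta <= W' ->
  `|cdf_at m (scale_threshold th W) - cdf_at m (scale_threshold th W')|
    <= L * `|W - W'| + om.
Proof.
case: th => [t|_] /=; last first.
  by exists 0 => om om0; exists 1 => // W W' _ _; rewrite subrr normr0 mul0r add0r ltW.
move=> /(_ _ erefl); rewrite aE lee_fin => at'.
have t0 : 0 < t by exact: lt_le_trans at'.
have [L hL] := Flip; exists (`|L| * t) => om om0.
have [d d0 hd] := Fuc (divr_gt0 om0 (ltr0n R 2)).
exists (d / t); first by rewrite divr_gt0.
move=> W W' hW hW'.
have hmax V : kappa - d / t <= V -> `|F (V * t) - F (Num.max V kappa * t)| <= om / 2.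
  move=> hV; apply: hd; rewrite -mulrBl normrM (gtr0_norm t0) -ler_pdivlMr//.
  rewrite /Num.max; case: ltP => h; first by rewrite ler0_norm; lra.
  by rewrite subrr normr0 divr_ge0 ?(ltW d0) ?(ltW t0).
rewrite ![t * _]mulrC.
have hk V : a * kappa <= Num.max V kappa * t.
  by rewrite mulrC ler_pM ?(ltW a0) ?(ltW kappa0)// le_max lexx orbT.
have := hL _ _ (hk W) (hk W').
rewrite -mulrBl normrM (gtr0_norm t0) => h.
have : `|F (Num.max W kappa * t) - F (Num.max W' kappa * t)| <= `|L| * t * `|W - W'|.
  apply: (le_trans h); apply: (@le_trans _ _ (`|L| * (`|Num.max W kappa - Num.max W' kappa| * t))).
    by rewrite ler_wpM2r ?mulr_ge0 ?(ltW t0) ?ler_norm.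
  by rewrite -mulrA ler_wpM2l// mulrC ler_wpM2l ?(ltW t0)// normr_maxB.
have := hmax _ hW; have := hmax _ hW'; clear h hmax hk.
set x := F (W * t); set y := F (W' * t).
set x' := F (Num.max W kappa * t); set y' := F (Num.max W' kappa * t).
rewrite [`|y - y'|]distrC => h1 h2 h3.
have -> : x - y = (x - x') + (x' - y') + (y' - y) by ring.
rewrite (le_trans (ler_normD _ _))//; have := ler_normD (x - x') (x' - y'); lra.
Qed.

Lemma weight_bounds : (0 < N)%N -> exists b1 b2 : R, [/\ 0 < b1, 0 < b2,
  weight_min m = b1, weight_max m = b2 & forall i, b1 <= weight m 0 i <= b2].
Proof.
move=> N0; exists (weight_min m), (weight_max m); rewrite /weight_min /weight_max.
have h1 i := @bigmin_le_cond _ _ _ +oo%E i xpredT (fun i => (weight m 0 i)%:E) isT.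
have h2 i := @le_bigmax_cond _ _ _ -oo%E i xpredT (fun i => (weight m 0 i)%:E) isT.
have h3 : (0 < \big[Order.min/+oo]_(i < N) (weight m 0 i)%:E)%E.
  by apply: lt_bigmin => [|i _]; [exact: ltry|rewrite lte_fin weight_gt0].
have h4 : (\big[Order.max/-oo]_(i < N) (weight m 0 i)%:E < +oo)%E.
  by apply: bigmax_lt => [|i _]; [exact: ltNye|rewrite ltry].
have f1 : \big[Order.min/+oo%E]_(i < N) (weight m 0 i)%:E \is a fin_num.
  by rewrite gt0_fin_numE// (le_lt_trans (h1 (Ordinal N0)))// ltry.
have f2 : \big[Order.max/-oo%E]_(i < N) (weight m 0 i)%:E \is a fin_num.
  by rewrite fin_numElt h4 (lt_le_trans _ (h2 (Ordinal N0)))// ltNye.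
split=> //.
- by apply: fine_gt0; rewrite h3 /= (le_lt_trans (h1 (Ordinal N0)))// ltry.
- apply: fine_gt0; rewrite h4 andbT (lt_le_trans _ (h2 (Ordinal N0)))//.
  by rewrite lte_fin weight_gt0.
- by move=> i; rewrite -!lee_fin !fineK// h1 h2.
Qed.

Lemma dotv_dist b q q' : (forall i, weight m 0 i <= b) ->
  `|dotv (weight m) q - dotv (weight m) q'| <= b * ldist q q'.
Proof.
move=> hb; rewrite /dotv /ldist -sumrB mulr_sumr.
apply: (le_trans (ler_norm_sum _ _ _)); apply: ler_sum => i _.
by rewrite -mulrBr normrM gtr0_norm ?weight_gt0// ler_wpM2r.
Qed.

Lemma serv_ge0 q i : nonnegv q -> 0 <= serv m q i.
Proof.
move=> q0; rewrite /serv divr_ge0 ?dotv_ge0//.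
by rewrite !mulr_ge0 ?(ltW (mo_rate_gt0 hm)) ?(ltW (weight_gt0 hm i)) ?q0.
Qed.

Lemma weighted_coord_le q i : nonnegv q ->
  0 <= weight m 0 i * q 0 i <= dotv (weight m) q.
Proof.
move=> q0; have h j : 0 <= weight m 0 j * q 0 j by rewrite mulr_ge0// ltW ?weight_gt0.
by rewrite h /dotv (bigD1 i)//= lerDl sumr_ge0.
Qed.

Lemma serv_le q i : nonnegv q -> serv m q i <= mo_rate m.
Proof.
move=> q0; rewrite /serv.
have /andP[h1 h2] := weighted_coord_le i q0.
have mu0 := mo_rate_gt0 hm.
have [W0|W0] := eqVneq (dotv (weight m) q) 0; first by rewrite W0 invr0 mulr0 ltW.
have Wp : 0 < dotv (weight m) q by rewrite lt_neqAle eq_sym W0 dotv_ge0.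
by rewrite ler_pdivrMr// ler_pM2l.
Qed.

Lemma sum_serv q : dotv (weight m) q != 0 -> \sum_i serv m q i = mo_rate m.
Proof.
move=> W0; rewrite /serv -mulr_suml -mulr_sumr -/(dotv _ _).
by rewrite mulfK.
Qed.

Lemma serv_lipschitz b c q q' i : 0 < c -> (forall i, weight m 0 i <= b) ->
  nonnegv q -> nonnegv q' ->
  c <= dotv (weight m) q -> c <= dotv (weight m) q' ->
  `|serv m q i - serv m q' i| <= mo_rate m * (2 * b / c) * ldist q q'.
Proof.
move=> c0 hb q0 q0' cW cW'; rewrite /serv.
have hd := dotv_dist q q' hb.
have /andP[h1 h2] := weighted_coord_le i q0'.
set W := dotv _ q in cW hd *; set W' := dotv _ q' in cW' hd h2 *.
have W0 : 0 < W by exact: lt_le_trans cW.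
have W0' : 0 < W' by exact: lt_le_trans cW'.
have mu0 := mo_rate_gt0 hm.
(* The first term varies the numerator. The second varies the denominator, and its factor
   [weight m 0 i * q' 0 i / W'] is at most 1. Each contributes at most [b * ldist q q' / c]. *)
have -> : mo_rate m * (weight m 0 i * q 0 i) / W - mo_rate m * (weight m 0 i * q' 0 i) / W' =
  mo_rate m * ((weight m 0 i * (q 0 i - q' 0 i)) / W
   + (weight m 0 i * q' 0 i / W') * (W' - W) / W).
  by field; rewrite !gt_eqF.
rewrite normrM (gtr0_norm mu0) -[leRHS]mulrA ler_wpM2l ?(ltW mu0)//.
have -> : 2 * b / c * ldist q q' = b * ldist q q' / c + b * ldist q q' / c by field; rewrite gt_eqF.
have D0 := ldist_ge0 q q'.
have b0 : 0 < b by apply: lt_le_trans (hb i); exact: weight_gt0.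
have hc x : 0 <= x -> x <= b * ldist q q' -> x / W <= b * ldist q q' / c.
  move=> x0 xD; apply: ler_pM => //; first by rewrite invr_ge0 ltW.
  by rewrite lef_pV2.
have nW x : `|x / W| = `|x| / W by rewrite normrM normfV (gtr0_norm W0).
rewrite (le_trans (ler_normD _ _))// lerD// nW; apply: hc => //.
  rewrite normrM (gtr0_norm (weight_gt0 hm i)) ler_pM// ?coord_le_ldist//.
  by rewrite ltW ?weight_gt0.
rewrite normrM distrC; apply: (le_trans _ hd); rewrite ler_piMl//.
rewrite ger0_norm; first by rewrite ler_pdivrMr// mul1r.
by rewrite divr_ge0// ltW.
Qed.

Lemma chi_bounds q i : nonnegv q -> 0 <= chi m q i <= 1.
Proof.
move=> q0; rewrite /chi fine_ge0//= -lee_fin fineK; last first.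
  by rewrite fin_num_measure//; have [ths [_ _ _ /(_ q q0)[]]] := chi_thresholds hm i.
by apply: probability_le1; have [ths [_ _ _ /(_ q q0)[]]] := chi_thresholds hm i.
Qed.

Lemma chi_modulus i : exists L : R, forall om, 0 < om ->
  exists2 eta, 0 < eta & forall q q', nonnegv q -> nonnegv q' ->
  kappa - eta <= dotv (weight m) q -> kappa - eta <= dotv (weight m) q' ->
  `|chi m q i - chi m q' i| <=
    L * `|dotv (weight m) q - dotv (weight m) q'| + om.
Proof.
have [[th1 th2] /= [_ _ lo chiE]] := chi_thresholds hm i.
have [L1 h1] := threshold_modulus (fun t e => lo t (or_introl e)).
have [L2 h2] := threshold_modulus (fun t e => lo t (or_intror e)).
exists (L1 + L2) => om om0; have om2 : 0 < om / 2 by rewrite divr_gt0.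
have [e1 e10 {}h1] := h1 _ om2; have [e2 e20 {}h2] := h2 _ om2.
exists (Order.min e1 e2); first by rewrite lt_min e10.
move=> q q' q0 q0' hq hq'; rewrite (chiE q q0).2 (chiE q' q0').2.
have m1 : Order.min e1 e2 <= e1 by rewrite ge_min lexx.
have m2 : Order.min e1 e2 <= e2 by rewrite ge_min lexx orbT.
have := h1 _ _ (le_trans (lerB (lexx _) m1) hq) (le_trans (lerB (lexx _) m1) hq').
have := h2 _ _ (le_trans (lerB (lexx _) m2) hq) (le_trans (lerB (lexx _) m2) hq').
set x := cdf_at _ _; set y := cdf_at _ _; set z := cdf_at _ _; set w := cdf_at _ _.
set D := `|_ - dotv _ _| => H1 H2.
rewrite (_ : z - x - (w - y) = (z - w) - (x - y)); last by ring.
rewrite (le_trans (ler_normB _ _))//.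
rewrite mulrDl; lra.
Qed.

Lemma drift_modulus : (0 < N)%N ->
  exists2 L : R, 0 < L & forall om, 0 < om -> exists2 eta, 0 < eta &
  forall q q' i, nonnegv q -> nonnegv q' ->
  kappa - eta <= dotv (weight m) q -> kappa - eta <= dotv (weight m) q' ->
  `|chi m q i - chi m q' i| <= L * ldist q q' + om /\
  `|serv m q i - serv m q' i| <= L * ldist q q'.
Proof.
move=> N0; have [b1 [b2 [b10 b20 _ _ hb]]] := weight_bounds N0.
pose Q (i : 'I_N) (L : R) := forall om, 0 < om ->
  exists2 eta, 0 < eta & forall q q', nonnegv q -> nonnegv q' ->
  kappa - eta <= dotv (weight m) q -> kappa - eta <= dotv (weight m) q' ->
  `|chi m q i - chi m q' i| <=
    L * `|dotv (weight m) q - dotv (weight m) q'| + om.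
have [L L0 hL] : exists2 L : R, 0 < L & forall i, Q i L.
  apply: finite_bound; last by move=> i; exact: chi_modulus.
  move=> i x y xy hx om om0; have [eta eta0 h] := hx om om0.
  exists eta => // q q' q0 q0' hq hq'; apply: (le_trans (h _ _ q0 q0' hq hq')).
  by rewrite lerD2r ler_wpM2r.
(* Service rates are singular at W = 0; with eta at most [kappa / 2] the weighted queue stays at
   least [kappa / 2]. *)
pose L' := mo_rate m * (2 * b2 / (kappa / 2)).
have L'0 : 0 < L' by rewrite !mulr_gt0 ?mo_rate_gt0 ?invr_gt0 ?divr_gt0.
exists (L * b2 + L'); first by rewrite addr_gt0// mulr_gt0.
move=> om om0.
have [eta eta0 heta] : exists2 eta, 0 < eta & forall i q q',
    nonnegv q -> nonnegv q' ->
    kappa - eta <= dotv (weight m) q -> kappa - eta <= dotv (weight m) q' ->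
    `|chi m q i - chi m q' i| <=
      L * `|dotv (weight m) q - dotv (weight m) q'| + om.
  apply: finite_scale; last by move=> i; exact: hL.
  move=> i x y y0 yx hx q q' q0 q0' hq hq'.
  by apply: hx => //; lra.
exists (Order.min eta (kappa / 2)); first by rewrite lt_min eta0 divr_gt0.
have m1 : Order.min eta (kappa / 2) <= eta by rewrite ge_min lexx.
have m2 : Order.min eta (kappa / 2) <= kappa / 2 by rewrite ge_min lexx orbT.
move=> q q' i q0 q0' hq hq'; have D0 := ldist_ge0 q q'.
have wb j : weight m 0 j <= b2 by case/andP: (hb j).
split.
  apply: (le_trans (heta i q q' q0 q0' _ _)); [lra|lra|].
  rewrite lerD2r mulrDl -mulrA.
  apply: (@le_trans _ _ (L * (b2 * ldist q q'))).
    by rewrite ler_wpM2l ?(ltW L0) // dotv_dist.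
  by rewrite lerDl mulr_ge0 ?(ltW L'0).
have k2 : 0 < kappa / 2 by rewrite divr_gt0.
have := @serv_lipschitz b2 (kappa / 2) q q' i k2 wb q0 q0'.
rewrite -/L' => h; apply: (le_trans (h _ _)); [lra|lra|].
by rewrite mulrDl lerDr !mulr_ge0 ?(ltW L0) ?(ltW b20).
Qed.

End drift.

(** * Approximate solutions of the fluid equations *)

Section approximate_solutions.
Context {R : realType} {N : nat}.
Variables (m : lob R N) (q0 : 'rV[R]_N).
Hypotheses (hm : lob_axioms m) (N0 : (0 < N)%N).
Notation mu := (@lebesgue_measure R).
Notation W := (dotv (weight m)).
Implicit Types (q p : R -> 'rV[R]_N) (s t T e : R).

Definition fluid_value q t i : R :=
  q0 0 i + ded_size m i * ded_rate m i * t
  + inv_size m * inv_rate m * \int[mu]_(s in `[0, t]) chi m (q s) i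
  - mo_size m * \int[mu]_(s in `[0, t]) serv m (q s) i.

(** The path may jump, as a queue does, but by at most [2 * e], since [fluid_value q] is continuous
    in time. *)
Record approx_solution T e q : Prop := {
  approx_ge0 : forall t, 0 <= t <= T -> nonnegv (q t);
  approx_measurable : forall i, measurable_fun `[0, T] (fun t => q t 0 i);
  approx_eq : forall t i, 0 <= t <= T -> `|q t 0 i - fluid_value q t i| <= e }.

Lemma approx_solution_weaken T T' e e' q : T' <= T -> e <= e' ->
  approx_solution T e q -> approx_solution T' e' q.
Proof.
move=> TT ee [h1 h2 h3]; split.
- by move=> t /andP[t0 tT]; apply: h1; rewrite t0 (le_trans tT).
- move=> i; apply: (measurable_funS _ _ (h2 i)) => //.
  by apply: subset_itv; rewrite bnd_simp.
- by move=> t i /andP[t0 tT]; apply: (le_trans (h3 _ _ _)) => //; rewrite t0 (le_trans tT).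
Qed.

Section path_measurability.
Variables (T : R) (q : R -> 'rV[R]_N).
Hypothesis q0T : forall t, 0 <= t <= T -> nonnegv (q t).
Hypothesis mq : forall i, measurable_fun `[0, T] (fun t => q t 0 i).

Lemma measurable_weighted : measurable_fun `[0, T] (fun t => W (q t)).
Proof. by apply: measurable_sum => i; apply: measurable_funM => //; exact: mq. Qed.

Lemma measurable_cdf_at th :
  measurable_fun `[0, T] (fun t => cdf_at m (scale_threshold th (W (q t)))).
Proof.
case: th => [t|] /=; last exact: measurable_cst.
apply: (@measurableT_comp _ _ _ _ _ _ (type_cdf m)).
  by apply: nondecreasing_measurable => // x y; exact: type_cdf_nd.
by apply: measurable_funM => //; exact: measurable_weighted.
Qed.

Lemma chi_bounded_upto i : bounded_upto T 1 (fun t => chi m (q t) i).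
Proof.
split; last by move=> s sT; apply: chi_bounds => //; exact: q0T.
have [[th1 th2] [/= _ _ _ chiE]] := chi_thresholds hm i.
apply: (@eq_measurable_fun _ _ _ _ _ (fun t =>
    cdf_at m (scale_threshold th1 (W (q t))) -
    cdf_at m (scale_threshold th2 (W (q t))))).
  move=> t; rewrite inE /= in_itv /= => tT.
  by rewrite (chiE _ (q0T tT)).2.
by apply: measurable_funB; exact: measurable_cdf_at.
Qed.

Lemma serv_bounded_upto i : bounded_upto T (mo_rate m) (fun t => serv m (q t) i).
Proof.
split; last first.
  by move=> s sT; rewrite serv_ge0 ?serv_le//; exact: q0T.
(* The inverse is written as a real power, which is measurable; the two agree on nonnegative reals,
   0 included. *)
apply: (@eq_measurable_fun _ _ _ _ _ (fun t =>
    mo_rate m * (weight m 0 i * q t 0 i) * (W (q t)) `^ (-1))).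
  move=> t; rewrite inE /= in_itv /= => tT.
  by rewrite powR_inv1// dotv_ge0//; exact: q0T.
apply: measurable_funM.
  by do 2! (apply: measurable_funM => //); exact: mq.
apply: (@measurableT_comp _ _ _ _ _ _ (fun x : R => x `^ (-1))).
  exact: measurable_powR.
exact: measurable_weighted.
Qed.

Lemma ldist_measurable q' : (forall i, measurable_fun `[0, T] (fun t => q' t 0 i)) ->
  measurable_fun `[0, T] (fun t => ldist (q t) (q' t)).
Proof.
move=> mq'; apply: measurable_sum => i.
by apply: measurableT_comp => //; apply: measurable_funB; [exact: mq|exact: mq'].
Qed.

End path_measurability.

Variables (a kappa : R) (qstar : 'rV[R]_N).
Hypotheses (a0 : 0 < a) (aE : a_minus_min m = a%:E) (kappa0 : 0 < kappa).
Hypotheses (qstar0 : nonnegv qstar) (qstarB : balanced m qstar).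
Hypothesis q00 : nonnegv q0.
Hypothesis Fuc : forall e : R, 0 < e ->
  exists2 d : R, 0 < d & forall x y, `|x - y| <= d ->
    `|type_cdf m x - type_cdf m y| <= e.
Hypothesis Flip : exists L : R, forall x y, a * kappa <= x -> a * kappa <= y ->
  `|type_cdf m x - type_cdf m y| <= L * `|x - y|.
Variables b1 b2 : R.
Hypotheses (b10 : 0 < b1) (b20 : 0 < b2) (wb : forall i, b1 <= weight m 0 i <= b2).
Hypothesis kappaE : kappa <= b1 / b2 * Num.min (W q0) (W qstar).

Lemma sum_chi_nonincreasing (q q' : 'rV[R]_N) : nonnegv q -> nonnegv q' -> W q <= W q' ->
  \sum_i chi m q' i <= \sum_i chi m q i.
Proof.
move=> qn qn' WW; have [th thE tha] := sum_chi hm.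
rewrite !thE// lerD2l lerN2; case: th tha {thE} => [t|] //= /(_ _ erefl).
rewrite aE lee_fin => at'; apply: type_cdf_nd; rewrite ler_wpM2l//.
exact: le_trans (ltW a0) at'.
Qed.

(** At weighted queue 0 nothing is served while dedicated orders keep arriving, so the balance
    fails. *)
Lemma balanced_gt0 : 0 < W qstar.
Proof.
rewrite lt_neqAle dotv_ge0// andbT eq_sym; apply/eqP => W0.
have := qstarB (Ordinal N0); rewrite /serv W0 invr0 !mulr0 subr0.
have /andP[c0 _] := chi_bounds hm (Ordinal N0) qstar0.
have := ded_size_gt0 hm (Ordinal N0); have := ded_rate_gt0 hm (Ordinal N0).
have := inv_size_gt0 hm; have := inv_rate_gt0 hm => i1 i2 i3 i4 H.
have : 0 < ded_size m (Ordinal N0) * ded_rate m (Ordinal N0) by rewrite mulr_gt0.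
have : 0 <= inv_size m * inv_rate m * chi m qstar (Ordinal N0).
  by rewrite !mulr_ge0// ltW.
lra.
Qed.

Lemma total_balance : \sum_(i < N) ded_size m i * ded_rate m i +
  inv_size m * inv_rate m * \sum_i chi m qstar i = mo_size m * mo_rate m.
Proof.
rewrite -(@sum_serv _ _ m qstar) ?gt_eqF ?balanced_gt0// !mulr_sumr -big_split /=.
by apply: eq_bigr => i _; apply/eqP; rewrite -subr_eq0 (qstarB i).
Qed.

Lemma dotv_sum_bounds (q : 'rV[R]_N) : nonnegv q ->
  b1 * (\sum_i q 0 i) <= W q <= b2 * (\sum_i q 0 i).
Proof.
move=> qn; rewrite /dotv !mulr_sumr; apply/andP; split; apply: ler_sum => i _.
  by rewrite ler_wpM2r ?qn//; case/andP: (wb i).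
by rewrite ler_wpM2r ?qn//; case/andP: (wb i).
Qed.

(* The total inflow of investors depends on W only and decreases in it, while
   the total service rate is constant; hence the total queue length cannot
   decrease as long as W <= W qstar. *)
Lemma approx_lower_bound T e q : 0 <= e -> approx_solution T e q ->
  forall t, 0 <= t <= T -> kappa - 2 * N%:R * b1 * e <= W (q t).
Proof.
move=> e0 [qge mq qeq] t tT.
(* [barrier] is applied to the sum of the fluid values, which is Lipschitz although q may jump; it
   differs from the total queue by at most N e. *)
pose G t := \sum_i fluid_value q t i.
pose B := \sum_(i < N) ded_size m i * ded_rate m i.
(* A total queue below [W qstar / b2] forces [W q <= W qstar]. Moreover W q0 is at most b2 times the
   total initial queue, so that [kappa <= b1 * lv]: this is the origin of the ratio b1 / b2 in
   kappa. *)
pose lv := Num.min (\sum_i q0 0 i) (W qstar / b2).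
have cb i := chi_bounded_upto qge mq i.
have sb i := serv_bounded_upto qge mq i.
pose c := inv_size m * inv_rate m; pose v := mo_size m.
have c0 : 0 < c by rewrite mulr_gt0 ?inv_size_gt0 ?inv_rate_gt0.
have v0 : 0 < v by exact: mo_size_gt0.
have mu0 := mo_rate_gt0 hm.
have B0 : 0 <= B by apply: sumr_ge0 => i _; rewrite mulr_ge0// ltW ?ded_size_gt0 ?ded_rate_gt0.
have cbs : bounded_upto T (N%:R * 1) (fun u => \sum_i chi m (q u) i).
  by have := bounded_upto_sum cb; rewrite card_ord.
have sbs : bounded_upto T (N%:R * mo_rate m) (fun u => \sum_i serv m (q u) i).
  by have := bounded_upto_sum sb; rewrite card_ord.
have GE s : 0 <= s <= T -> G s = \sum_i q0 0 i + B * s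
    + c * \int[mu]_(u in `[0, s]) (\sum_i chi m (q u) i)
    - v * \int[mu]_(u in `[0, s]) (\sum_i serv m (q u) i).
  move=> sT; rewrite -(Rintegral_sum sT cb) -(Rintegral_sum sT sb).
  by rewrite /G /fluid_value !big_split /= sumrN !mulr_sumr mulr_suml.
have GB s u : 0 <= s <= u -> u <= T -> G u - G s = B * (u - s)
    + c * (\int[mu]_(u in `[0, u]) (\sum_i chi m (q u) i) -
           \int[mu]_(u in `[0, s]) (\sum_i chi m (q u) i))
    - v * (\int[mu]_(u in `[0, u]) (\sum_i serv m (q u) i) -
           \int[mu]_(u in `[0, s]) (\sum_i serv m (q u) i)).
  move=> /andP[s0 su] uT; rewrite !GE ?s0 ?(le_trans s0 su) ?(le_trans su)//.
  by rewrite -/c -/v; ring.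
have SG s : 0 <= s <= T -> `|\sum_i q s 0 i - G s| <= N%:R * e.
  move=> sT; rewrite /G -sumrB (le_trans (ler_norm_sum _ _ _))//.
  rewrite mulr_natl -[X in _ *+ X]card_ord -sumr_const; apply: ler_sum => i _; exact: qeq.
have Ne0 : 0 <= N%:R * e by rewrite mulr_ge0.
have Gt : lv - N%:R * e <= G t.
  apply: (@barrier _ T (B + c * (N%:R * 1) + v * (N%:R * mo_rate m))) => //.
  - have h1 : 0 <= c * (N%:R * 1) by rewrite mulr1; apply: mulr_ge0 (ltW c0) (ler0n _ _).
    have h2 : 0 <= v * (N%:R * mo_rate m).
      by apply: mulr_ge0 (ltW v0) _; apply: mulr_ge0 (ler0n _ _) (ltW mu0).
    by lra.
  - have T0 : 0 <= T by case/andP: tT => t0; exact: le_trans.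
    rewrite GE ?lexx// !Rintegral_at0 !mulr0 subr0 !addr0.
    apply: (@le_trans _ _ lv); first by rewrite gerBl.
    by rewrite /lv ge_min lexx.
  - move=> s u su uT; have := GB _ _ su uT.
    have /= := Rintegral_upto_bounds cbs su uT; have /= := Rintegral_upto_bounds sbs su uT.
    set x := (X in 0 <= X <= _ * mo_rate m * _).
    set y := (X in 0 <= X <= _ * 1 * _) => /andP[x0 xle] /andP[y0 yle] GBx.
    have {GBx} -> : G u - G s = B * (u - s) + c * y - v * x by exact: GBx.
    have us : 0 <= u - s by rewrite subr_ge0; case/andP: su.
    have := ler_wpM2l (ltW v0) xle; have := ler_wpM2l (ltW c0) yle.
    have vx : 0 <= v * x by rewrite mulr_ge0// ltW.
    have cy : 0 <= c * y by rewrite mulr_ge0// ltW.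
    have bu : 0 <= B * (u - s) by rewrite mulr_ge0.
    by move=> h1 h2; rewrite ler_norml; apply/andP; split; lra.
  - move=> s u su uT below; rewrite -subr_ge0; have := GB _ _ su uT.
    have us : 0 <= u - s by rewrite subr_ge0; case/andP: su.
    have hw w : s < w <= u -> 0 <= w <= T.
      move=> /andP[sw wu]; case/andP: su => s0 _.
      by rewrite (le_trans s0 (ltW sw)) (le_trans wu).
    pose x := \int[mu]_(w in `[0, u]) (\sum_i serv m (q w) i) -
      \int[mu]_(w in `[0, s]) (\sum_i serv m (q w) i).
    pose y := \int[mu]_(w in `[0, u]) (\sum_i chi m (q w) i) -
      \int[mu]_(w in `[0, s]) (\sum_i chi m (q w) i).
    move=> GBx.
    have {GBx} -> : G u - G s = B * (u - s) + c * y - v * x by exact: GBx.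
    have hx : x <= mo_rate m * (u - s).
      suff /andP[] : 0 * (u - s) <= x <= mo_rate m * (u - s) by [].
      apply: (Rintegral_between sbs su uT) => w /hw wT; have qn := qge _ wT.
      rewrite sumr_ge0 => [/=|i _]; last exact: serv_ge0.
      have [W0|W0] := eqVneq (W (q w)) 0; last by rewrite sum_serv.
      by rewrite big1 ?ltW// => i _; rewrite /serv W0 invr0 mulr0.
    have hy : (\sum_i chi m qstar i) * (u - s) <= y.
      suff /andP[] : (\sum_i chi m qstar i) * (u - s) <= y <= N%:R * 1 * (u - s) by [].
      apply: (Rintegral_between cbs su uT) => w sw; have wT := hw _ sw; have qn := qge _ wT.
      apply/andP; split; last first.
        rewrite mulr1 -[X in _ <= X%:R]card_ord -sumr_const.
        by apply: ler_sum => i _; case/andP: (chi_bounds hm i qn).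
      apply: sum_chi_nonincreasing => //.
      have := SG _ wT; rewrite ler_norml => /andP[_ hS].
      have := below _ sw => hG.
      have : \sum_i q w 0 i < W qstar / b2.
        apply: (@lt_le_trans _ _ lv); first by lra.
        by rewrite /lv ge_min lexx orbT.
      rewrite ltr_pdivlMr// mulrC => /ltW; apply: le_trans.
      by case/andP: (dotv_sum_bounds qn).
    have := total_balance; rewrite -/B -/c -/v => tb.
    have := ler_wpM2l (ltW v0) hx; have := ler_wpM2l (ltW c0) hy.
    have : B * (u - s) = v * mo_rate m * (u - s) - c * (\sum_i chi m qstar i) * (u - s).
      by rewrite -mulrBl -tb addrK.
    by lra.
have qn := qge _ tT.
have /andP[+ _] := dotv_sum_bounds qn; apply: le_trans.
have := SG _ tT; rewrite ler_norml => /andP[hS _].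
have hk : kappa <= b1 * lv.
  apply: (le_trans kappaE); rewrite -mulrA ler_wpM2l ?(ltW b10)//.
  rewrite /lv le_min; apply/andP; split.
    rewrite mulrC ler_pdivrMr// mulrC; apply: (@le_trans _ _ (W q0)); first by rewrite ge_min lexx.
    by case/andP: (dotv_sum_bounds q00).
  by rewrite mulrC ler_pM2r ?invr_gt0// ge_min lexx orbT.
apply: (@le_trans _ _ (b1 * (lv - 2 * (N%:R * e)))); first by lra.
rewrite ler_wpM2l ?(ltW b10)//; lra.
Qed.

Let c := inv_size m * inv_rate m.
Let v := mo_size m.

(** The majorant f of the distance is left free: the stability estimate takes the distance itself,
    the passage to the limit a constant. *)
Lemma fluid_value_dist L om T q p i f t :
  (forall s, 0 <= s <= T -> nonnegv (q s)) -> (forall s, 0 <= s <= T -> nonnegv (p s)) ->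
  (forall i, measurable_fun `[0, T] (fun t => q t 0 i)) ->
  (forall i, measurable_fun `[0, T] (fun t => p t 0 i)) ->
  0 < L -> 0 <= t <= T -> mu.-integrable `[0, t] (EFin \o f) ->
  (forall s, 0 <= s <= t -> ldist (q s) (p s) <= f s) ->
  (forall s, 0 <= s <= t ->
    `|chi m (q s) i - chi m (p s) i| <= L * ldist (q s) (p s) + om /\
    `|serv m (q s) i - serv m (p s) i| <= L * ldist (q s) (p s)) ->
  `|fluid_value q t i - fluid_value p t i| <=
    (c + v) * L * \int[mu]_(s in `[0, t]) f s + c * om * t.
Proof.
move=> qn pn mq mp L0 tT intf hf hL.
have c0 : 0 < c by rewrite mulr_gt0 ?inv_size_gt0 ?inv_rate_gt0.
have v0 : 0 < v by exact: mo_size_gt0.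
have iLf : mu.-integrable `[0, t] (EFin \o (fun s => L * f s)).
  exact: (integrableZl _ L intf).
have h1 : `|\int[mu]_(s in `[0, t]) chi m (q s) i - \int[mu]_(s in `[0, t]) chi m (p s) i|
    <= L * \int[mu]_(s in `[0, t]) f s + om * t.
  rewrite -RintegralZl//.
  apply: (normr_RintegralB (chi_bounded_upto qn mq i) (chi_bounded_upto pn mp i)) => //.
  move=> s st; apply: (le_trans (hL s st).1); rewrite lerD2r ler_wpM2l ?(ltW L0)//; exact: hf.
have h2 : `|\int[mu]_(s in `[0, t]) serv m (q s) i - \int[mu]_(s in `[0, t]) serv m (p s) i|
    <= L * \int[mu]_(s in `[0, t]) f s + 0 * t.
  rewrite -RintegralZl//.
  apply: (normr_RintegralB (serv_bounded_upto qn mq i) (serv_bounded_upto pn mp i)) => //.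
  move=> s st; apply: (le_trans (hL s st).2); rewrite addr0 ler_wpM2l ?(ltW L0)//; exact: hf.
move: h1 h2; rewrite /fluid_value -/c -/v.
set x1 := \int[_]_(_ in _) _; set x2 := \int[_]_(_ in _) _.
set J := \int[_]_(_ in _) _; set y1 := \int[_]_(_ in _) _.
set y2 := \int[_]_(_ in _) _ => h1 h2.
set A := q0 0 i + _.
rewrite (_ : _ - (A + _ - _) = c * (x1 - x2) - v * (y1 - y2)); last by ring.
rewrite (le_trans (ler_normB _ _))// (normrM c) (normrM v) (gtr0_norm c0) (gtr0_norm v0).
have := ler_wpM2l (ltW c0) h1; have := ler_wpM2l (ltW v0) h2; lra.
Qed.

Lemma approx_bounded T e q : 0 <= T -> 0 <= e -> approx_solution T e q ->
  exists K, forall t, 0 <= t <= T -> forall i, q t 0 i <= K.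
Proof.
move=> T0 e0 [qn mq qeq].
pose K i := q0 0 i + ded_size m i * ded_rate m i * T + c * T + e.
have c0 : 0 < c by rewrite mulr_gt0 ?inv_size_gt0 ?inv_rate_gt0.
have v0 : 0 < v by exact: mo_size_gt0.
have [M M0 hM] : exists2 M : R, 0 < M & forall i, K i <= M.
  apply: finite_bound => [i x y xy /le_trans|i]; first exact.
  by exists (K i).
exists M => t tT i; apply: le_trans (hM i).
have := qeq t i tT; rewrite ler_norml => /andP[_].
rewrite /fluid_value -/c -/v /K.
have /andP[t0 tT'] := tT.
have tt : 0 <= (0 : R) <= t by rewrite lexx.
have /= := Rintegral_upto_bounds (chi_bounded_upto qn mq i) tt tT'.
have /= := Rintegral_upto_bounds (serv_bounded_upto qn mq i) tt tT'.
rewrite !Rintegral_at0 !subr0 mul1r.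
set x1 := \int[_]_(_ in _) _; set x2 := \int[_]_(_ in _) _.
move=> /andP[h1 h2] /andP[h3 h4].
have : 0 <= v * x1 by rewrite mulr_ge0// ltW.
have := ler_wpM2l (ltW c0) h4; have := ler_wpM2l (ltW c0) tT'.
have bl : 0 <= ded_size m i * ded_rate m i.
  by rewrite mulr_ge0// ltW ?ded_size_gt0 ?ded_rate_gt0.
have := ler_wpM2l bl tT'; lra.
Qed.

(** The order of choice matters: L and with it the Gronwall factor X, then om from X, then eta from
    om, then d from eta, so small that both paths stay above [kappa - eta]. *)
Lemma approx_stability T eps : 0 <= T -> 0 < eps -> exists2 d, 0 < d &
  forall q p, approx_solution T d q -> approx_solution T d p ->
  forall t, 0 <= t <= T -> ldist (q t) (p t) <= eps.
Proof.
move=> T0 eps0.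
have c0 : 0 < c by rewrite mulr_gt0 ?inv_size_gt0 ?inv_rate_gt0.
have v0 : 0 < v by exact: mo_size_gt0.
have [L L0 hL] := drift_modulus hm a0 aE kappa0 Fuc Flip N0.
have N0' : 0 < N%:R :> R by rewrite ltr0n.
pose L' := N%:R * (c + v) * L.
have L'0 : 0 < L' by rewrite !mulr_gt0 ?addr_gt0.
pose X := 2 * expR (2 * L' * T).
have X0 : 0 < X by rewrite mulr_gt0// expR_gt0.
(* This om makes X N c om (T + 1) equal to eps / 2, and d1 below makes 2 X N d1 equal to eps / 2. T
   + 1 avoids a division by 0 when T = 0. *)
pose om := eps / (2 * X * (N%:R * c * (T + 1))).
have T1 : 0 < T + 1 by rewrite ltr_wpDl.
have NcT : 0 < N%:R * c * (T + 1) by exact: mulr_gt0 (mulr_gt0 N0' c0) T1.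
have om0 : 0 < om by apply: divr_gt0 eps0 (mulr_gt0 _ NcT); exact: mulr_gt0.
have [eta eta0 heta] := hL om om0.
pose d1 := eps / (2 * X * (2 * N%:R)); pose d2 := eta / (2 * N%:R * b1).
have N2 : 0 < 2 * N%:R :> R by exact: mulr_gt0.
have X2 : 0 < 2 * X by exact: mulr_gt0.
have d10 : 0 < d1 by exact: divr_gt0 eps0 (mulr_gt0 X2 N2).
have d20 : 0 < d2 by exact: divr_gt0 eta0 (mulr_gt0 N2 b10).
exists (Order.min d1 d2); first by rewrite lt_min d10.
set d := Order.min _ _.
have dd1 : d <= d1 by rewrite ge_min lexx.
have dd2 : d <= d2 by rewrite ge_min lexx orbT.
have d0 : 0 < d by rewrite lt_min d10.
move=> q p aq ap; have [qn mq qeq] := aq; have [pn mp peq] := ap.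
have low r : approx_solution T d r -> forall s, 0 <= s <= T -> kappa - eta <= W (r s).
  move=> ar s sT; apply: le_trans (approx_lower_bound (ltW d0) ar sT).
  rewrite lerD2l lerN2.
  by rewrite mulrC -ler_pdivlMr// mulr_gt0.
pose D t := ldist (q t) (p t).
have [K1 hK1] := approx_bounded T0 (ltW d0) aq.
have [K2 hK2] := approx_bounded T0 (ltW d0) ap.
have Db : bounded_upto T (N%:R * (K1 + K2)) D.
  split; first exact: ldist_measurable.
  move=> s sT; rewrite ldist_ge0 /= /D /ldist mulr_natl.
  rewrite -[X in _ *+ X]card_ord -sumr_const; apply: ler_sum => i _.
  rewrite (le_trans (ler_normB _ _))// !ger0_norm ?qn ?pn//.
  by rewrite lerD ?hK1 ?hK2.
pose A := 2 * N%:R * d + N%:R * (c * om * T).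
have com : 0 <= c * om by exact: mulr_ge0 (ltW c0) (ltW om0).
have A0 : 0 <= A.
  apply: addr_ge0 (mulr_ge0 (ltW N2) (ltW d0)) _.
  exact: mulr_ge0 (ltW N0') (mulr_ge0 com T0).
have gr t : 0 <= t <= T -> D t <= A + L' * \int[mu]_(s in `[0, t]) D s.
  move=> tT; have /andP[t0 tT'] := tT.
  set J := \int[_]_(_ in _) _.
  apply: (@le_trans _ _ (\sum_(i < N) (2 * d + ((c + v) * L * J + c * om * T)))); last first.
    by rewrite sumr_const card_ord -mulr_natl /A /L'; lra.
  apply: ler_sum => i _.
  have sT s : 0 <= s <= t -> 0 <= s <= T.
    by move=> /andP[-> st]; rewrite (le_trans st).
  have : `|fluid_value q t i - fluid_value p t i| <= (c + v) * L * J + c * om * t.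
    apply: (fluid_value_dist qn pn) => //.
      exact: (bounded_upto_integrable Db).
    by move=> s /sT ss; apply: heta; rewrite ?low//; [exact: qn|exact: pn].
  have := qeq t i tT; have := peq t i tT.
  have : c * om * t <= c * om * T by exact: ler_wpM2l.
  set x := fluid_value q t i; set y := fluid_value p t i => h4 h1 h2 h3.
  rewrite (_ : q t 0 i - p t 0 i = (q t 0 i - x) + (x - y) - (p t 0 i - y)); last by ring.
  rewrite (le_trans (ler_normB _ _))//.
  have := ler_normD (q t 0 i - x) (x - y); lra.
move=> t tT; have := gronwall T0 L'0 A0 Db gr tT.
move=> h; apply: (le_trans h).
have /andP[t0 tT'] := tT.
apply: (@le_trans _ _ (X * A)).
  rewrite -mulrA [A * _]mulrC mulrA ler_wpM2r// ler_pM2l// ler_expR.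
  by apply: ler_wpM2l tT'; exact: mulr_ge0 (ltW _).
have hA1 : X * (2 * N%:R * d) <= eps / 2.
  apply: (@le_trans _ _ (X * (2 * N%:R * d1))).
    by apply: (ler_wpM2l (ltW X0)); apply: (ler_wpM2l (ltW N2)).
  rewrite /d1 le_eqVlt; apply/orP; left; apply/eqP; field.
  by rewrite !gt_eqF.
have hA2 : X * (N%:R * (c * om * T)) <= eps / 2.
  apply: (@le_trans _ _ (X * (N%:R * (c * om * (T + 1))))).
    apply: (ler_wpM2l (ltW X0)); apply: (ler_wpM2l (ltW N0')).
    by apply: (ler_wpM2l com); rewrite lerDl.
  rewrite /om le_eqVlt; apply/orP; left; apply/eqP; field.
  by rewrite ?(gt_eqF c0) ?(gt_eqF N0') ?(gt_eqF X0) ?(gt_eqF T1).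
rewrite mulrDr; lra.
Qed.

(** By stability the [p k] are uniformly Cauchy on each [0, T]. The limit inherits the equations
    because [fluid_value] depends continuously on the path in the uniform distance, as long as the
    paths stay above [kappa - eta]. *)
Lemma approx_limit (p : nat -> R -> 'rV[R]_N) :
  (forall k, approx_solution k%:R k.+1%:R^-1 (p k)) ->
  exists q, forall T e, 0 <= T -> 0 < e -> approx_solution T e q.
Proof.
move=> ap.
have near_ap T d : 0 < d -> \forall k \near \oo, approx_solution T d (p k).
  move=> d0; near=> k; apply: approx_solution_weaken (ap k).
    by near: k; exact: nbhs_infty_ger.
  by apply/ltW; near: k; exact: near_infty_natSinv_lt (PosNum d0).
have cauchy_p T eps : 0 <= T -> 0 < eps -> exists K, forall k l,
    (K <= k)%N -> (K <= l)%N -> forall t, 0 <= t <= T -> ldist (p k t) (p l t) <= eps.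
  move=> T0 eps0; have [d d0 hd] := approx_stability T0 eps0.
  have [K _ hK] := near_ap T d d0.
  by exists K => k l Kk Kl t tT; apply: hd => //; exact: hK.
pose q t : 'rV[R]_N := \row_i limn (fun k => p k t 0 i).
have pq t i : 0 <= t -> (p k t 0 i) @[k --> \oo] --> q t 0 i.
  move=> t0; rewrite mxE; apply/cauchy_cvgP/cauchy_exP => e e0.
  have [K hK] := cauchy_p t (e / 2) t0 (divr_gt0 e0 (ltr0n R 2)).
  exists (p K t 0 i); exists K => // k /= Kk.
  apply: (@le_lt_trans _ _ (e / 2)); last by rewrite ltr_pdivrMr// ltr_pMr// ltr1n.
  apply: (le_trans (coord_le_ldist _ _ _)); apply: hK => //.
  by rewrite t0 lexx.
have pq_unif T eps : 0 <= T -> 0 < eps -> \forall k \near \oo,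
    forall t, 0 <= t <= T -> ldist (q t) (p k t) <= eps.
  move=> T0 eps0; have [K hK] := cauchy_p T eps T0 eps0.
  exists K => // k /= Kk t tT; have /andP[t0 _] := tT.
  have cl : ldist (p l t) (p k t) @[l --> \oo] --> ldist (q t) (p k t).
    apply: cvg_big => [|i _]; first exact: add_continuous.
    by apply: cvg_norm; apply: cvgB; [exact: pq|exact: cvg_cst].
  by apply: (cvgr_to_le cl); exists K => // l /= Kl; exact: hK.
exists q => T e T0 e0.
have qn t : 0 <= t <= T -> nonnegv (q t).
  move=> /andP[t0 tT] i; apply: (cvgr_to_ge (pq t i t0)).
  have := near_ap T 1 ltr01; apply: filterS => k [h _ _].
  by apply: h; rewrite t0.
(* Only a tail of the sequence is known to be measurable on all of [0, T], hence the shift by K. *)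
have mq i : measurable_fun `[0, T] (fun t => q t 0 i).
  have [K _ hK] := near_ap T 1 ltr01.
  apply: (@measurable_fun_cvg _ _ _ _ (fun k t => p (k + K)%N t 0 i)).
    by move=> k; have [_ + _] := hK (k + K)%N (leq_addl _ _); apply.
  move=> t /=; rewrite in_itv /= => /andP[t0 _].
  by have := pq t i t0; rewrite -(cvg_shiftn K).
split=> // t i tT; have /andP[t0 tT'] := tT.
have c0 : 0 < c by rewrite mulr_gt0 ?inv_size_gt0 ?inv_rate_gt0.
have v0 : 0 < v by exact: mo_size_gt0.
have [L L0 hL] := drift_modulus hm a0 aE kappa0 Fuc Flip N0.
have T1 : 0 < T + 1 by rewrite ltr_wpDl.
have cT : 0 < c * (T + 1) by exact: mulr_gt0.
pose om := e / (4 * (c * (T + 1))).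
have om0 : 0 < om by apply: divr_gt0 e0 _; exact: mulr_gt0.
have [eta eta0 heta] := hL om om0.
have cvL : 0 < (c + v) * L * (T + 1).
  by apply: mulr_gt0 T1; apply: mulr_gt0 L0; exact: addr_gt0.
(* The error e is spent in quarters: q against [p k], [p k] against its own fluid value, and the L
   and om terms between the two fluid values. The last entry keeps the weighted queues of q and
   [p k] within [eta / 2] of each other. *)
pose eps := Order.min (e / 4) (Order.min (e / (4 * ((c + v) * L * (T + 1)))) (eta / (2 * b2))).
have e4 : 0 < e / 4 by exact: divr_gt0.
have eps0 : 0 < eps.
  rewrite !lt_min e4 divr_gt0//=; first by rewrite divr_gt0// mulr_gt0.
  exact: mulr_gt0.
pose d := Order.min (e / 4) (eta / (2 * (2 * N%:R * b1))).
have Nb : 0 < 2 * N%:R * b1 by apply: mulr_gt0 b10; rewrite mulr_gt0// ltr0n.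
have d0 : 0 < d by rewrite lt_min e4 divr_gt0// mulr_gt0.
have [k [ak dk]] := filter_ex (filterI (near_ap T d d0) (pq_unif T eps T0 eps0)).
have [pn mp peq] := ak.
have kl s : 0 <= s <= T -> kappa - eta / 2 <= W (p k s).
  move=> sT; apply: le_trans (approx_lower_bound (ltW d0) ak sT).
  rewrite lerD2l lerN2 mulrC -ler_pdivlMr// -(mulrA eta) -(invfM 2) ge_min.
  by rewrite lexx orbT.
have low s : 0 <= s <= T -> kappa - eta <= W (q s) /\ kappa - eta <= W (p k s).
  move=> sT; have := kl s sT; split; last by lra.
  have wb2 j : weight m 0 j <= b2 by case/andP: (wb j).
  have := dotv_dist hm (q s) (p k s) wb2.
  have : b2 * ldist (q s) (p k s) <= eta / 2.
    rewrite mulrC -ler_pdivlMr// -(mulrA eta) -(invfM 2); apply: (le_trans (dk s sT)).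
    by rewrite !ge_min lexx !orbT.
  by rewrite ler_norml => h1 /andP[h2 _]; lra.
have ieps : mu.-integrable `[0, t] (EFin \o (fun _ => eps)).
  by apply: (@bounded_upto_integrable _ T eps) => //; split=> // s _; rewrite lexx ltW.
have sT s : 0 <= s <= t -> 0 <= s <= T.
  by move=> /andP[-> st]; rewrite (le_trans st).
have := @fluid_value_dist L om T q (p k) i (fun _ => eps) t qn pn mq mp L0 tT ieps.
move=> /(_ (fun s st => dk s (sT s st))).
have hh s : 0 <= s <= t ->
    `|chi m (q s) i - chi m (p k s) i| <= L * ldist (q s) (p k s) + om /\
    `|serv m (q s) i - serv m (p k s) i| <= L * ldist (q s) (p k s).
  move=> /sT ss; have [l1 l2] := low s ss.
  by apply: heta => //; [exact: qn|exact: pn].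
move=> /(_ hh).
rewrite Rintegral_cst// (segment_measure t0) subr0 => H.
have := peq t i tT; have := dk t tT; have := coord_le_ldist (q t) (p k t) i.
have h1 : (c + v) * L * (eps * t) <= e / 4.
  apply: (@le_trans _ _ (eps * ((c + v) * L * (T + 1)))).
    rewrite [eps * t]mulrC mulrA [eps * _]mulrC; apply: ler_wpM2r; first exact: ltW.
    apply: ler_wpM2l; last by lra.
    by apply/ltW/mulr_gt0 => //; exact: addr_gt0.
  rewrite -ler_pdivlMr// -(mulrA e) -(invfM 4) !ge_min.
  by rewrite lexx orbT.
have h2 : c * om * t <= e / 4.
  apply: (@le_trans _ _ (c * om * (T + 1))).
    by apply: ler_wpM2l; [apply/ltW/mulr_gt0|lra].
  rewrite /om le_eqVlt; apply/orP; left; apply/eqP; field.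
  by rewrite (gt_eqF c0) (gt_eqF T1).
have h3 : eps <= e / 4 by rewrite ge_min lexx.
have h4 : d <= e / 4 by rewrite ge_min lexx.
set x := fluid_value q t i; set y := fluid_value (p k) t i in H * => h5 h6 h7.
have -> : q t 0 i - x = (q t 0 i - p k t 0 i) + (p k t 0 i - y) - (x - y) by ring.
rewrite (le_trans (ler_normB _ _))//.
have := ler_normD (q t 0 i - p k t 0 i) (p k t 0 i - y).
have : `|x - y| <= e / 4 + e / 4 by apply: (le_trans H); exact: lerD.
lra.
Unshelve. all: by end_near.
Qed.

Lemma approx_fluid_equations q :
  (forall T e, 0 <= T -> 0 < e -> approx_solution T e q) -> fluid_equations m q0 q.
Proof.
move=> aq t i t0.
suff : `|q t 0 i - fluid_value q t i| <= 0 by rewrite normr_le0 subr_eq0 => /eqP ->.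
apply/ler_addgt0Pr => e e0; rewrite add0r.
by have [_ _ h] := aq t e t0 e0; apply: h; rewrite t0 lexx.
Qed.

(** This modulus of the limit path lets a supremum over real times be replaced by one over rational
    times. *)
Lemma approx_lipschitz q :
  (forall T e, 0 <= T -> 0 < e -> approx_solution T e q) ->
  exists C : R, forall s t i, 0 <= s <= t -> `|q t 0 i - q s 0 i| <= C * (t - s).
Proof.
move=> aq.
have c0 : 0 < c by rewrite mulr_gt0 ?inv_size_gt0 ?inv_rate_gt0.
have v0 : 0 < v by exact: mo_size_gt0.
have [C C0 hC] : exists2 C : R, 0 < C & forall i, ded_size m i * ded_rate m i <= C.
  by apply: finite_bound => [i x y xy /le_trans|i]; [exact|exists (ded_size m i * ded_rate m i)].
exists (C + c + v * mo_rate m) => s t i st; have /andP[s0 st'] := st.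
have t0 : 0 <= t := le_trans s0 st'.
rewrite !(approx_fluid_equations aq)// -/c -/v.
have [qn mq _] := aq t 1 t0 ltr01.
have /= := Rintegral_upto_bounds (chi_bounded_upto qn mq i) st (lexx t).
have /= := Rintegral_upto_bounds (serv_bounded_upto qn mq i) st (lexx t).
set x1 := \int[_]_(_ in _) _; set x2 := \int[_]_(_ in _) _.
set y1 := \int[_]_(_ in _) _; set y2 := \int[_]_(_ in _) _.
move=> /andP[h1 h2] /andP[h3 h4].
have ts : 0 <= t - s by rewrite subr_ge0.
have h5 := mulr_ge0 (ltW v0) h1; have h6 := ler_wpM2l (ltW v0) h2.
have h7 := mulr_ge0 (ltW c0) h3; have h8 := ler_wpM2l (ltW c0) h4.
have h9 := ler_wpM2r ts (hC i).
have h10 : 0 <= ded_size m i * ded_rate m i * (t - s).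
  by rewrite mulr_ge0// mulr_ge0// ltW ?ded_size_gt0 ?ded_rate_gt0.
have h11 : 0 <= C * (t - s) by rewrite mulr_ge0// ltW.
rewrite ler_norml; apply/andP; split; lra.
Qed.

End approximate_solutions.

(** * A queue path driven by flows close to their means is an approximate solution *)

Section monotone_paths.
Context {R : realType}.
Notation mu := (@lebesgue_measure R).
Implicit Types (g : R -> R) (s t u T K : R).

(* No measurability: a queue path is only known to be measurable once its
   cumulated service integral is known to be nondecreasing. *)
Lemma le_integral_nomeas g s t K : (forall u, 0 <= u -> 0 <= g u <= K) ->
  0 <= s <= t ->
  \int[mu]_(u in `[0, s]) g u <= \int[mu]_(u in `[0, t]) g u /\
  0 <= \int[mu]_(u in `[0, t]) g u <= K * t.
Proof.
move=> gK /andP[s0 st]; have t0 : 0 <= t := le_trans s0 st.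
have K0 : 0 <= K by have /andP[h1 h2] := gK 0 (lexx _); exact: le_trans h2.
(* The integral of a nonnegative function is a supremum over the simple functions below it, hence
   monotone in the domain and in the integrand without any measurability. *)
have mono (D D' : set R) (h h' : R -> R) : (forall x, D x -> 0 <= h x) ->
    (forall x, D' x -> 0 <= h' x) -> D `<=` D' -> (forall x, D x -> h x <= h' x) ->
    (\int[mu]_(x in D) (h x)%:E <= \int[mu]_(x in D') (h' x)%:E)%E.
  move=> h0 h0' DD hh; rewrite !ge0_integralE//.
  apply: le_ereal_sup => _ [p /= pP <-]; exists p => //= x.
  apply: (le_trans (pP x)); rewrite /patch; case: ifPn => xD.
    rewrite ifT; last by apply/mem_set/DD/set_mem.
    by rewrite lee_fin; apply: hh; exact/set_mem.
  by case: ifPn => // /set_mem/h0'; rewrite lee_fin.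
have sub : `[0, s] `<=` `[0, t] by apply: subset_itv; rewrite bnd_simp.
have g0 v (x : R) : [set` `[0, v]] x -> 0 <= g x.
  by rewrite /= in_itv /= => /andP[x0 _]; case/andP: (gK x x0).
have gle v (x : R) : [set` `[0, v]] x -> g x <= K.
  by rewrite /= in_itv /= => /andP[x0 _]; case/andP: (gK x x0).
have cK v : (0 <= v) -> (\int[mu]_(x in `[0%R, v]) (g x)%:E <= (K * v)%:E)%E.
  move=> v0; have := mono [set` `[0, v]] [set` `[0, v]] g (cst K).
  move=> /(_ (g0 v) (fun _ _ => K0) (@subset_refl _ _) (gle v)) /le_trans; apply.
  rewrite (_ : (fun x => _) = cst K%:E)// integral_cst//= lebesgue_measure_itv /= lte_fin.
  case: ltgtP v0 => // [v0 _|<- _]; last by rewrite mulr0 mule0.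
  by rewrite -EFinB subr0 EFinM.
have fin v : 0 <= v -> (\int[mu]_(x in `[0%R, v]) (g x)%:E)%E \is a fin_num.
  move=> v0; rewrite ge0_fin_numE; first exact: le_lt_trans (cK v v0) (ltry _).
  by apply: integral_ge0 => x xv; rewrite lee_fin; exact: g0 xv.
split.
  apply: fine_le; [exact: fin|exact: fin|].
  apply: mono => //; [exact: g0|exact: g0].
apply/andP; split; first by apply: Rintegral_ge0; exact: g0.
by rewrite -lee_fin /Rintegral fineK ?fin// cK.
Qed.

Definition nd_from0 g := forall s t, 0 <= s <= t -> g s <= g t.

Lemma nd_from0_measurable T g : nd_from0 g -> measurable_fun `[0, T] g.
Proof.
move=> gnd; apply: (@eq_measurable_fun _ _ _ _ _ (fun t => g (Num.max t 0))).
  by move=> t; rewrite inE /= in_itv /= => /andP[t0 _]; rewrite max_l.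
apply: nondecreasing_measurable => // s t st; apply: gnd.
by rewrite le_max lexx orbT /= ge_max le_max st /= le_max lexx orbT.
Qed.

Lemma nd_from0_left_limit g t : nd_from0 g -> 0 < t -> cvg (g s @[s --> t^'-]).
Proof.
move=> gnd t0; apply: nondecreasing_at_left_is_cvgr.
  near=> s; move=> x y; rewrite !in_itv /= => /andP[sx _] /andP[sy _] xy.
  apply: gnd; rewrite xy andbT; apply: le_trans (ltW sx).
  by near: s; exact: nbhs_left_ge.
near=> s; exists (g t) => y [x /=]; rewrite in_itv /= => /andP[sx xt] <-.
apply: gnd; rewrite (ltW xt) andbT; apply: le_trans (ltW sx).
by near: s; exact: nbhs_left_ge.
Unshelve. all: by end_near.
Qed.

Lemma cvg_rowv (T : Type) (F : set_system T) {FF : Filter F} N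
  (f : T -> 'rV[R]_N) (l : 'rV[R]_N) :
  (forall i, f x 0 i @[x --> F] --> l 0 i) -> f x @[x --> F] --> l.
Proof.
move=> fl; apply/cvg_ballP => e e0.
have : \forall x \near F, forall i, ball (l 0 i) e (f x 0 i).
  by apply: filter_forall => i; exact: (cvg_ballP _ _).1 (fl i) e e0.
by apply: filterS => x h; split=> // i j; rewrite ord1; exact: h.
Qed.

Lemma cvg_rowv_coord (T : Type) (F : set_system T) {FF : Filter F} N
  (f : T -> 'rV[R]_N) (l : 'rV[R]_N) i :
  f x @[x --> F] --> l -> f x 0 i @[x --> F] --> l 0 i.
Proof.
move=> fl; apply/cvg_ballP => e e0.
move/cvg_ballP: fl => /(_ e e0); apply: filterS => x [_ h]; exact: h.
Qed.

End monotone_paths.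

Section queue_paths.
Context {R : realType} {N : nat}.
Variables (m : lob R N).
Hypothesis hm : lob_axioms m.
Notation mu := (@lebesgue_measure R).
Notation W := (dotv (weight m)).
Implicit Types (K : pred (option 'I_N)) (s t u T e : R) (th : option R) (i : 'I_N).

Section one_path.
Variables (n : nat) (q : R -> 'rV[R]_N) (cnt : R -> nat) (B gm : nat -> R).
Variables (ad dm : 'I_N -> R -> R).

(** A set K of venues replaces a single one because thresholds exist only for sets closed under
    lowering the rebate; the flow to one venue is a difference of two such flows. *)
Definition inv_flow K t := n%:R^-1 * \sum_(k < cnt t) B k *
  (K (route m (gm k) (left_limit q (jump_time cnt k))))%:R.

Definition type_le th (x : R) : bool := if th is Some y then x <= y else true.

(** Orders are selected by type alone, whatever their route. For random data the summands are then
    independent marked sizes, to which a law of large numbers applies. *)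
Definition mark_flow th t := n%:R^-1 * \sum_(k < cnt t) B k * (type_le th (gm k))%:R.

(** The properties that almost every sample path has. Measurability of q in time is derived from
    them, through the monotonicity of the flows. *)
Record queue_path : Prop := {
  path_ge0 : forall t, 0 <= t -> nonnegv (q t);
  path_eq : forall t i, 0 <= t -> q t 0 i = Num.max (q 0 0 i + ad i t
    + inv_flow (pred1 (Some i)) t
    - dm i (\int[mu]_(s in `[0, t]) serv m (q s) i)) 0;
  path_ded_nd : forall i, nd_from0 (ad i);
  path_serv_nd : forall i, nd_from0 (dm i);
  path_cnt0 : cnt 0 = 0%N;
  path_cnt_nd : forall s t, 0 <= s -> s <= t -> (cnt s <= cnt t)%N;
  path_cnt_right : forall t, 0 <= t -> \forall s \near t^'+, cnt s = cnt t;
  path_size_ge0 : forall k, 0 <= B k;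
  path_type_gt0 : forall k, 0 < gm k }.

Hypothesis hq : queue_path.

Lemma flow_incr (h : nat -> R) s t : 0 <= s <= t ->
  n%:R^-1 * \sum_(k < cnt t) h k - n%:R^-1 * \sum_(k < cnt s) h k =
  n%:R^-1 * \sum_(cnt s <= k < cnt t) h k.
Proof.
move=> /andP[s0 st]; rewrite -mulrBr -!(big_mkord xpredT h).
rewrite (@big_cat_nat _ _ _ (cnt s) 0 (cnt t))//=; last exact: path_cnt_nd.
by congr (_ * _); rewrite addrAC subrr add0r.
Qed.

Lemma le_flow (h h' : nat -> R) s t :
  (forall k, (cnt s <= k < cnt t)%N -> h k <= h' k) ->
  n%:R^-1 * \sum_(cnt s <= k < cnt t) h k <= n%:R^-1 * \sum_(cnt s <= k < cnt t) h' k.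
Proof.
by move=> hh; rewrite ler_wpM2l ?invr_ge0//; apply: ler_sum_nat.
Qed.

Lemma inv_flow_incr K s t : 0 <= s <= t ->
  0 <= inv_flow K t - inv_flow K s <= mark_flow None t - mark_flow None s.
Proof.
move=> st; rewrite /inv_flow /mark_flow.
rewrite (flow_incr (fun k => B k *
  (K (route m (gm k) (left_limit q (jump_time cnt k))))%:R) st).
rewrite (flow_incr (fun k => B k * (type_le None (gm k))%:R) st).
apply/andP; split.
  rewrite mulr_ge0 ?invr_ge0//; apply: sumr_ge0 => k _.
  by rewrite mulr_ge0// path_size_ge0.
by apply: le_flow => k _ /=; rewrite ler_wpM2l ?path_size_ge0// lern1 leq_b1.
Qed.

Lemma inv_flow_nd K : nd_from0 (inv_flow K).
Proof. by move=> s t /(inv_flow_incr K)/andP[]; rewrite subr_ge0. Qed.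

Definition cum_serv i t := \int[mu]_(s in `[0, t]) serv m (q s) i.

Lemma cum_serv_nd i : nd_from0 (cum_serv i).
Proof.
move=> s t st; apply: (@le_integral_nomeas _ _ _ _ (mo_rate m) _ st).1 => u u0.
by rewrite serv_ge0 ?serv_le//; exact: path_ge0.
Qed.

Lemma cum_serv_bounds i t : 0 <= t -> 0 <= cum_serv i t <= mo_rate m * t.
Proof.
move=> t0; apply: (@le_integral_nomeas _ _ t t (mo_rate m) _ _).2; last by rewrite t0 /=.
by move=> u u0; rewrite serv_ge0 ?serv_le//; exact: path_ge0.
Qed.

Lemma departures_nd i : nd_from0 (fun t => dm i (cum_serv i t)).
Proof.
move=> s t st; apply: path_serv_nd => //; have /andP[s0 _] := st.
by rewrite cum_serv_nd// andbT; case/andP: (cum_serv_bounds i s0).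
Qed.

Lemma path_measurable T i : measurable_fun `[0, T] (fun t => q t 0 i).
Proof.
apply: (@eq_measurable_fun _ _ _ _ _ (fun t => Num.max (q 0 0 i + ad i t
    + inv_flow (pred1 (Some i)) t - dm i (cum_serv i t)) 0)).
  by move=> t; rewrite inE /= in_itv /= => /andP[t0 _]; rewrite (path_eq hq i t0).
apply: measurable_maxr => //; apply: measurable_funB.
  apply: measurable_funD; [apply: measurable_funD => //|].
    by apply: nd_from0_measurable; exact: path_ded_nd.
  by apply: nd_from0_measurable; exact: inv_flow_nd.
by apply: nd_from0_measurable; exact: departures_nd.
Qed.

(** [lim] is meaningful only when the limit exists. It does here, since coordinates are positive
    parts of differences of nondecreasing functions. *)
Lemma path_left_limit t : 0 < t -> q s @[s --> t^'-] --> left_limit q t.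
Proof.
move=> t0; rewrite /left_limit.
pose x i s := q 0 0 i + ad i s + inv_flow (pred1 (Some i)) s - dm i (cum_serv i s).
have cx i : cvg (Num.max (x i s) 0 @[s --> t^'-]).
  have c1 := nd_from0_left_limit (path_ded_nd hq i) t0.
  have c2 := nd_from0_left_limit (@inv_flow_nd (pred1 (Some i))) t0.
  have c3 := nd_from0_left_limit (departures_nd i) t0.
  have cxi : cvg (x i s @[s --> t^'-]).
    apply: is_cvgB => //; apply: is_cvgD => //; apply: is_cvgD => //.
    exact: is_cvg_cst.
  rewrite (_ : (fun s => _) = fun s => (x i s + `|x i s|) / 2); last first.
    by apply/funext => s; rewrite maxr_absE subr0 addr0.
  have [y cy] := (cvg_ex _).1 cxi.
  by apply/cvg_ex; exists ((y + `|y|) / 2); apply: cvgM;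
    [apply: cvgD => //; exact: cvg_norm|exact: cvg_cst].
suff : q s @[s --> t^'-] --> (\row_i lim (Num.max (x i s) 0 @[s --> t^'-]) : 'rV[R]_N).
  by move=> H; apply/cvgP: H.
apply: cvg_rowv => i; rewrite mxE.
apply: cvg_trans (cx i); apply: near_eq_cvg; near=> s.
have s0 : 0 <= s by near: s; exact: nbhs_left_ge.
by rewrite (path_eq hq i s0).
Unshelve. all: by end_near.
Qed.

(** The count is constant just after s, so an order not yet counted at s arrives later by a positive
    amount. This strictness leaves room for a left limit taken within [s, t]. *)
Lemma jump_time_bounds s t k : 0 <= s <= t -> (cnt s <= k < cnt t)%N ->
  s < jump_time cnt k <= t.
Proof.
move=> /andP[s0 st] /andP[sk kt]; rewrite /jump_time.
set E := [set _ | _].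
have Et : E t by split=> //; exact: le_trans st.
apply/andP; split; last by apply: (ge_inf _ Et); exists 0 => u [].
have : \forall u \near s^'+, forall v, s <= v <= u -> cnt v = cnt s.
  have [d /= d0 hd] := path_cnt_right hq s0.
  exists d => //= u us su v /andP[sv vu].
  move: sv; rewrite le_eqVlt => /predU1P[->//|sv].
  apply: hd => //=; apply: le_lt_trans us.
  by rewrite !ltr0_norm ?subr_lt0// lerN2 lerD2l lerN2.
move=> /(filterI (nbhs_right_gt s))/filter_ex[u [su hu]].
apply: (lt_le_trans su); apply: lb_le_inf; first by exists t.
move=> v [v0 kv]; rewrite leNgt; apply/negP => vu.
have [vs|sv] := leP v s.
  by have := leq_trans kv (leq_trans (path_cnt_nd hq v0 vs) sk); rewrite ltnn.
have := hu v; rewrite (ltW sv) (ltW vu) => /(_ isT) e.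
by move: kv; rewrite e ltnNge sk.
Qed.

Lemma left_limit_bounds w rho s t : 0 <= s -> s < t ->
  (forall u, s <= u <= t -> `|W (q u) - w| <= rho) ->
  nonnegv (left_limit q t) /\ `|W (left_limit q t) - w| <= rho.
Proof.
move=> s0 st hw; have t0 : 0 < t := le_lt_trans s0 st.
have ql := path_left_limit t0.
have qli i : q s 0 i @[s --> t^'-] --> left_limit q t 0 i.
  exact: (@cvg_rowv_coord _ _ _ _ _ q).
have near_st : \forall u \near t^'-, s <= u <= t.
  near=> u; apply/andP; split; near: u; [exact: nbhs_left_ge|exact: nbhs_left_le].
split.
  move=> i; apply: (cvgr_to_ge (qli i)).
  apply: filterS near_st => u /andP[su _]; apply: path_ge0 => //; exact: le_trans su.
have Wl : W (q u) @[u --> t^'-] --> W (left_limit q t).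
  apply: cvg_big => [|i _]; first exact: add_continuous.
  by apply: cvgM; [exact: cvg_cst|exact: qli].
have : `|W (q u) - w| @[u --> t^'-] --> `|W (left_limit q t) - w|.
  by apply: cvg_norm; apply: cvgB => //; exact: cvg_cst.
move=> Nl; apply: (cvgr_to_le Nl); exact: filterS near_st.
Unshelve. all: by end_near.
Qed.

(* While the weighted queue stays within rho of w, the venue choice of each type
   outside a small window is the same as in a system frozen at w. *)
Lemma inv_flow_sandwich K th w rho s t :
  is_threshold m K th -> (forall x, th = Some x -> 0 < x) ->
  0 <= s <= t -> 0 < rho -> (forall u, s <= u <= t -> `|W (q u) - w| <= rho) ->
  mark_flow (scale_threshold th (w - 2 * rho)) t
    - mark_flow (scale_threshold th (w - 2 * rho)) s
  <= inv_flow K t - inv_flow K s <=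
  mark_flow (scale_threshold th (w + rho)) t
    - mark_flow (scale_threshold th (w + rho)) s.
Proof.
move=> hth th0 st rho0 hw; have /andP[s0 st'] := st.
rewrite /mark_flow /inv_flow.
rewrite (flow_incr (fun k => B k *
  (K (route m (gm k) (left_limit q (jump_time cnt k))))%:R) st).
rewrite !(flow_incr (fun k => B k * (type_le _ (gm k))%:R) st).
have hk k : (cnt s <= k < cnt t)%N ->
    nonnegv (left_limit q (jump_time cnt k)) /\
    `|W (left_limit q (jump_time cnt k)) - w| <= rho.
  move=> kst; have /andP[sj jt] := jump_time_bounds st kst.
  apply: (left_limit_bounds s0 sj) => u /andP[su uj].
  by apply: hw; rewrite su (le_trans uj).
have bb (b b' : bool) : (b -> b') -> (b%:R : R) <= b'%:R.
  by case: b => [->//|_]; rewrite ler0n.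
apply/andP; split; apply: le_flow => k kst; have [ln lw] := hk k kst.
  rewrite ler_wpM2l ?path_size_ge0//; apply: bb => hg; have g0 := path_type_gt0 hq k.
  case: th hth th0 hg => [x|] hth th0 /= hg; last exact: hth.
  (* [type_le] is not strict whereas the threshold needs a strict inequality: this is why the lower
     window is [2 * rho] and the upper one only rho. *)
  have x0 := th0 x erefl; apply: (hth _ _ g0 ln).1; apply: (le_lt_trans hg).
  by rewrite ltr_pM2l//; move: lw; rewrite ler_norml => /andP[]; lra.
rewrite ler_wpM2l ?path_size_ge0//; apply: bb => hK; have g0 := path_type_gt0 hq k.
case: th hth th0 => [x|] hth th0 //=; have x0 := th0 x erefl.
rewrite leNgt; apply/negP => hg; suff : ~~ K (route m (gm k) (left_limit q (jump_time cnt k))).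
  by rewrite hK.
apply: (hth _ _ g0 ln).2; apply: le_lt_trans hg.
by rewrite ler_pM2l//; move: lw; rewrite ler_norml => /andP[]; lra.
Qed.

Variables (q0 : 'rV[R]_N) (T e : R).

Let c := inv_size m * inv_rate m.
Let v := mo_size m.

(** The service clock never exceeds [mo_rate m * T]. The bound on [mark_flow] is uniform in th
    because the thresholds it is applied to depend on the path. *)
Record lln_close : Prop := {
  close_init : forall i, `|q 0 0 i - q0 0 i| <= e;
  close_ded : forall i t, 0 <= t <= T ->
    `|ad i t - ded_size m i * ded_rate m i * t| <= e;
  close_serv : forall i s, 0 <= s <= mo_rate m * T -> `|dm i s - v * s| <= e;
  close_mark : forall th t, 0 <= t <= T ->
    `|mark_flow th t - c * cdf_at m th * t| <= e }.

Hypothesis hc : lln_close.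

Let c0 : 0 < c. Proof. by rewrite mulr_gt0 ?inv_size_gt0 ?inv_rate_gt0. Qed.
Let v0 : 0 < v. Proof. exact: mo_size_gt0. Qed.

Lemma path_nonneg_upto t : 0 <= t <= T -> nonnegv (q t).
Proof. by move=> /andP[t0 _]; exact: path_ge0. Qed.

Lemma cum_serv_incr i s t : 0 <= s <= t -> t <= T ->
  0 <= cum_serv i t - cum_serv i s <= mo_rate m * (t - s).
Proof.
apply: Rintegral_upto_bounds.
exact: (serv_bounded_upto hm path_nonneg_upto (@path_measurable T)).
Qed.

Lemma cum_serv_le i t : 0 <= t <= T -> 0 <= cum_serv i t <= mo_rate m * T.
Proof.
move=> /andP[t0 tT]; have /andP[-> h] := cum_serv_bounds i t0.
by rewrite (le_trans h)// ler_wpM2l// ltW// mo_rate_gt0.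
Qed.

Definition net_flow i t := q 0 0 i + ad i t + inv_flow (pred1 (Some i)) t
  - dm i (cum_serv i t).

Lemma mark_flow_incr th s t : 0 <= s <= t -> t <= T ->
  `|mark_flow th t - mark_flow th s - c * cdf_at m th * (t - s)| <= 2 * e.
Proof.
move=> /andP[s0 st] tT.
have := close_mark hc th (_ : 0 <= t <= T); rewrite (le_trans s0 st) tT => /(_ isT).
have := close_mark hc th (_ : 0 <= s <= T); rewrite s0 (le_trans st tT) => /(_ isT).
rewrite !ler_norml => /andP[h1 h2] /andP[h3 h4]; apply/andP; split; lra.
Qed.

(** Dedicated arrivals, investor arrivals and services each deviate by e at both ends, whence
    [6 * e]. The investors who join one venue are bounded by all investors, [mark_flow None]. *)
Lemma net_flow_incr C i s t : 0 <= s <= t -> t <= T ->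
  ded_size m i * ded_rate m i <= C ->
  `|net_flow i t - net_flow i s| <= (C + c + v * mo_rate m) * (t - s) + 6 * e.
Proof.
move=> st tT hC; have /andP[s0 st'] := st.
have tT' : 0 <= t <= T by rewrite (le_trans s0 st') tT.
have sT' : 0 <= s <= T by rewrite s0 (le_trans st' tT).
have ts : 0 <= t - s by rewrite subr_ge0.
have := close_ded hc i tT'; have := close_ded hc i sT'.
have := mark_flow_incr None st tT; have := inv_flow_incr (pred1 (Some i)) st.
have := cum_serv_incr i st tT.
have := close_serv hc i (cum_serv_le i tT').
have := close_serv hc i (cum_serv_le i sT').
have := path_ded_nd hq i st; have := departures_nd i st.
rewrite /net_flow /=; set x1 := ad i t; set x2 := ad i s.
set y1 := inv_flow _ t; set y2 := inv_flow _ s; set z1 := dm i _; set z2 := dm i _.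
set w1 := cum_serv i s; set w2 := cum_serv i t; set m1 := mark_flow _ t; set m2 := mark_flow _ s.
rewrite mulr1 !ler_norml.
move=> hz hx /andP[h1 h2] /andP[h3 h4] /andP[h5 h6] /andP[h7 h8] /andP[h9 h10] /andP[h11 h12] /andP[h13 h14].
have H1 := ler_wpM2r ts hC; have H2 := ler_wpM2l (ltW v0) h6.
have H3 : 0 <= ded_size m i * ded_rate m i * (t - s).
  by rewrite mulr_ge0// mulr_ge0// ltW ?ded_size_gt0 ?ded_rate_gt0.
have H4 : 0 <= c * (t - s) by rewrite mulr_ge0// ltW.
have H5 := mulr_ge0 (ltW v0) h5.
have e0 : 0 <= e by lra.
apply/andP; split; lra.
Qed.

Lemma path_incr C i s t : 0 <= s <= t -> t <= T ->
  ded_size m i * ded_rate m i <= C ->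
  `|q t 0 i - q s 0 i| <= (C + c + v * mo_rate m) * (t - s) + 6 * e.
Proof.
move=> st tT hC; have /andP[s0 st'] := st.
rewrite (path_eq hq i s0) (path_eq hq i (le_trans s0 st')).
by apply: (le_trans (normr_maxB _ _ _)); exact: net_flow_incr.
Qed.

(** While the net flow is nonpositive the queue is empty and receives no service. After the last
    time at which the net flow is at least [- (2 * e)] no service time accrues, arrivals only push
    it up, and departures grow by at most [2 * e]. So the positive part in the queue equation costs
    at most [4 * e]. *)
Lemma net_flow_lower i t : 0 <= t <= T -> - (4 * e) <= net_flow i t.
Proof.
move=> tT; have /andP[t0 tT'] := tT.
have T0 : 0 <= T := le_trans t0 tT'.
have mu0 := mo_rate_gt0 hm.
have x0 : - (2 * e) <= net_flow i 0.
  rewrite /net_flow /inv_flow path_cnt0 // big_ord0 mulr0 addr0.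
  rewrite /cum_serv Rintegral_at0.
  have := close_ded hc i (_ : 0 <= 0 <= T); rewrite lexx T0 => /(_ isT).
  have := close_serv hc i (_ : 0 <= 0 <= mo_rate m * T).
  rewrite lexx mulr_ge0 ?(ltW mu0)// => /(_ isT).
  have := path_ge0 hq (lexx 0) i.
  rewrite !mulr0 !subr0 !ler_norml => h /andP[h1 h2] /andP[h3 h4]; lra.
have e0 : 0 <= e by have := close_init hc i; exact: le_trans (normr_ge0 _).
pose E := [set s | 0 <= s <= t /\ - (2 * e) <= net_flow i s].
have E0 : E 0 by split=> //; rewrite lexx.
have supE : has_sup E.
  by split; [exists 0|exists t => s [/andP[]]].
have u0 : 0 <= sup E by exact: (sup_upper_bound supE).
have ut : sup E <= t by apply: ge_sup; [exists 0|move=> s [/andP[]]].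
have flat : cum_serv i t - cum_serv i (sup E) <= 0 * (t - sup E).
  suff /andP[] : 0 * (t - sup E) <= cum_serv i t - cum_serv i (sup E) <= 0 * (t - sup E) by [].
  apply: (Rintegral_between (serv_bounded_upto hm path_nonneg_upto (@path_measurable T) i)) => //.
    by rewrite u0.
  move=> w /andP[uw wt]; have w0 : 0 <= w := le_trans u0 (ltW uw).
  have : net_flow i w <= 0.
    rewrite leNgt; apply/negP => nw.
    have : w <= sup E.
      apply: (sup_upper_bound supE); split; first by rewrite w0.
      by apply: le_trans (ltW nw); rewrite oppr_le0 mulr_ge0.
    by rewrite leNgt uw.
  move=> nw; rewrite /serv (path_eq hq i w0) max_r; last exact: nw.
  by rewrite mulr0 mulr0 mul0r lexx.
apply/ler_addgt0Pr => eps eps0.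
(* The net flow jumps, so the supremum need not be attained; the mean service between a nearby s in
   E and [sup E] is at most eps. *)
have d0 : 0 < eps / (v * mo_rate m) by rewrite divr_gt0// mulr_gt0.
have [s [/andP[s0 st] xs] us] := sup_adherent d0 supE.
have su : s <= sup E by apply: (sup_upper_bound supE); split=> //; rewrite s0.
have sts : 0 <= s <= t by rewrite s0.
have sT : 0 <= s <= T by rewrite s0 (le_trans st).
have := close_serv hc i (cum_serv_le i tT); have := close_serv hc i (cum_serv_le i sT).
have := @cum_serv_incr i s (sup E); rewrite s0 su => /(_ isT (le_trans ut tT')).
have := @inv_flow_nd (pred1 (Some i)) _ _ sts; have := path_ded_nd hq i sts.
have hv : v * (mo_rate m * (sup E - s)) <= eps.
  by rewrite mulrA mulrC -ler_pdivlMr ?mulr_gt0//; lra.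
move: xs flat; rewrite /net_flow mul0r.
set x1 := ad i t; set x2 := ad i s.
set y1 := inv_flow _ t; set y2 := inv_flow _ s; set z1 := dm i _; set z2 := dm i _.
rewrite !ler_norml => h1 h2 h3 h4 /andP[h5 h6] /andP[h7 h8] /andP[h9 h10].
have := ler_wpM2l (ltW v0) h2; have := ler_wpM2l (ltW v0) h6; lra.
Qed.

(** * Routed flow over short steps with frozen thresholds *)

Section frozen.
Variables (K : pred (option 'I_N)) (th : option R) (rho om h : R).
Hypotheses (hth : is_threshold m K th) (th0 : forall x, th = Some x -> 0 < x).
Hypotheses (rho0 : 0 < rho) (h0 : 0 < h).
Hypothesis hom : forall x, th = Some x -> forall y z, `|y - z| <= 3 * x * rho ->
  `|type_cdf m y - type_cdf m z| <= om.
Hypothesis om0 : 0 <= om.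
Hypothesis osc : forall s u, 0 <= s <= u -> u <= T -> u - s <= h ->
  `|W (q u) - W (q s)| <= rho.

Let phi u := cdf_at m (scale_threshold th (W (q u))).

Let phib : bounded_upto T 1 phi.
Proof.
split; last by move=> s _; exact: cdf_at_bounds.
by apply: measurable_cdf_at; exact: path_measurable.
Qed.

(** The routed flow lies between two flows with thresholds frozen at W (q s) - 2 rho and W (q s) +
    rho. Both are within 3 rho of the running value W (q u), and over that window F varies by at
    most om. *)
Lemma inv_flow_step s t : 0 <= s <= t -> t <= T -> t - s <= h ->
  `|inv_flow K t - inv_flow K s -
    c * (\int[mu]_(u in `[0, t]) phi u - \int[mu]_(u in `[0, s]) phi u)|
  <= 2 * e + c * om * (t - s).
Proof.
move=> st tT tsh; have /andP[s0 st'] := st.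
have hw u : s <= u <= t -> `|W (q u) - W (q s)| <= rho.
  move=> /andP[su ut]; apply: osc; [by rewrite s0|exact: le_trans tT|].
  by apply: le_trans tsh; rewrite lerD2r.
have /andP[h1 h2] := inv_flow_sandwich hth th0 st rho0 hw.
have := mark_flow_incr (scale_threshold th (W (q s) - 2 * rho)) st tT.
have := mark_flow_incr (scale_threshold th (W (q s) + rho)) st tT.
set A := cdf_at m (scale_threshold th (W (q s) + rho)).
set A' := cdf_at m (scale_threshold th (W (q s) - 2 * rho)).
have mod x y : `|x - y| <= 3 * rho ->
    `|cdf_at m (scale_threshold th x) - cdf_at m (scale_threshold th y)| <= om.
  case: th hom th0 => [z|] homz z0 /= xy; last by rewrite subrr normr0.
  apply: (homz z) => //; have z00 := z0 z erefl.
  by rewrite -mulrBr normrM (gtr0_norm z00) mulrAC [3 * rho * z]mulrC ler_pM2l.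
have : (A - om) * (t - s) <=
    \int[mu]_(u in `[0, t]) phi u - \int[mu]_(u in `[0, s]) phi u
    <= (A' + om) * (t - s).
  apply: (Rintegral_between phib) => // u /andP[su ut].
  have := hw u; rewrite (ltW su) ut => /(_ isT); rewrite ler_norml => /andP[w1 w2].
  have : `|A - phi u| <= om by apply: mod; rewrite ler_norml; apply/andP; split; lra.
  have : `|A' - phi u| <= om by apply: mod; rewrite ler_norml; apply/andP; split; lra.
  by rewrite !ler_norml => /andP[? ?] /andP[? ?]; apply/andP; split; lra.
set I := _ - \int[mu]_(u in `[0, s]) phi u; move=> /andP[i1 i2].
have := ler_wpM2l (ltW c0) i1; have := ler_wpM2l (ltW c0) i2.
rewrite !ler_norml => H1 H2 /andP[H3 H4] /andP[H5 H6].
apply/andP; split; lra.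
Qed.

(** Each step costs [2 * e], while om enters only through the elapsed time. Hence the number J of
    steps is fixed first and e is taken small compared with 1 / J. *)
Lemma inv_flow_fluid J t : 0 <= t <= T -> t <= J%:R * h ->
  `|inv_flow K t - c * \int[mu]_(u in `[0, t]) phi u| <= 2 * J%:R * e + c * om * t.
Proof.
have com : 0 <= c * om by rewrite mulr_ge0// ltW.
have zero : inv_flow K 0 - c * \int[mu]_(u in `[0, 0]) phi u = 0.
  by rewrite /inv_flow path_cnt0// big_ord0 Rintegral_at0 !mulr0 subrr.
have e0 : 0 <= T -> 0 <= e.
  move=> T0; have := close_mark hc None (_ : 0 <= 0 <= T); rewrite lexx T0 => /(_ isT).
  exact: le_trans (normr_ge0 _).
elim: J t => [|J IH] t tT; have /andP[t0 tT'] := tT; have {}e0 := e0 (le_trans t0 tT').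
  rewrite mul0r => tle; have -> : t = 0 by apply/eqP; rewrite eq_le tle.
  by rewrite zero normr0 !mulr0 mul0r addr0.
move=> tJ; have [tJ'|Jt] := leP t (J%:R * h).
  apply: (le_trans (IH t tT tJ')); rewrite lerD2r ler_wpM2r// ler_wpM2l//.
  by rewrite ler_nat.
set s := J%:R * h in Jt.
have s0 : 0 <= s by rewrite mulr_ge0// ltW.
have st : 0 <= s <= t by rewrite s0 ltW.
have sT : 0 <= s <= T by rewrite s0 (le_trans (ltW Jt)).
have tsh : t - s <= h by move: tJ; rewrite -natr1 mulrDl mul1r -/s; lra.
have := IH s sT (lexx _); have := inv_flow_step st tT' tsh.
set x := inv_flow K t; set y := inv_flow K s.
set A := \int[_]_(_ in _) _; set A' := \int[_]_(_ in _) _ => H1 H2.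
have -> : x - c * A = (y - c * A') + (x - y - c * (A - A')) by ring.
rewrite (le_trans (ler_normD _ _))// -natr1; lra.
Qed.

End frozen.

End one_path.

(** The tolerance e is uniform in n and in the path, so that all randomness is confined to
    [lln_close]. *)
Lemma path_approx a (q0 : 'rV[R]_N) T d : (0 < N)%N -> 0 < a ->
  a_minus_min m = a%:E ->
  (forall e : R, 0 < e -> exists2 d : R, 0 < d & forall x y, `|x - y| <= d ->
    `|type_cdf m x - type_cdf m y| <= e) ->
  0 <= T -> 0 < d -> exists2 e, 0 < e & forall n q cnt B gm ad dm,
    queue_path n q cnt B gm ad dm -> lln_close n q cnt B gm ad dm q0 T e ->
    approx_solution m q0 T d q.
Proof.
move=> N0 a0 aE Fuc T0 d0.
pose c := inv_size m * inv_rate m; pose v := mo_size m.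
have c0 : 0 < c by rewrite mulr_gt0 ?inv_size_gt0 ?inv_rate_gt0.
have v0 : 0 < v by exact: mo_size_gt0.
have mu0 := mo_rate_gt0 hm.
have [b1 [b2 [_ b20 _ _ wb]]] := weight_bounds hm N0.
have [C C0 hC] : exists2 C : R, 0 < C & forall i, ded_size m i * ded_rate m i <= C.
  by apply: finite_bound => [i x y xy /le_trans|i]; [exact|exists (ded_size m i * ded_rate m i)].
have [ths hths] := choice (chi_thresholds hm).
have [M M0 hM] : exists2 M : R, 0 < M & forall i x,
    (ths i).1 = Some x \/ (ths i).2 = Some x -> x <= M.
  apply: (@finite_bound _ _ (fun i M => forall x,
    (ths i).1 = Some x \/ (ths i).2 = Some x -> x <= M)) => [i x y xy h z /h zx|i].
    exact: le_trans xy.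
  exists (Num.max (odflt 0 (ths i).1) (odflt 0 (ths i).2)) => x.
  by case=> -> /=; rewrite le_max lexx ?orbT.
have ths0 i x : (ths i).1 = Some x \/ (ths i).2 = Some x -> 0 < x.
  have [_ _ h _] := hths i; move=> /h; rewrite aE lee_fin; exact: lt_le_trans.
have T1 : 0 < T + 1 by rewrite ltr_wpDl.
have cT : 0 < c * (T + 1) by exact: mulr_gt0.
pose om := d / (4 * (c * (T + 1))).
have om0 : 0 < om by apply: divr_gt0 d0 _; exact: mulr_gt0.
have [dF dF0 hdF] := Fuc om om0.
pose rho := dF / (3 * M).
have rho0 : 0 < rho by apply: divr_gt0 dF0 _; exact: mulr_gt0.
have N0' : 0 < N%:R :> R by rewrite ltr0n.
have bN : 0 < b2 * N%:R by exact: mulr_gt0.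
pose D := C + c + v * mo_rate m.
have D0 : 0 < D by rewrite addr_gt0 ?addr_gt0// mulr_gt0.
(* Over a step of length h the weighted queue moves by at most b2 N D h = rho / 2, plus a
   fluctuation 6 b2 N e, which the first entry of e below keeps under rho / 2. *)
pose h := rho / (2 * (b2 * N%:R * D)).
have bND : 0 < b2 * N%:R * D by exact: mulr_gt0.
have h0 : 0 < h by apply: divr_gt0 rho0 _; exact: mulr_gt0.
pose J := (Num.truncn (T / h)).+1.
have TJ : T <= J%:R * h by rewrite -ler_pdivrMr// ltW// truncnS_gt.
have J0 : 0 < J%:R :> R by rewrite ltr0n.
(* The 7 counts four errors for the positive part and one each for the initial state, the dedicated
   arrivals and the services; [4 * J] counts [2 * J] for each of the two thresholds. The two om
   terms take the other half of d. *)
pose e := Order.min (rho / (12 * (b2 * N%:R))) (d / (2 * (7 + 4 * J%:R))).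
have J7 : 0 < 7 + 4 * J%:R :> R by rewrite addr_gt0// mulr_gt0.
have e0 : 0 < e.
  by rewrite lt_min !divr_gt0// mulr_gt0.
exists e => // n q cnt B gm ad dm hq hc.
have qn := path_nonneg_upto (T := T) hq.
have mq i := path_measurable hq (T := T) i.
split => // t i tT; have /andP[t0 tT'] := tT.
have osc s u : 0 <= s <= u -> u <= T -> u - s <= h -> `|W (q u) - W (q s)| <= rho.
  move=> su uT ush.
  have wb2 j : weight m 0 j <= b2 by case/andP: (wb j).
  apply: (le_trans (dotv_dist hm _ _ wb2)).
  have : ldist (q u) (q s) <= N%:R * (D * h + 6 * e).
    rewrite mulr_natl -[X in _ *+ X]card_ord -sumr_const; apply: ler_sum => j _.
    have hp := path_incr hq hc su uT (hC j).
    apply: (le_trans hp).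
    by rewrite lerD2r ler_wpM2l// ltW.
  move=> hl; have := ler_wpM2l (ltW b20) hl => /le_trans; apply.
  have -> : b2 * (N%:R * (D * h + 6 * e)) = b2 * N%:R * D * h + 6 * (b2 * N%:R * e) by ring.
  have -> : b2 * N%:R * D * h = rho / 2.
    by rewrite /h; field; rewrite !gt_eqF.
  have : e <= rho / (12 * (b2 * N%:R)) by rewrite ge_min lexx.
  by rewrite ler_pdivlMr ?mulr_gt0//; lra.
have homx x i' : (ths i').1 = Some x \/ (ths i').2 = Some x ->
    forall y z, `|y - z| <= 3 * x * rho -> `|type_cdf m y - type_cdf m z| <= om.
  move=> hx y z yz; apply: hdF; apply: (le_trans yz).
  rewrite /rho mulrA ler_pdivrMr ?mulr_gt0// mulrC ler_pM2l//.
  by rewrite ler_pM2l//; exact: hM hx.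
have [th1 th2 _ chiE] := hths i.
have f1 := inv_flow_fluid hq hc th1 (fun x hx => ths0 i x (or_introl hx)) rho0 h0
  (fun x hx => homx x i (or_introl hx)) (ltW om0) osc tT (le_trans tT' TJ).
have f2 := inv_flow_fluid hq hc th2 (fun x hx => ths0 i x (or_intror hx)) rho0 h0
  (fun x hx => homx x i (or_intror hx)) (ltW om0) osc tT (le_trans tT' TJ).
have bd th : mu.-integrable `[0, t] (EFin \o (fun u => cdf_at m (scale_threshold th (W (q u))))).
  apply: (@bounded_upto_integrable _ T 1) => //; split=> [|s _].
    exact: measurable_cdf_at.
  exact: cdf_at_bounds.
have chiI : \int[mu]_(u in `[0, t]) chi m (q u) i =
    \int[mu]_(u in `[0, t]) cdf_at m (scale_threshold (ths i).1 (W (q u))) -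
    \int[mu]_(u in `[0, t]) cdf_at m (scale_threshold (ths i).2 (W (q u))).
  rewrite -RintegralB//.
  apply: eq_Rintegral => u; rewrite inE /= in_itv /= => /andP[u0 ut].
  by rewrite (chiE (q u) (qn u _)).2// u0 (le_trans ut).
have flowE : inv_flow n q cnt B gm (pred1 (Some i)) t =
    inv_flow n q cnt B gm (fun o => rebate m o <= rebate m (Some i)) t -
    inv_flow n q cnt B gm (fun o => rebate m o < rebate m (Some i)) t.
  rewrite /inv_flow -mulrBr -sumrB; congr (_ * _); apply: eq_bigr => k _.
  rewrite -mulrBr; congr (_ * _) => /=; set o := route _ _ _.
  have -> : (o == Some i) = (rebate m o == rebate m (Some i)).
    by rewrite (inj_eq (rebate_inj hm)).
  by case: ltgtP => _; rewrite ?subrr ?subr0.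
have hl := net_flow_lower hq hc i tT.
have := path_eq hq i t0; rewrite -/(cum_serv q i t) -/(net_flow _ q cnt B gm ad dm i t) => qE.
have := close_init hc i; have := close_ded hc i tT.
have := close_serv hc i (cum_serv_le hq i tT).
have qx : `|q t 0 i - net_flow n q cnt B gm ad dm i t| <= 4 * e.
  rewrite qE /Num.max; case: ltP => hx; last by rewrite subrr normr0 mulr_ge0// ltW.
  by rewrite sub0r normrN ler0_norm ?(ltW hx)//; lra.
have : e <= d / (2 * (7 + 4 * J%:R)) by rewrite ge_min lexx orbT.
rewrite ler_pdivlMr ?mulr_gt0// => he.
have ho : c * om * t <= d / 4.
  apply: (@le_trans _ _ (c * om * (T + 1))).
    by apply: ler_wpM2l; [apply/ltW/mulr_gt0|lra].
  rewrite /om le_eqVlt; apply/orP; left; apply/eqP; field.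
  by rewrite (gt_eqF c0) (gt_eqF T1).
move: f1 f2 qx; rewrite /fluid_value chiI /net_flow flowE -/c -/v /cum_serv.
set A1 := \int[_]_(_ in _) _; set A2 := \int[_]_(_ in _) _.
set A3 := \int[_]_(_ in _) _.
set x1 := inv_flow _ _ _ _ _ _ _; set x2 := inv_flow _ _ _ _ _ _ _.
rewrite !ler_norml => /andP[h1 h2] /andP[h3 h4] /andP[h5 h6] /andP[h7 h8].
move=> /andP[h9 h10] /andP[h11 h12]; apply/andP; split; lra.
Qed.

End queue_paths.

(** * Laws of large numbers *)

Section with_high_probability.
Context {R : realType} {d : measure_display} {Omega : measurableType d}.
Variable P : probability Omega R.
Implicit Types (A : nat -> Omega -> Prop).

(* [A n] need not be measurable: its complement is covered by a small event. *)
Definition whp A := forall e : R, 0 < e -> \forall n \near \oo,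
  exists B, [/\ measurable B, (P B <= e%:E)%E & forall w, ~ B w -> A n w].

Lemma whp_and A A' : whp A -> whp A' -> whp (fun n w => A n w /\ A' n w).
Proof.
move=> hA hA' e e0; have e2 : 0 < e / 2 by rewrite divr_gt0.
apply: filterS2 (hA _ e2) (hA' _ e2) => n [B [mB PB AB]] [B' [mB' PB' AB']].
exists (B `|` B'); split; first exact: measurableU.
  rewrite [e]splitr EFinD; apply: le_trans (leeD PB PB').
  exact: measureU2.
by move=> w /not_orP[h h']; split; [exact: AB|exact: AB'].
Qed.

Lemma whp_impl A A' : (forall n w, (0 < n)%N -> A n w -> A' n w) -> whp A -> whp A'.
Proof.
move=> AA hA e e0; near=> n.
have n0 : (0 < n)%N by near: n; exact: nbhs_infty_gt.
have [B [mB PB AB]] : exists B, [/\ measurable B, (P B <= e%:E)%E &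
    forall w, ~ B w -> A n w] by near: n; exact: hA.
by exists B; split=> // w /AB; exact: AA.
Unshelve. all: by end_near.
Qed.

Lemma whp_ae A : (forall n, (0 < n)%N -> {ae P, forall w, A n w}) -> whp A.
Proof.
move=> hA e e0; near=> n.
have [B [mB PB AB]] : {ae P, forall w, A n w}.
  by apply: hA; near: n; exact: nbhs_infty_gt.
exists B; split=> //; first by rewrite PB lee_fin ltW.
by move=> w /(subsetC AB); rewrite setCK.
Unshelve. all: by end_near.
Qed.

Lemma whp_const (p : Prop) : (p : Prop) -> whp (fun _ _ => p).
Proof.
move=> hp e e0; apply: nearW => n; exists set0; split=> //.
by rewrite measure0 lee_fin ltW.
Qed.

Lemma whp_forall (J : finType) (A : J -> nat -> Omega -> Prop) :
  (forall i, whp (A i)) -> whp (fun n w => forall i, A i n w).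
Proof.
move=> hA; have : whp (fun n w => forall i, i \in enum J -> A i n w).
  elim: (enum J) => [|i s IH].
    by apply: whp_impl (@whp_const True I) => n w _ _ i; rewrite in_nil.
  apply: whp_impl (whp_and (hA i) IH) => n w _ [h1 h2] j.
  by rewrite inE => /predU1P[->//|]; exact: h2.
by apply: whp_impl => n w _ h i; apply: h; rewrite mem_enum.
Qed.

(** A bad event of probability at most 1/2 is not the whole space. This makes the stochastic systems
    a source of individual approximate solutions. *)
Lemma whp_ex A : whp A -> exists n w, (0 < n)%N /\ A n w.
Proof.
move=> hA; have h2 : 0 < 2^-1 :> R by rewrite invr_gt0.
have [n [n0 [B [mB PB AB]]]] := filter_ex (filterI (nbhs_infty_gt 0) (hA _ h2)).
exists n; apply: contrapT => /forallNP h.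
have BT : B = setT.
  by apply/seteqP; split => // w _; apply: contrapT => /AB Aw; exact: (h w).
move: PB; rewrite BT probability_setT lee_fin => h1.
by move: h1; lra.
Qed.

(** Egorov: almost sure convergence is uniform off one event of small probability, which serves for
    all large n. The sequence is shifted by one because measurability is given from n = 1 on. *)
Lemma whp_cvg (f : nat -> Omega -> R) (l delta : R) : 0 < delta ->
  (forall n, (0 < n)%N -> measurable_fun setT (f n)) ->
  {ae P, forall w, f n w @[n --> \oo] --> l} ->
  whp (fun n w => `|f n w - l| <= delta).
Proof.
move=> d0 mf cf e e0.
pose g n w := f n.+1 w.
have := @ae_pointwise_almost_uniform _ _ _ P g (fun _ => l) setT e.
case=> //; first by move=> n; exact: mf.
- exact: (le_lt_trans (probability_le1 P measurableT) (ltry _)).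
- apply: filterS cf => w cw _.
  by have := cw; rewrite -(cvg_shiftS (f ^~ w)).
move=> B [mB PB cB].
have : \forall n \near \oo, forall w, ~ B w -> `|g n w - l| <= delta.
  apply: (cB [set h | forall w, ~ B w -> `|h w - l| <= delta]).
  apply/uniform_nbhs.
  exists [set xy | ball xy.1 delta xy.2]; split.
    by rewrite -entourage_ballE; exists delta.
  move=> h /= hh w Bw; rewrite distrC; apply/ltW.
  by apply: hh; split.
move=> [k _ hk]; exists k.+1 => // n /= kn; exists B; split=> //; first exact: ltW.
move=> w Bw; have := hk n.-1; rewrite /g prednK ?(leq_trans _ kn)//.
by apply => //=; rewrite -ltnS prednK ?(leq_trans _ kn).
Qed.

End with_high_probability.

(** * Moments, Chebyshev's inequality and the weak law of large numbers *)

Section moments.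
Context {R : realType} {d : measure_display} {Omega : measurableType d}.
Variable P : probability Omega R.

Lemma nat_partition_integral (D : set Omega) (X : Omega -> nat) (f : Omega -> \bar R) :
  measurable D -> measurable_fun setT X -> measurable_fun setT f ->
  (forall w, (0 <= f w)%E) ->
  (\int[P]_(w in D) f w =
   \sum_(0 <= k <oo) \int[P]_(w in D `&` X @^-1` [set k]) f w)%E.
Proof.
move=> mD mX mf f0.
have mDX k : measurable (D `&` X @^-1` [set k]).
  by apply: measurableI => //; rewrite -[X in measurable X]setTI; exact: mX.
rewrite -ge0_integral_bigcup//.
- congr (integral _ _ _); apply/seteqP; split => w /=.
    by move=> Dw; exists (X w).
  by case=> k _ [].
- by apply: measurable_funTS.
- by move=> i j _ _ [w [[_ /= <-] [_ /= <-]]].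
Qed.

Lemma nat_integral (D : set Omega) (X : Omega -> nat) (phi : nat -> R) :
  measurable D -> measurable_fun setT X -> (forall k, 0 <= phi k) ->
  (\int[P]_(w in D) (phi (X w))%:E =
   \sum_(0 <= k <oo) (phi k)%:E * P (D `&` X @^-1` [set k]))%E.
Proof.
move=> mD mX phi0.
rewrite (@nat_partition_integral D X)//; last first.
- by move=> w; rewrite lee_fin.
- by apply/measurable_EFinP; apply: (@measurableT_comp _ _ _ _ _ _ phi).
apply: eq_eseriesr => k _.
have mDX : measurable (D `&` X @^-1` [set k]).
  by apply: measurableI => //; rewrite -[X in measurable X]setTI; exact: mX.
rewrite -integral_cst//; apply: eq_integral => w.
by rewrite inE /= => -[_ ->].
Qed.

Lemma nat_measurable_comp (X : Omega -> nat) (phi : nat -> R) :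
  measurable_fun setT X -> measurable_fun setT (phi \o X).
Proof. by move=> mX; exact: (@measurableT_comp _ _ _ _ _ _ phi). Qed.

(** Zero values do not contribute to the product, so independence is stated for nonzero values. For
    marked sizes these are the values whose events split into a size event and a type event. *)
Lemma indep_integral_mul (X Y : Omega -> nat) (x y : R) :
  measurable_fun setT X -> measurable_fun setT Y ->
  (forall a b, (0 < a)%N -> (0 < b)%N ->
    P (X @^-1` [set a] `&` Y @^-1` [set b]) =
    (P (X @^-1` [set a]) * P (Y @^-1` [set b]))%E) ->
  (\int[P]_w ((X w)%:R)%:E = x%:E)%E -> (\int[P]_w ((Y w)%:R)%:E = y%:E)%E ->
  (\int[P]_w ((X w)%:R * (Y w)%:R)%:E = (x * y)%:E)%E.
Proof.
move=> mX mY indep EX EY.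
have mXa k : measurable (X @^-1` [set k]).
  by rewrite -[X in measurable X]setTI; exact: mX.
have n0 k : (0 : R) <= k%:R by [].
have {}EX : (x%:E = \sum_(0 <= k <oo) (k%:R)%:E * P (X @^-1` [set k]))%E.
  rewrite -EX (@nat_integral setT X (fun k => k%:R))//.
  by apply: eq_eseriesr => k _; rewrite setTI.
have {}EY : (y%:E = \sum_(0 <= k <oo) (k%:R)%:E * P (Y @^-1` [set k]))%E.
  rewrite -EY (@nat_integral setT Y (fun k => k%:R))//.
  by apply: eq_eseriesr => k _; rewrite setTI.
rewrite (@nat_partition_integral setT X)//; last first.
  apply/measurable_EFinP; apply: measurable_funM.
    exact: (nat_measurable_comp (fun k => k%:R)).
  exact: (nat_measurable_comp (fun k => k%:R)).
rewrite mulrC EFinM EX -nneseriesZl; last by move=> k _; rewrite mule_ge0 ?lee_fin.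
apply: eq_eseriesr => a _; rewrite setTI.
have -> : (\int[P]_(w in X @^-1` [set a]) ((X w)%:R * (Y w)%:R)%:E =
    \int[P]_(w in X @^-1` [set a]) (a%:R%:E * ((Y w)%:R)%:E))%E.
  by apply: eq_integral => w; rewrite inE /= => ->; rewrite EFinM.
rewrite ge0_integralZl_EFin//; last first.
  apply/measurable_EFinP; apply: measurable_funTS.
  exact: (nat_measurable_comp (fun k => k%:R)).
have [->|a0] := posnP a; first by rewrite !mul0e mule0.
rewrite (@nat_integral _ Y (fun k => k%:R))//.
rewrite [RHS]muleCA; congr (_ * _)%E.
rewrite EY muleC -[X in (X * _)%E]fineK ?fin_num_measure// -nneseriesZl; last first.
  by move=> k _; rewrite mule_ge0 ?lee_fin.
apply: eq_eseriesr => b _; have [->|b0] := posnP b; first by rewrite !mul0e mule0.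
by rewrite indep// fineK ?fin_num_measure// muleCA.
Qed.

Lemma probability_integral_cst (r : \bar R) : (\int[P]_(x in setT) cst r x = r)%E.
Proof.
rewrite integral_cst// [X in (_ * X)%E](_ : _ = 1%E) ?mule1//.
exact: probability_setT.
Qed.

Lemma chebyshev_second_moment (Y : Omega -> R) (mean V delta : R) :
  measurable_fun setT Y -> (forall w, 0 <= Y w) -> 0 <= mean -> 0 < delta ->
  (\int[P]_w (Y w)%:E = mean%:E)%E ->
  (\int[P]_w (Y w ^+ 2)%:E <= (mean ^+ 2 + V)%:E)%E ->
  measurable [set w | delta <= `|Y w - mean|] /\
  (P [set w | (delta <= `|Y w - mean|)%R] <= (V / delta ^+ 2)%:E)%E.
Proof.
move=> mY Y0 m0 d0 EY EY2.
have mD : measurable_fun setT (fun w => Y w - mean) by exact: measurable_funB.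
have mS : measurable_fun setT (fun w => (Y w - mean) ^+ 2) by exact: measurable_funX.
have mB : measurable [set w | delta <= `|Y w - mean|].
  rewrite (_ : [set w | _] = (fun w => `|Y w - mean|) @^-1` `[delta, +oo[).
    rewrite -[X in measurable X]setTI.
    by apply: (measurableT_comp (@normr_measurable R setT) mD).
  by apply/seteqP; split => w /=; rewrite in_itv /= andbT.
split=> //.
have d2 : 0 < delta ^+ 2 by rewrite exprn_gt0.
pose S w : R := (Y w - mean) ^+ 2.
have := @le_integral_abse _ _ _ P setT measurableT (EFin \o S)
  (delta ^+ 2) ((measurable_EFinP _ _).2 mS) d2.
have -> : setT `&` [set x | ((delta ^+ 2)%:E <= `|(EFin \o S) x|)%E] =
    [set w | delta <= `|Y w - mean|].
  apply/seteqP; split => w /=.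
    case=> _; rewrite lee_fin /S ger0_norm ?sqr_ge0// -(real_normK (num_real (Y w - mean))).
    by rewrite ler_sqr ?nnegrE ?(ltW d0).
  move=> h; split=> //; rewrite lee_fin /S ger0_norm ?sqr_ge0// -(real_normK (num_real (Y w - mean))).
  by rewrite ler_sqr ?nnegrE ?(ltW d0).
have -> : (\int[P]_x `|(EFin \o S) x| =
    \int[P]_x ((Y x - mean) ^+ 2)%:E)%E.
  by apply: eq_integral => w _ /=; rewrite /S ger0_norm ?sqr_ge0.
(* The cross term goes to the left-hand side, so that every integrand is nonnegative. *)
have E1 : (\int[P]_x ((Y x - mean) ^+ 2)%:E + (2 * mean ^+ 2)%:E =
    \int[P]_x (Y x ^+ 2)%:E + (mean ^+ 2)%:E)%E.
  have -> : ((2 * mean ^+ 2)%:E = \int[P]_x (2 * mean * Y x)%:E)%E.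
    under [RHS]eq_integral => w _ do rewrite EFinM.
    rewrite ge0_integralZl_EFin//; last first.
    - by rewrite mulr_ge0.
    - by apply/measurable_EFinP.
    - by move=> w _; rewrite lee_fin.
    by rewrite EY -EFinM; congr EFin; ring.
  have -> : ((mean ^+ 2)%:E = \int[P]_(x in setT) (cst (mean ^+ 2)%:E x))%E.
    by rewrite probability_integral_cst.
  rewrite -!ge0_integralD//.
  - apply: eq_integral => w _ /=; rewrite -!EFinD; congr EFin; ring.
  - by move=> w _; rewrite lee_fin sqr_ge0.
  - by apply/measurable_EFinP; exact: measurable_funX.
  - by move=> w _; rewrite lee_fin sqr_ge0.
  - by move=> w _; rewrite lee_fin sqr_ge0.
  - by apply/measurable_EFinP.
  - by move=> w _; rewrite lee_fin !mulr_ge0.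
  - by apply/measurable_EFinP; apply: measurable_funM.
have E2 : (\int[P]_x ((Y x - mean) ^+ 2)%:E <= V%:E)%E.
  rewrite -(@leeD2rE _ (2 * mean ^+ 2)%:E)// E1.
  apply: (le_trans (leeD2r _ EY2)); rewrite -!EFinD lee_fin; lra.
move=> /le_trans/(_ E2); set B := [set w | _].
have PE : P B = (fine (P B))%:E by rewrite fineK// fin_num_measure.
by rewrite [X in (_ * X)%E]PE [X in (_ -> X <= _)%E]PE -EFinM !lee_fin ler_pdivlMr// mulrC.
Qed.

(* Chen's identity, which yields the moments of the Poisson law. *)
Lemma poisson_size_bias (C : Omega -> nat) (a : R) (phi : nat -> R) : 0 < a ->
  measurable_fun setT C -> (forall k, 0 <= phi k) ->
  (forall k, P (C @^-1` [set k]) = (poisson_pmf a k)%:E) ->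
  (\int[P]_w ((C w)%:R * phi (C w))%:E = a%:E * \int[P]_w (phi (C w).+1)%:E)%E.
Proof.
move=> a0 mC phi0 law.
rewrite (@nat_integral setT C (fun k => k%:R * phi k))//; last first.
  by move=> k; rewrite mulr_ge0.
rewrite (@nat_integral setT C (fun k => phi k.+1))//.
rewrite nneseries_recl//; last by move=> k _; rewrite mule_ge0 ?lee_fin ?mulr_ge0.
rewrite mul0r mul0e add0e -nneseries_addn; last first.
  by move=> k; rewrite mule_ge0 ?lee_fin ?mulr_ge0.
rewrite -nneseriesZl; last by move=> k _; rewrite mule_ge0 ?lee_fin.
apply: eq_eseriesr => k _; rewrite !setTI addn1 !law -!EFinM; congr EFin.
rewrite /poisson_pmf a0 factS natrM exprS.
have : k.+1%:R != 0 :> R by rewrite pnatr_eq0.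
move: (k.+1%:R : R) (k`!%:R : R) => y x y0.
have -> : y * phi k.+1 * (a * a ^+ k / (y * x) * expR (- a)) =
    (y / y) * (a * (phi k.+1 * (a ^+ k / x * expR (- a)))) by rewrite invfM; ring.
by rewrite divff// mul1r.
Qed.

(** Chen's identity with phi = 1 gives the mean; with phi the identity it turns the second moment
    into a times the mean of C + 1. *)
Lemma poisson_moments (C : Omega -> nat) (a : R) : 0 < a -> measurable_fun setT C ->
  (forall k, P (C @^-1` [set k]) = (poisson_pmf a k)%:E) ->
  (\int[P]_w ((C w)%:R)%:E = a%:E)%E /\
  (\int[P]_w ((C w)%:R ^+ 2)%:E = (a ^+ 2 + a)%:E)%E.
Proof.
move=> a0 mC law.
have EC : (\int[P]_w ((C w)%:R)%:E = a%:E)%E.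
  have := @poisson_size_bias C a (fun _ => 1) a0 mC (fun _ => ler01) law.
  rewrite (_ : (fun w => 1%:E) = cst 1%E)// probability_integral_cst mule1 => <-.
  by apply: eq_integral => w _; rewrite mulr1.
split=> //.
have := @poisson_size_bias C a (fun k => k%:R) a0 mC (fun k => ler0n _ k) law.
have -> : (\int[P]_w ((C w).+1%:R)%:E = a%:E + 1)%E.
  rewrite -{1}EC -[X in (_ + X)%E](probability_integral_cst 1) -ge0_integralD//.
  - by apply: eq_integral => w _; rewrite -EFinD natr1.
  - by apply/measurable_EFinP; exact: (nat_measurable_comp (fun k => k%:R)).
rewrite -EFinD -EFinM mulrDr mulr1 -expr2 => <-.
by apply: eq_integral => w _; rewrite expr2.
Qed.

Lemma whp_poisson (C : nat -> Omega -> nat) (c delta : R) : 0 < c -> 0 < delta ->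
  (forall n, (0 < n)%N -> measurable_fun setT (C n)) ->
  (forall n k, (0 < n)%N -> P (C n @^-1` [set k]) = (poisson_pmf (n%:R * c) k)%:E) ->
  whp P (fun n w => `|n%:R^-1 * (C n w)%:R - c| <= delta).
Proof.
move=> c0 d0 mC law e e0; near=> n.
have n0 : (0 < n)%N by near: n; exact: nbhs_infty_gt.
have n0' : 0 < n%:R :> R by rewrite ltr0n.
have nc : 0 < n%:R * c by rewrite mulr_gt0.
have nd : 0 < n%:R * delta by rewrite mulr_gt0.
have [E1 E2] := poisson_moments nc (mC n n0) (fun k => law n k n0).
have := @chebyshev_second_moment (fun w => (C n w)%:R) _ (n%:R * c) (n%:R * delta)
  (nat_measurable_comp (fun k => k%:R) (mC n n0)) (fun w => ler0n _ _) (ltW nc) nd E1 _.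
rewrite E2 => /(_ (lexx _)) [mB PB].
eexists; split; first exact: mB.
  apply: (le_trans PB); rewrite lee_fin exprMn.
  rewrite ler_pdivrMr ?mulr_gt0 ?exprn_gt0//.
  rewrite [n%:R ^+ 2]expr2 -!mulrA mulrCA ler_pM2l//.
  have : c / (e * delta ^+ 2) <= n%:R by near: n; exact: nbhs_infty_ger.
  by rewrite ler_pdivrMr ?mulr_gt0 ?exprn_gt0// mulrCA.
move=> w /= /negP; rewrite -ltNge => /ltW h.
rewrite -(ler_pM2l n0') -{1}(gtr0_norm n0') -normrM mulrBr.
by rewrite mulrA divff ?mul1r// gt_eqF.
Unshelve. all: by end_near.
Qed.

(** Pairwise independence controls the second moments of partial sums; V bounds the second moment of
    a term, hence its variance. *)
Record lln_sequence (xi : nat -> Omega -> nat) (mean V : R) : Prop := {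
  ls_measurable : forall k, measurable_fun setT (xi k);
  ls_mean : forall k, (\int[P]_w ((xi k w)%:R)%:E = mean%:E)%E;
  ls_second : forall k, (\int[P]_w ((xi k w)%:R ^+ 2)%:E <= V%:E)%E;
  ls_indep : forall k l a b, k != l -> (0 < a)%N -> (0 < b)%N ->
    P (xi k @^-1` [set a] `&` xi l @^-1` [set b]) =
    (P (xi k @^-1` [set a]) * P (xi l @^-1` [set b]))%E }.

Section weak_lln.
Variables (xi : nat -> Omega -> nat) (mean V : R).
Hypothesis hxi : lln_sequence xi mean V.

Definition partial_sum J w : R := \sum_(k < J) (xi k w)%:R.

Lemma lln_mean_ge0 : 0 <= mean.
Proof. by rewrite -lee_fin -(ls_mean hxi 0); apply: integral_ge0 => w _; rewrite lee_fin. Qed.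

Lemma lln_second_ge0 : 0 <= V.
Proof.
rewrite -lee_fin; apply: le_trans (ls_second hxi 0).
by apply: integral_ge0 => w _; rewrite lee_fin sqr_ge0.
Qed.

Lemma xi_measurable k : measurable_fun setT (fun w => (xi k w)%:R : R).
Proof. exact: (nat_measurable_comp (fun k => k%:R) (ls_measurable hxi k)). Qed.

Lemma partial_sum_moments J :
  (\int[P]_w (partial_sum J w)%:E = (J%:R * mean)%:E)%E /\
  (\int[P]_w (partial_sum J w ^+ 2)%:E <= ((J%:R * mean) ^+ 2 + J%:R * V)%:E)%E.
Proof.
have V0 := lln_second_ge0.
split.
  under eq_integral => w _ do rewrite /partial_sum -sumEFin.
  rewrite ge0_integral_sum//; last first.
    by move=> k; apply/measurable_EFinP; exact: xi_measurable.
  under eq_bigr => k _ do rewrite (ls_mean hxi).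
  by rewrite sumEFin sumr_const card_ord mulr_natl.
have -> : (\int[P]_w (partial_sum J w ^+ 2)%:E =
    \int[P]_w \sum_(k < J) \sum_(l < J) ((xi k w)%:R * (xi l w)%:R)%:E)%E.
  apply: eq_integral => w _; rewrite expr2 /partial_sum mulr_suml -sumEFin.
  by apply: eq_bigr => k _; rewrite mulr_sumr -sumEFin.
have mkl k l : measurable_fun setT (fun w => ((xi k w)%:R * (xi l w)%:R : R)%:E).
  by apply/measurable_EFinP; apply: measurable_funM; exact: xi_measurable.
have kl0 k l w : (0 <= ((xi k w)%:R * (xi l w)%:R : R)%:E)%E.
  by rewrite lee_fin mulr_ge0.
rewrite ge0_integral_sum//; last first.
- by move=> k w _; apply: sume_ge0.
- by move=> k; apply: emeasurable_sum => l; exact: mkl.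
apply: (@le_trans _ _ (\sum_(k < J) (J%:R * mean ^+ 2 + V)%:E)%E); last first.
  rewrite sumEFin lee_fin sumr_const card_ord -mulr_natl exprMn expr2; lra.
apply: lee_sum => k _; rewrite ge0_integral_sum//.
(* Independence gives [mean ^+ 2] off the diagonal; on it, V is an upper bound and [mean ^+ 2] is
   added to keep the terms alike. *)
apply: (@le_trans _ _ (\sum_(l < J) (mean ^+ 2 + (l == k)%:R * V)%:E)%E); last first.
  rewrite sumEFin lee_fin big_split /= sumr_const card_ord -[mean ^+ 2 *+ J]mulr_natl lerD2l.
  by rewrite (bigD1 k)//= eqxx mul1r big1 ?addr0// => i /negbTE ->; rewrite mul0r.
apply: lee_sum => l _; have [->|lk] := eqVneq l k.
  rewrite mul1r; apply: (@le_trans _ _ V%:E); last by rewrite lee_fin lerDr sqr_ge0.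
  by rewrite (eq_integral (fun w => ((xi k w)%:R ^+ 2)%:E)) ?(ls_second hxi)// => w _; rewrite expr2.
rewrite mul0r addr0 expr2.
rewrite (indep_integral_mul _ _ _ (ls_mean hxi k) (ls_mean hxi l))//.
- exact: (ls_measurable hxi).
- exact: (ls_measurable hxi).
- by move=> a b a0 b0; apply: (ls_indep hxi) => //; rewrite eq_sym.
Qed.

Lemma whp_lln (c delta : R) : 0 <= c -> 0 < delta ->
  whp P (fun n w => `|n%:R^-1 * partial_sum (Num.truncn (c * n%:R)) w - c * mean| <= delta).
Proof.
move=> c0 d0 e e0; near=> n.
have V0 := lln_second_ge0; have m0 := lln_mean_ge0.
have n0 : (0 < n)%N by near: n; exact: nbhs_infty_gt.
have n0' : 0 < n%:R :> R by rewrite ltr0n.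
set J := Num.truncn _.
have d2 : 0 < delta / 2 by rewrite divr_gt0.
have nd : 0 < n%:R * (delta / 2) by rewrite mulr_gt0.
have /andP[J1 J2] : J%:R <= c * n%:R < J.+1%:R.
  by rewrite /J; apply: truncn_itv; rewrite mulr_ge0.
have [E1 E2] := partial_sum_moments J.
have mS : measurable_fun setT (partial_sum J).
  by apply: measurable_sum => k; exact: xi_measurable.
have S0 w : 0 <= partial_sum J w by apply: sumr_ge0.
have [mB PB] := chebyshev_second_moment mS S0 (mulr_ge0 (ler0n _ J) m0) nd E1 E2.
eexists; split; first exact: mB.
  apply: (le_trans PB); rewrite lee_fin exprMn.
  rewrite ler_pdivrMr ?mulr_gt0 ?exprn_gt0//.
  apply: (@le_trans _ _ (c * n%:R * V)); first by rewrite ler_wpM2r.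
  have : c * V / (e * (delta / 2) ^+ 2) <= n%:R by near: n; exact: nbhs_infty_ger.
  rewrite ler_pdivrMr ?mulr_gt0 ?exprn_gt0// => /(ler_wpM2l (ltW n0')) hV.
  rewrite (_ : c * n%:R * V = n%:R * (c * V)); last by ring.
  by rewrite (_ : e * _ = n%:R * (n%:R * (e * (delta / 2) ^+ 2))); last by ring.
move=> w /= /negP; rewrite -ltNge => /ltW h.
rewrite -(ler_pM2l n0') -{1}(gtr0_norm n0') -normrM mulrBr mulrA divff ?mul1r ?gt_eqF//.
(* Replacing c n by its integer part costs at most mean / n, which uses the second half of delta. *)
have : mean * 2 / delta <= n%:R by near: n; exact: nbhs_infty_ger.
rewrite ler_pdivrMr// => hm.
have h2 : `|J%:R * mean - n%:R * (c * mean)| <= n%:R * (delta / 2).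
  have J3 : c * n%:R <= J%:R + 1 by rewrite natr1 ltW.
  have := ler_wpM2r m0 J1; have := ler_wpM2r m0 J3.
  rewrite ler_norml => h3 h4; apply/andP; split; lra.
have -> : partial_sum J w - n%:R * (c * mean) =
  (partial_sum J w - J%:R * mean) + (J%:R * mean - n%:R * (c * mean)) by ring.
rewrite (le_trans (ler_normD _ _))//; lra.
Unshelve. all: by end_near.
Qed.

Lemma partial_sum_nd J J' w : (J <= J')%N -> partial_sum J w <= partial_sum J' w.
Proof.
move=> JJ; rewrite /partial_sum -!(big_mkord xpredT (fun k => (xi k w)%:R : R)).
by rewrite (@big_cat_nat _ _ _ J 0 J')//= lerDl sumr_ge0.
Qed.

(** Partial sums are monotone in the number of terms, so the random count is squeezed between the
    deterministic counts (c - eta) n and (c + eta) n; no joint law of C and xi enters. The lower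
    count is truncated at 0, and eta is such that [eta * mean <= delta / 2]. *)
Lemma whp_compound (C : nat -> Omega -> nat) (c delta : R) : 0 <= c -> 0 < delta ->
  (forall eta, 0 < eta -> whp P (fun n w => `|n%:R^-1 * (C n w)%:R - c| <= eta)) ->
  whp P (fun n w => `|n%:R^-1 * partial_sum (C n w) w - c * mean| <= delta).
Proof.
move=> c0 d0 hC; have m0 := lln_mean_ge0.
pose eta := delta / (2 * (mean + 1)).
have m1 : 0 < mean + 1 by rewrite ltr_wpDl.
have eta0 : 0 < eta by rewrite divr_gt0// mulr_gt0.
have em : eta * mean <= delta / 2.
  rewrite /eta invfM mulrA -mulrA ler_piMr ?(ltW (divr_gt0 _ _))//.
  by rewrite mulrC ler_pdivrMr// mul1r lerDl.
have d2 : 0 < delta / 2 by rewrite divr_gt0.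
have up0 : 0 <= c + eta by rewrite addr_ge0// ltW.
have lo0 : 0 <= Num.max (c - eta) 0 by rewrite le_max lexx orbT.
have := whp_and (hC eta eta0) (whp_and (whp_lln up0 d2) (whp_lln lo0 d2)).
apply: whp_impl => n w n0 [hCn [hu hl]].
have n0' : 0 < n%:R :> R by rewrite ltr0n.
have hCn' : `|(C n w)%:R - c * n%:R| <= eta * n%:R.
  have -> : (C n w)%:R - c * n%:R = (n%:R^-1 * (C n w)%:R - c) * n%:R.
    by field; rewrite gt_eqF.
  by rewrite normrM (gtr0_norm n0') ler_pM2r.
have n1 : 0 <= n%:R^-1 :> R by rewrite invr_ge0.
move: hCn'; rewrite ler_norml => /andP[hC1 hC2].
have Cu : (C n w <= Num.truncn ((c + eta) * n%:R))%N.
  by rewrite truncn_ge_nat ?mulr_ge0//; lra.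
have Cl : (Num.truncn (Num.max (c - eta)%R 0%R * n%:R)%R <= C n w)%N.
  rewrite truncn_le_nat -natr1 maxr_pMl// mul0r gt_max; apply/andP; split.
    by lra.
  by rewrite ltr_wpDl.
have h1 := ler_wpM2l n1 (partial_sum_nd w Cu).
have h2 := ler_wpM2l n1 (partial_sum_nd w Cl).
have h3 : (c - eta) * mean <= Num.max (c - eta) 0 * mean.
  by rewrite ler_wpM2r// le_max lexx.
move: hu hl; rewrite !ler_norml => /andP[_ h4] /andP[h5 _].
apply/andP; split; lra.
Qed.

End weak_lln.

End moments.

(** * Laws of large numbers for the primitives *)

Section primitives_lln.
Context {R : realType} {d : measure_display} {Omega : measurableType d}.
Variable P : probability Omega R.

Lemma nat_measurable_fun (X : Omega -> nat) :
  (forall k, measurable (X @^-1` [set k])) -> measurable_fun setT X.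
Proof.
move=> mX _ S _; rewrite setTI.
rewrite (_ : X @^-1` S = \bigcup_(k in S) (X @^-1` [set k])).
  by apply: bigcup_measurable => k _; exact: mX.
apply/seteqP; split => w /=; first by move=> SX; exists (X w).
by case=> k Sk /= ->.
Qed.

Lemma probability_ae_eq (A B : set Omega) : measurable A -> measurable B ->
  {ae P, forall w, A w <-> B w} -> P A = P B.
Proof.
have H (A' B' : set Omega) : measurable A' -> measurable B' ->
    {ae P, forall w, A' w -> B' w} -> (P A' <= P B')%E.
  move=> mA mB [Z [mZ PZ hZ]].
  have : (P A' <= P (B' `|` Z))%E.
    apply: le_measure; rewrite ?inE//; first exact: measurableU.
    move=> w Aw; have [Bw|Bw] := pselect (B' w); [by left|right].
    by apply: hZ => /= h; exact: Bw (h Aw).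
  have : (P (B' `|` Z) <= P B' + P Z)%E by exact: measureU2.
  by rewrite [P Z]PZ adde0 => h1 h2; exact: le_trans h1.
move=> mA mB AB; apply/eqP; rewrite eq_le; apply/andP; split; apply: H => //;
  by apply: filterS AB => w [].
Qed.

(** Rate and time both vary with n because arrivals run at a rate of order n up to a fixed time,
    whereas service clocks run at rate 1 up to a time of order n. For c = 0 the time is 0, where the
    law of increments says nothing and the initial value is used. *)
Lemma whp_poisson_process (rate : nat -> R) (X : nat -> R -> Omega -> nat)
  (t : nat -> R) (c delta : R) : 0 <= c -> 0 < delta ->
  (forall n, (0 < n)%N -> poisson_process P (rate n) (X n)) ->
  (forall n, (0 < n)%N -> 0 < rate n) ->
  (forall n, (0 < n)%N -> rate n * t n = n%:R * c) ->
  whp P (fun n w => `|n%:R^-1 * (X n (t n) w)%:R - c| <= delta).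
Proof.
move=> c0 d0 hX r0 rt; move: c0; rewrite le_eqVlt => /predU1P[c0|c0].
  apply: whp_ae => n n0; have [mX pX _ _] := hX n n0.
  apply: filterS pX => w [X0 _ _].
  have -> : t n = 0.
    have := rt n n0; rewrite -c0 mulr0 => /eqP.
    by rewrite mulf_eq0 gt_eqF ?r0//= => /eqP.
  by rewrite X0 mulr0 -c0 subrr normr0 ltW.
have t0 n : (0 < n)%N -> 0 < t n.
  move=> n0; rewrite -(pmulr_rgt0 _ (r0 n n0)) rt//.
  by rewrite mulr_gt0// ltr0n.
apply: (@whp_poisson _ _ _ P (fun n => X n (t n)) c delta c0 d0).
  by move=> n n0; apply: (pp_measurable (hX n n0)); exact/ltW/t0.
move=> n k n0; have [mX pX _ lawX] := hX n n0.
have := lawX 0 (t n) k (lexx 0) (t0 n n0); rewrite subr0 rt// => <-.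
have mXt := mX _ (ltW (t0 n n0)); have mX0 := mX 0 (lexx 0).
apply: probability_ae_eq.
- by rewrite -[X in measurable X]setTI; exact: mXt.
- rewrite (_ : [set w | _] = setT `&` (fun w => (X n (t n) w - X n 0%R w)%N) @^-1` [set k]).
    exact: (measurable_fun_subn mXt mX0).
  by rewrite setTI.
- by apply: filterS pX => w [X0 _ _] /=; rewrite X0 subn0.
Qed.

(** Both g and its limit are nondecreasing in time. An error [delta / 2] at the points of a grid on
    which the limit grows by at most [delta / 2] per cell therefore controls all times. *)
Lemma whp_uniform_time (g : nat -> R -> Omega -> R) (a T : R) : 0 <= a -> 0 <= T ->
  (forall t delta, 0 <= t -> 0 < delta -> whp P (fun n w => `|g n t w - a * t| <= delta)) ->
  (forall n, (0 < n)%N -> {ae P, forall w, nd_from0 (g n ^~ w)}) ->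
  forall delta, 0 < delta ->
  whp P (fun n w => forall t, 0 <= t <= T -> `|g n t w - a * t| <= delta).
Proof.
move=> a0 T0 hg gnd delta d0.
have d2 : 0 < delta / 2 by rewrite divr_gt0.
pose J := (Num.truncn (a * T / (delta / 2))).+1.
have J0 : 0 < J%:R :> R by rewrite ltr0n.
pose h := T / J%:R.
have h0 : 0 <= h by rewrite divr_ge0.
have ah : a * h <= delta / 2.
  by rewrite /h mulrA ler_pdivrMr// [leRHS]mulrC -ler_pdivrMr// ltW// truncnS_gt.
have := whp_and (whp_ae gnd) (whp_forall (fun j : 'I_J.+1 =>
  hg (j%:R * h) (delta / 2) (mulr_ge0 (ler0n _ _) h0) d2)).
apply: whp_impl => n w n0 [nd hj] t /andP[t0 tT].
have [T00|TN0] := eqVneq T 0.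
  have -> : t = 0 by apply/eqP; rewrite eq_le t0 -T00 tT.
  by have := hj ord0; rewrite mul0r => /le_trans; apply; rewrite ler_pdivrMr// ler_peMr ?ler1n// ltW.
have T00 : 0 < T by rewrite lt_neqAle eq_sym TN0.
have hp : 0 < h by rewrite divr_gt0.
(* The endpoint is a grid point but would be assigned to a cell beyond the grid. *)
have [tT'|tT'] := eqVneq t T.
  have := hj ord_max; rewrite /= (_ : J%:R * h = T); last by rewrite mulrC divfK ?gt_eqF.
  by rewrite tT' => /le_trans; apply; rewrite ler_pdivrMr// ler_peMr ?ler1n// ltW.
pose j := Num.truncn (t / h).
have /andP[j1 j2] : j%:R <= t / h < j.+1%:R by apply: truncn_itv; rewrite divr_ge0.
rewrite ler_pdivlMr// in j1; rewrite ltr_pdivrMr// in j2.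
have jJ : (j < J)%N.
  rewrite -(ltr_nat R); rewrite -(ltr_pM2r hp) [J%:R * _]mulrC divfK ?gt_eqF//.
  by apply: (le_lt_trans j1); rewrite lt_neqAle tT'.
have jJ1 : (j < J.+1)%N := ltn_trans jJ (ltnSn _).
have := hj (Ordinal jJ1); have := hj (Ordinal (jJ : (j.+1 < J.+1)%N)) => /=.
have n1 : g n (j%:R * h) w <= g n t w by apply: nd; rewrite j1 mulr_ge0.
have n2 : g n t w <= g n (j.+1%:R * h) w by apply: nd; rewrite t0 ltW.
have := ler_wpM2l a0 j1; have := ler_wpM2l a0 (ltW j2).
move: n1 n2; rewrite -natr1 mulrDl mul1r mulrDr !ler_norml.
move=> h1 h2 h3 h4 /andP[h5 h6] /andP[h7 h8]; apply/andP; split; lra.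
Qed.

Section independence.
Variables (L : Type) (G : L -> set (set Omega)).
Hypothesis hG : mutually_independent P G.

Lemma indep2 i j (A B : set Omega) : i <> j -> G i A -> G j B ->
  P (A `&` B) = (fine (P A) * fine (P B))%:E.
Proof.
move=> ij GA GB.
have := hG (f := fun k : 'I_2 => nth i [:: i; j] k) (A := fun k => nth A [:: A; B] k).
rewrite !big_ord_recl big_ord0 mulr1 /= => <-.
- congr (P _); apply/seteqP; split => w /=.
    by move=> [Aw Bw] [[|[|?]] ?].
  by move=> h; split; [exact: (h ord0 I)|exact: (h ord_max I)].
- by move=> [[|[|?]] ?] [[|[|?]] ?] //= h; try exact: val_inj; case: ij.
- by move=> [[|[|?]] ?].
Qed.

Lemma indep4 i j k l (A B C D : set Omega) :
  i <> j -> i <> k -> i <> l -> j <> k -> j <> l -> k <> l ->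
  G i A -> G j B -> G k C -> G l D ->
  P (A `&` B `&` (C `&` D)) =
  (fine (P A) * fine (P B) * (fine (P C) * fine (P D)))%:E.
Proof.
move=> ij ik il jk jl kl GA GB GC GD.
have := hG (f := fun n : 'I_4 => nth i [:: i; j; k; l] n)
  (A := fun n => nth A [:: A; B; C; D] n).
rewrite !big_ord_recl big_ord0 mulr1 /= => H; rewrite -mulrA -H.
- congr (P _); apply/seteqP; split => w /=.
    by move=> [[Aw Bw] [Cw Dw]] [[|[|[|[|?]]]] ?].
  move=> h; split; split.
  + exact: (h (@Ordinal 4 0 isT) I).
  + exact: (h (@Ordinal 4 1 isT) I).
  + exact: (h (@Ordinal 4 2 isT) I).
  + exact: (h (@Ordinal 4 3 isT) I).
- by move=> [[|[|[|[|?]]]] ?] [[|[|[|[|?]]]] ?] //= h; try exact: val_inj;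
    exfalso; (do ?[by apply: ij|by apply: ik|by apply: il|by apply: jk|by apply: jl|by apply: kl]).
- by move=> [[|[|[|[|?]]]] ?].
Qed.

End independence.

Lemma order_sizes_lln (B : nat -> Omega -> nat) (b : R) (L : Type)
  (G : L -> set (set Omega)) (lab : nat -> L) :
  order_sizes P B b -> mutually_independent P G -> injective lab ->
  (forall k, G (lab k) = sigma_rv (B k)) ->
  exists V, lln_sequence P B b V.
Proof.
move=> [mB lawB meanB secB] hG labI GB.
have pre k (A : set nat) : sigma_rv (B k) (B k @^-1` A).
  by exists A => //; rewrite setTI.
have E2 k : (\int[P]_w ((B k w)%:R ^+ 2)%:E = \int[P]_w ((B 0 w)%:R ^+ 2)%:E)%E.
  rewrite (@nat_integral _ _ _ P setT (B k) (fun k => k%:R ^+ 2))//.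
  rewrite (@nat_integral _ _ _ P setT (B 0) (fun k => k%:R ^+ 2))//.
  by apply: eq_eseriesr => a _; rewrite !setTI (lawB k 0%N).
have fin : (\int[P]_w ((B 0 w)%:R ^+ 2)%:E \is a fin_num)%E.
  rewrite ge0_fin_numE; first by have := secB 0%N; rewrite unlock.
  by apply: integral_ge0 => w _; rewrite lee_fin sqr_ge0.
exists (fine (\int[P]_w ((B 0 w)%:R ^+ 2)%:E)%E); split=> //.
- by move=> k; have := meanB k; rewrite unlock.
- by move=> k; rewrite E2 fineK.
- move=> k l a a' kl _ _.
  rewrite (indep2 hG (i := lab k) (j := lab l)) ?GB//.
  + by rewrite EFinM !fineK// fin_num_measure// -[X in measurable X]setTI; exact: mB.
  + by move=> /labI/eqP; apply/negP.
Qed.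

(** For a > 0 the marked size equals a iff the size equals a and the type lies in A. Two such events
    for different orders involve four distinct primitives, whose joint independence factors the
    probability. *)
Lemma marked_sizes_lln (B : nat -> Omega -> nat) (b : R) (nu : probability R R)
  (g : nat -> Omega -> R) (L : Type) (G : L -> set (set Omega))
  (lB lg : nat -> L) (A : set R) :
  order_sizes P B b -> investor_types P nu g -> mutually_independent P G ->
  injective lB -> injective lg -> (forall k l, lB k <> lg l) ->
  (forall k, G (lB k) = sigma_rv (B k)) -> (forall k, G (lg k) = sigma_rv (g k)) ->
  measurable A ->
  exists V, lln_sequence P (fun k w => B k w * (g k w \in A))%N (b * fine (nu A)) V.
Proof.
move=> hB [mg lawg] hG lBI lgI lBg GB Gg mA.
have [V [mB EB EB2 _]] := order_sizes_lln hB hG lBI GB.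
pose Y k w : nat := (g k w \in A).
have mgA k : measurable (g k @^-1` A).
  by rewrite -[X in measurable X]setTI; exact: mg.
have mY k : measurable_fun setT (Y k).
  apply: nat_measurable_fun => -[|[|a]].
  - rewrite (_ : _ @^-1` _ = ~` (g k @^-1` A)); first exact: measurableC.
    apply/seteqP; split => w /=; rewrite /Y.
      by move=> h gA; rewrite mem_set in h.
    by move=> gA; rewrite memNset.
  - rewrite (_ : _ @^-1` _ = g k @^-1` A)//.
    apply/seteqP; split => w /=; rewrite /Y.
      by case: (boolP (_ \in _)) => // /set_mem.
    by move=> gA; rewrite mem_set.
  - rewrite (_ : _ @^-1` _ = set0)//.
    by rewrite -subset0 => w /=; rewrite /Y; case: (_ \in _).
have mBa k a : measurable (B k @^-1` [set a]).
  by rewrite -[X in measurable X]setTI; exact: mB.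
have GBa k a : G (lB k) (B k @^-1` [set a]).
  by rewrite GB; exists [set a] => //; rewrite setTI.
have GgA k : G (lg k) (g k @^-1` A).
  by rewrite Gg; exists A => //; rewrite setTI.
have preE k a : (0 < a)%N ->
    (fun w => (B k w * Y k w)%N) @^-1` [set a] = B k @^-1` [set a] `&` g k @^-1` A.
  move=> a0; apply/seteqP; split => w /=; rewrite /Y.
    case: (boolP (g k w \in A)) => [/set_mem gA|_]; first by rewrite muln1.
    by rewrite muln0 => a00; rewrite -a00 in a0.
  by move=> [-> gA]; rewrite mem_set// muln1.
have mBY k : measurable_fun setT (fun w => (B k w * Y k w)%N).
  apply: nat_measurable_fun => -[|a]; last by rewrite preE//; exact: measurableI.
  rewrite (_ : _ @^-1` _ = B k @^-1` [set 0%N] `|` ~` (g k @^-1` A)).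
    by apply: measurableU => //; exact: measurableC.
  apply/seteqP; split => w /=; rewrite /Y.
    case: (boolP (_ \in _)) => [_|/negP gA _]; first by rewrite muln1; left.
    by right => h; apply: gA; rewrite mem_set.
  by case=> [->|gA]; rewrite ?mul0n// memNset// muln0.
exists V; split.
- exact: mBY.
- move=> k; rewrite -(indep_integral_mul (mB k) (mY k) _ (EB k) (y := fine (nu A))).
  + by apply: eq_integral => w _; rewrite natrM.
  + move=> a a' a0 a0'; have [a1|a1] := eqVneq a' 1%N.
      have YE : Y k @^-1` [set a'] = g k @^-1` A.
        rewrite a1; apply/seteqP; split => w /=; rewrite /Y.
          by case: (boolP (_ \in _)) => // /set_mem.
        by move=> gA; rewrite mem_set.
      rewrite YE (indep2 hG (i := lB k) (j := lg k))//.
      by rewrite EFinM !fineK// fin_num_measure.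
    have -> : Y k @^-1` [set a'] = set0.
      rewrite -subset0 => w /=; rewrite /Y; case: (_ \in _) => /= h.
        by rewrite -h in a1.
      by rewrite -h in a0'.
    by rewrite setI0 !measure0 mule0.
  + have -> : (\int[P]_w ((Y k w)%:R)%:E = \int[P]_w (\1_(g k @^-1` A) w)%:E)%E.
      by apply: eq_integral => w _; rewrite indicE /Y.
    rewrite integral_indic// setIT [X in X = _]lawg// fineK// fin_num_measure//.
- move=> k; apply: le_trans (EB2 k); apply: ge0_le_integral => //.
  + apply/measurable_EFinP; apply: measurable_funX.
    apply: (nat_measurable_comp (fun k => k%:R)).
    exact: mBY.
  + apply/measurable_EFinP; apply: measurable_funX.
    exact: (nat_measurable_comp (fun k => k%:R) (mB k)).
  + move=> w _; rewrite lee_fin ler_sqr ?nnegrE// ler_nat.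
    by rewrite -{2}[B k w]muln1 leq_mul2l leq_b1 orbT.
- move=> k l a a' kl a0 a0'; rewrite !preE//.
  have kl' : k <> l by apply/eqP.
  rewrite (indep4 hG (i := lB k) (j := lg k) (k := lB l) (l := lg l))//; last first.
  + by move/lgI.
  + by move/esym; exact: lBg.
  + by move/lBI.
  rewrite (indep2 hG (lBg k k))// (indep2 hG (lBg l l))//.
Qed.

End primitives_lln.

Lemma ae_and d (T : measurableType d) (R : realType) (P : probability T R)
  (A B : T -> Prop) : {ae P, forall w, A w} -> {ae P, forall w, B w} ->
  {ae P, forall w, A w /\ B w}.
Proof. by move=> hA hB; apply: filterS2 hA hB => w. Qed.

(** * The rescaled queues are approximate solutions with high probability *)

Section system_lln.
Context {R : realType} {N : nat}.
Variables (m : lob R N).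
Hypothesis hm : lob_axioms m.
Context {d : measure_display} {Omega : measurableType d}.
Variables (P : probability Omega R) (X : primitives R Omega N).
Hypothesis hX : primitives_axioms m P X.
Variable Q : nat -> R -> Omega -> 'rV[R]_N.
Hypothesis hQ : forall n, (0 < n)%N -> queue_process m P X n (Q n).

Definition path_of n w t : 'rV[R]_N := rescaled n (Q n) t w.
Definition count_of n w t := No X n t w.
Definition size_of w k : R := (Bo X k w)%:R.
Definition type_of w k := gam X k w.
Definition ded_of n w i t : R := n%:R^-1 * ded_arrivals X n i t w.
(** The clock is sped up by n so that the argument s is the unscaled cumulated service
    [cum_serv]. *)
Definition serv_of n w i s : R := n%:R^-1 * cum_services X i (n%:R * s) w.

Notation mark_of n w := (mark_flow n (count_of n w) (size_of w) (type_of w)).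

Lemma nd_from0_count (h : nat -> R) (c : R -> nat) (x : R) : 0 <= x ->
  (forall k, 0 <= h k) -> (forall s t, 0 <= s -> s <= t -> (c s <= c t)%N) ->
  nd_from0 (fun t => x * \sum_(k < c t) h k).
Proof.
move=> x0 h0 cnd s t /andP[s0 st]; rewrite ler_wpM2l// -!(big_mkord xpredT h).
by rewrite (@big_cat_nat _ _ _ (c s) 0 (c t))//= ?cnd// lerDl sumr_ge0.
Qed.

Lemma ae_ded_nd n i : (0 < n)%N -> {ae P, forall w, nd_from0 (ded_of n w i)}.
Proof.
move=> n0; have [_ pX _ _] := prim_Nd hX i n0.
apply: filterS pX => w [_ nd _]; apply: (nd_from0_count (h := fun k => (Bd X i k w)%:R)).
- by rewrite invr_ge0.
- by [].
- exact: nd.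
Qed.

Lemma ae_serv_nd n i : {ae P, forall w, nd_from0 (serv_of n w i)}.
Proof.
have [_ pX _ _] := prim_Nm hX i.
apply: filterS pX => w [_ nd _].
have := @nd_from0_count (fun k => (Vm X i k w)%:R) (fun s => Nm X i (n%:R * s) w) n%:R^-1.
apply; [by rewrite invr_ge0|by []|].
by move=> s t s0 st; apply: nd; rewrite ?mulr_ge0// ler_wpM2l.
Qed.

Lemma ae_type_gt0 : {ae P, forall w, forall k, 0 < gam X k w}.
Proof.
apply: ae_foralln => k; have [mg lawg] := prim_gam hX.
exists (~` (gam X k @^-1` `]0, +oo[)).
have mA : measurable (gam X k @^-1` `]0, +oo[).
  by rewrite -[X in measurable X]setTI; exact: mg.
split; first exact: measurableC.
  transitivity (1 - P (gam X k @^-1` `]0%R, +oo[))%E; first exact: probability_setC.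
  by rewrite lawg// (type_dist_pos hm) subee.
by move=> w /= h h'; apply: h; move: h'; rewrite in_itv /= andbT.
Qed.

Lemma ae_queue_path n : (0 < n)%N -> {ae P, forall w,
  queue_path m n (path_of n w) (count_of n w) (size_of w) (type_of w)
    (ded_of n w) (serv_of n w)}.
Proof.
move=> n0; have [_ Q0 Qeq] := hQ n0.
have [_ pN _ _] := prim_No hX n0.
have h1 : {ae P, forall w, forall i, nd_from0 (ded_of n w i)}.
  by apply: filter_forall => i; exact: ae_ded_nd.
have h2 : {ae P, forall w, forall i, nd_from0 (serv_of n w i)}.
  by apply: filter_forall => i; exact: ae_serv_nd.
have n1 : 0 <= n%:R^-1 :> R by rewrite invr_ge0.
have := ae_and (ae_and h1 h2) (ae_and ae_type_gt0 (ae_and pN Qeq)).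
apply: filterS => w [[nd1 nd2] [g0 [[c0 cnd cr] qeq]]]; split => //.
- by move=> t t0 i; rewrite /path_of /rescaled mxE mulr_ge0// Q0.
- move=> t i t0; rewrite /path_of /rescaled !mxE qeq//.
  by rewrite maxr_pMr// mulr0; congr Num.max; rewrite !mulrDr mulrN.
Qed.

Lemma whp_ded i T delta : 0 <= T -> 0 < delta -> whp P (fun n w =>
  forall t, 0 <= t <= T ->
    `|ded_of n w i t - ded_size m i * ded_rate m i * t| <= delta).
Proof.
move=> T0; have r0 := ded_rate_gt0 hm i.
apply: (@whp_uniform_time _ _ _ P (fun n t w => ded_of n w i t)) => //.
- by rewrite mulr_ge0// ltW ?ded_size_gt0.
- move=> t delta' t0 d0.
  (* The sizes are common to all systems; their independence is read off the system n = 1. *)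
  have [V hV] := order_sizes_lln (lab := LBd i) (prim_Bd hX i) (prim_indep hX (ltn0Sn 0))
    (fun k l e => let: erefl := e in erefl) (fun k => erefl).
  have := whp_compound (C := fun n w => Nd X n i t w) hV
    (mulr_ge0 (ltW r0) t0) d0.
  have cnt eta : 0 < eta ->
      whp P (fun n w => `|n%:R^-1 * (Nd X n i t w)%:R - ded_rate m i * t| <= eta).
    move=> eta0; apply: (@whp_poisson_process _ _ _ P (fun n => n%:R * ded_rate m i)
      (fun n => Nd X n i) (fun _ => t)) => //.
    + by rewrite mulr_ge0// ltW.
    + by move=> n n0; exact: (prim_Nd hX).
    + by move=> n n0; rewrite mulr_gt0// ltr0n.
    + by move=> n _; rewrite mulrA.
  move=> /(_ cnt); apply: whp_impl => n w n0.
  by rewrite [_ * t * _]mulrC mulrA.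
- by move=> n n0; exact: ae_ded_nd.
Qed.

Lemma whp_serv i T delta : 0 <= T -> 0 < delta -> whp P (fun n w =>
  forall s, 0 <= s <= T -> `|serv_of n w i s - mo_size m * s| <= delta).
Proof.
move=> T0.
apply: (@whp_uniform_time _ _ _ P (fun n t w => serv_of n w i t)) => //.
- by rewrite ltW ?mo_size_gt0.
- move=> t delta' t0 d0.
  have [V hV] := order_sizes_lln (lab := LVm i) (prim_Vm hX i) (prim_indep hX (ltn0Sn 0))
    (fun k l e => let: erefl := e in erefl) (fun k => erefl).
  have := whp_compound (C := fun n w => Nm X i (n%:R * t) w) hV t0 d0.
  have cnt eta : 0 < eta ->
      whp P (fun n w => `|n%:R^-1 * (Nm X i (n%:R * t) w)%:R - t| <= eta).
    move=> eta0; apply: (@whp_poisson_process _ _ _ P (fun n => 1)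
      (fun n => Nm X i) (fun n => n%:R * t)) => //.
    + by move=> n n0; exact: (prim_Nm hX).
    + by move=> n _; rewrite mul1r.
  move=> /(_ cnt); apply: whp_impl => n w n0.
  by rewrite [t * _]mulrC.
- by move=> n n0; exact: ae_serv_nd.
Qed.

Let c := inv_size m * inv_rate m.

Lemma whp_mark th T delta : 0 <= T -> 0 < delta -> whp P (fun n w =>
  forall t, 0 <= t <= T -> `|mark_of n w th t - c * cdf_at m th * t| <= delta).
Proof.
move=> T0; have r0 := inv_rate_gt0 hm; have s0 := inv_size_gt0 hm.
have /andP[F0 F1] := cdf_at_bounds m th.
apply: (@whp_uniform_time _ _ _ P (fun n t w => mark_of n w th t)) => //.
- by rewrite !mulr_ge0// ltW.
- move=> t delta' t0 d0.
  have [V [xi [hV xiE]]] : exists V xi,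
      lln_sequence P xi (inv_size m * cdf_at m th) V /\
      forall k w, (xi k w)%:R = size_of w k * (type_le th (type_of w k))%:R.
    case: th F0 F1 => [x|] _ _ /=.
      have := marked_sizes_lln (lB := LBo) (lg := Lgam) (A := `]-oo, x]%classic)
        (prim_Bo hX) (prim_gam hX) (prim_indep hX (ltn0Sn 0)).
      case => //; [by move=> k l []|by move=> k l []|] => V hV.
      exists V; eexists; split; first exact: hV.
      move=> k w; rewrite natrM; congr (_ * _%:R).
      by rewrite mem_setE in_itv.
    have [V hV] := order_sizes_lln (lab := LBo) (prim_Bo hX) (prim_indep hX (ltn0Sn 0))
      (fun k l e => let: erefl := e in erefl) (fun k => erefl).
    exists V, (Bo X); rewrite mulr1; split => // k w.
    by rewrite mulr1.
  have := whp_compound (C := fun n w => No X n t w) hV (mulr_ge0 (ltW r0) t0) d0.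
  have cnt eta : 0 < eta ->
      whp P (fun n w => `|n%:R^-1 * (No X n t w)%:R - inv_rate m * t| <= eta).
    move=> eta0; apply: (@whp_poisson_process _ _ _ P (fun n => n%:R * inv_rate m)
      (fun n => No X n) (fun _ => t)) => //.
    + by rewrite mulr_ge0// ltW.
    + by move=> n n0; exact: (prim_No hX).
    + by move=> n n0; rewrite mulr_gt0// ltr0n.
    + by move=> n _; rewrite mulrA.
  move=> /(_ cnt); apply: whp_impl => n w n0.
  rewrite /partial_sum; under eq_bigr => k _ do rewrite xiE.
  rewrite (_ : inv_rate m * t * (inv_size m * cdf_at m th) = c * cdf_at m th * t)//.
  by rewrite /c; ring.
- move=> n n0; have [_ pN _ _] := prim_No hX n0.
  apply: filterS pN => w [_ nd _].
  apply: (nd_from0_count (h := fun k => size_of w k * (type_le th (type_of w k))%:R)).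
  + by rewrite invr_ge0.
  + by move=> k; rewrite mulr_ge0.
  + exact: nd.
Qed.

(** It closes the grid of types at a finite level, beyond which little mass is left. *)
Lemma type_cdf_near1 om : 0 < om -> exists2 x, 0 <= x & 1 - om <= type_cdf m x.
Proof.
move=> om0; pose F n : set R := `]-oo, (n%:R : R)]%classic.
have UF : \bigcup_n F n = setT.
  apply/seteqP; split => // x _; exists (Num.truncn `|x|).+1 => //=.
  rewrite /F /= in_itv /= (le_trans (ler_norm _))// ltW//; exact: truncnS_gt.
have mF n : measurable (F n) by rewrite /F; exact: measurable_itv.
have cF : (type_dist m \o F) n @[n --> \oo] --> 1%:E.
  have -> : 1%:E = type_dist m (\bigcup_n F n) by rewrite UF probability_setT.
  apply: nondecreasing_cvg_mu => //; first exact: bigcup_measurable.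
  move=> n p np; apply/subsetPset/subset_itv; rewrite bnd_simp//.
  by rewrite ler_nat.
have : type_cdf m n%:R @[n --> \oo] --> (1 : R) by exact: fine_cvg cF.
have lt1 : 1 - om < 1 by rewrite gtrBl.
move=> /cvgr_gt/(_ _ lt1)/filter_ex[n hn].
by exists n%:R => //; exact: ltW.
Qed.

Lemma mark_flow_mono n w x y t : x <= y -> mark_of n w (Some x) t <= mark_of n w (Some y) t.
Proof.
move=> xy; rewrite /mark_flow ler_wpM2l ?invr_ge0//; apply: ler_sum => k _.
rewrite ler_wpM2l// /type_le ler_nat.
by case: (leP (type_of w k) x) => // /le_trans/(_ xy) ->.
Qed.

Lemma mark_flow_le_total n w x t : mark_of n w (Some x) t <= mark_of n w None t.
Proof.
rewrite /mark_flow ler_wpM2l ?invr_ge0//; apply: ler_sum => k _.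
by rewrite ler_wpM2l// /type_le lern1 leq_b1.
Qed.

(* Glivenko-Cantelli: a finite grid of types suffices by monotonicity. *)
Lemma whp_mark_uniform T delta :
  (forall e : R, 0 < e -> exists2 d : R, 0 < d & forall x y, `|x - y| <= d ->
    `|type_cdf m x - type_cdf m y| <= e) ->
  0 <= T -> 0 < delta -> whp P (fun n w => forall th t, 0 <= t <= T ->
    `|mark_of n w th t - c * cdf_at m th * t| <= delta).
Proof.
move=> Fuc T0 delta0.
have c0 : 0 < c by rewrite mulr_gt0 ?inv_size_gt0 ?inv_rate_gt0.
have T1 : 0 < T + 1 by rewrite ltr_wpDl.
have cT : 0 < c * (T + 1) by exact: mulr_gt0.
have d2 : 0 < delta / 2 by rewrite divr_gt0.
pose om := delta / (2 * (c * (T + 1))).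
have om0 : 0 < om by apply: divr_gt0 delta0 _; exact: mulr_gt0.
have omT t : 0 <= t <= T -> c * om * t <= delta / 2.
  move=> /andP[t0 tT]; apply: (@le_trans _ _ (c * om * (T + 1))).
    by apply: ler_wpM2l; [apply/ltW/mulr_gt0|lra].
  rewrite /om le_eqVlt; apply/orP; left; apply/eqP; field.
  by rewrite (gt_eqF c0) (gt_eqF T1).
have [h h0 hF] := Fuc om om0.
have [x0 x00 hx0] := type_cdf_near1 om0.
pose J := (Num.truncn (x0 / h)).+1.
have Jx : x0 <= J%:R * h by rewrite -ler_pdivrMr// ltW// truncnS_gt.
have := whp_and (whp_ae (fun n (_ : (0 < n)%N) => ae_type_gt0))
  (whp_and (whp_mark None T0 d2)
    (whp_forall (fun j : 'I_J.+1 => whp_mark (Some (j%:R * h)) T0 d2))).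
apply: whp_impl => n w n0 [g0 [hN hj]] th t tT.
have /andP[t0 tT'] := tT.
have dd : delta / 2 <= delta by rewrite ler_pdivrMr// ler_peMr ?ler1n// ltW.
have ct : 0 <= c * t by rewrite mulr_ge0// ltW.
case: th => [x|]; last by exact: le_trans (hN t tT) dd.
have [xle0|x_gt0] := leP x 0.
  have -> : mark_of n w (Some x) t = 0.
    rewrite /mark_flow big1 ?mulr0// => k _.
    by rewrite /type_le leNgt (le_lt_trans xle0 (g0 k)) mulr0.
  by rewrite /= type_cdf_nonpos// mulr0 mul0r subrr normr0 ltW.
(* Beyond the grid the flow lies between those of the last grid point and of all types, whose mean
   rates differ by at most [c * om]. *)
have [xJ|Jx'] := ltP x (J%:R * h); last first.
  have := hN t tT; have := hj ord_max t tT; rewrite /= mulr1.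
  have := mark_flow_mono n w t Jx'; have := mark_flow_le_total n w x t.
  have F1 : 1 - om <= type_cdf m (J%:R * h) by apply: (le_trans hx0); exact: type_cdf_nd.
  have F2 := type_cdf_nd m Jx'; have F3 := type_cdf_le1 m x.
  have := ler_wpM2l ct F1; have := ler_wpM2l ct F2; have := ler_wpM2l ct F3.
  have := omT t tT; rewrite !ler_norml => H1 H2 H3 H4 H5 H6 /andP[H7 H8] /andP[H9 H10].
  apply/andP; split; lra.
pose j := Num.truncn (x / h).
have /andP[j1 j2] : j%:R <= x / h < j.+1%:R by apply: truncn_itv; rewrite divr_ge0// ltW.
rewrite ler_pdivlMr// in j1; rewrite ltr_pdivrMr// in j2.
have jJ : (j < J)%N.
  by rewrite -(ltr_nat R) -(ltr_pM2r h0); exact: le_lt_trans xJ.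
have jJ1 : (j < J.+1)%N := ltn_trans jJ (ltnSn _).
have := hj (Ordinal jJ1) t tT; have := hj (Ordinal (jJ : (j.+1 < J.+1)%N)) t tT => /=.
have := mark_flow_mono n w t j1; have := mark_flow_mono n w t (ltW j2).
have jh : j.+1%:R * h = j%:R * h + h by rewrite -natr1 mulrDl mul1r.
have : `|type_cdf m x - type_cdf m (j%:R * h)| <= om.
  by apply: hF; rewrite ger0_norm; lra.
have : `|type_cdf m x - type_cdf m (j.+1%:R * h)| <= om.
  by apply: hF; rewrite ler0_norm; lra.
rewrite !ler_norml => /andP[h1 _] /andP[_ h2].
have := ler_wpM2l ct h1; have := ler_wpM2l ct h2; have := omT t tT.
set A := type_cdf m _ ; set B := type_cdf m (j%:R * h); set C := type_cdf m (j.+1%:R * h).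
move=> H1 H2 H3 H4 H5 /andP[H6 H7] /andP[H8 H9].
apply/andP; split; lra.
Qed.

Lemma whp_lln_close q0 T delta :
  (forall e : R, 0 < e -> exists2 d : R, 0 < d & forall x y, `|x - y| <= d ->
    `|type_cdf m x - type_cdf m y| <= e) ->
  initial_convergence P Q q0 -> 0 <= T -> 0 < delta ->
  whp P (fun n w => lln_close m n (path_of n w) (count_of n w) (size_of w)
    (type_of w) (ded_of n w) (serv_of n w) q0 T delta).
Proof.
move=> Fuc init T0 delta0.
have mT : 0 <= mo_rate m * T by rewrite mulr_ge0// ltW// mo_rate_gt0.
have h1 : whp P (fun n w => forall i : 'I_N, `|path_of n w 0 0 i - q0 0 i| <= delta).
  apply: whp_forall => i; apply: whp_cvg => //.
    move=> n n0; rewrite /path_of /rescaled.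
    under eq_fun => w do rewrite mxE.
    by apply: measurable_funM => //; exact: (queue_measurable (hQ n0)).
  apply: filterS (init i) => w; rewrite /path_of /rescaled.
  have E : (fun n => (n%:R^-1 *: Q n 0 w) 0 i) = (fun n => n%:R^-1 * Q n 0 w 0 i).
    by apply/funext => n; rewrite mxE.
  by rewrite E.
have h2 := whp_forall (fun i => whp_ded i T0 delta0).
have h3 := whp_forall (fun i => whp_serv i mT delta0).
have := whp_and (whp_and h1 h2) (whp_and h3 (whp_mark_uniform Fuc T0 delta0)).
apply: whp_impl => n w n0 [[c1 c2] [c3 c4]]; split.
- exact: c1.
- by move=> i t tT; exact: c2.
- by move=> i s sT; exact: c3.
- exact: c4.
Qed.

Lemma whp_approx_solution q0 a T delta : (0 < N)%N -> 0 < a ->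
  a_minus_min m = a%:E ->
  (forall e : R, 0 < e -> exists2 d : R, 0 < d & forall x y, `|x - y| <= d ->
    `|type_cdf m x - type_cdf m y| <= e) ->
  initial_convergence P Q q0 -> 0 <= T -> 0 < delta ->
  whp P (fun n w => approx_solution m q0 T delta (path_of n w)).
Proof.
move=> N0 a0 aE Fuc init T0 delta0.
have [e e0 he] := path_approx hm q0 N0 a0 aE Fuc T0 delta0.
have := whp_and (whp_ae ae_queue_path) (whp_lln_close Fuc init T0 e0).
by apply: whp_impl => n w n0 [hq hc]; exact: (he _ _ _ _ _ _ _ hq hc).
Qed.

End system_lln.

(** * Measurability of the supremum events *)

Section norms.
Context {R : realType} {N : nat}.
Variable nrm : 'rV[R]_N -> R.
Hypothesis hnrm : norm_axioms nrm.

Lemma nrm0 : nrm 0 = 0.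
Proof. by rewrite -(scale0r (0 : 'rV[R]_N)) (nrm_scale hnrm) normr0 mul0r. Qed.

Lemma nrmN x : nrm (- x) = nrm x.
Proof. by rewrite -scaleN1r (nrm_scale hnrm) normrN normr1 mul1r. Qed.

Lemma nrm_ge0 x : 0 <= nrm x.
Proof. by have := nrm_triangle hnrm x (- x); rewrite subrr nrm0 nrmN; lra. Qed.

Lemma nrm_le_ldist : exists2 C, 0 < C & forall x y, nrm (x - y) <= C * ldist x y.
Proof.
pose C := 1 + \sum_(i < N) nrm 'e_i.
have C1 : 1 <= C by rewrite lerDl sumr_ge0// => i _; exact: nrm_ge0.
exists C; first exact: lt_le_trans C1.
move=> x y; rewrite {1}[x - y]row_sum_delta.
apply: (@le_trans _ _ (\sum_(i < N) `|(x - y) 0 i| * nrm 'e_i)).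
  elim/big_ind2: _ => [|u a v b ua vb|i _]; first by rewrite nrm0.
    by apply: le_trans (nrm_triangle hnrm _ _) _; exact: lerD.
  by rewrite (nrm_scale hnrm).
rewrite /ldist mulr_sumr; apply: ler_sum => i _; rewrite !mxE mulrC.
apply: ler_wpM2r => //; rewrite /C (bigD1 i)//=.
have : 0 <= \sum_(j < N | j != i) nrm 'e_j by apply: sumr_ge0 => j _; exact: nrm_ge0.
lra.
Qed.

Lemma nrm_le_add x y : nrm x <= nrm y + nrm (x - y).
Proof. by have := nrm_triangle hnrm y (x - y); rewrite subrKC. Qed.

(* [e < nrm y] holds iff some rational point within 1/(j+1) of y coordinatewise
   has norm larger than e by a margin proportional to 1/(j+1). *)
Lemma measurable_nrm_gt d (T : measurableType d) (Y : T -> 'rV[R]_N) e :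
  (forall i, measurable_fun setT (fun w => Y w 0 i)) ->
  measurable [set w | e < nrm (Y w)].
Proof.
move=> mY; have [C C0 hC] := nrm_le_ldist.
pose pt (p : 'rV[rat]_N) : 'rV[R]_N := map_mx ratr p.
pose gap j : R := C * (j.+1%:R^-1 *+ N).
pose F (pj : 'rV[rat]_N * nat) : set T :=
  \bigcap_(i in [set: 'I_N]) [set w | `|Y w 0 i - pt pj.1 0 i| < pj.2.+1%:R^-1].
pose S pj := if e + gap pj.2 < nrm (pt pj.1) then F pj else set0.
have near_pt p j w : F (p, j) w -> C * ldist (Y w) (pt p) <= gap j.
  move=> h; rewrite ler_wpM2l ?(ltW C0)// -[N in _ *+ N]card_ord -sumr_const; apply: ler_sum => i _.
  exact/ltW/h.
have -> : [set w | e < nrm (Y w)] = \bigcup_pj S pj.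
  apply/seteqP; split => [w /= ew|w [[p j] _]]; last first.
    rewrite /S/=; case: ifPn => // h /near_pt hw /=.
    have := hw; have := hC (pt p) (Y w).
    have -> : ldist (pt p) (Y w) = ldist (Y w) (pt p).
      by apply: eq_bigr => i _; rewrite distrC.
    by have := nrm_le_add (pt p) (Y w); move: h; rewrite /=; lra.
  have g0 : 0 < nrm (Y w) - e by rewrite subr_gt0.
  pose j := Num.truncn (2 * C * N%:R / (nrm (Y w) - e)).
  have hj : 2 * gap j < nrm (Y w) - e.
    have : 2 * C * N%:R / (nrm (Y w) - e) < j.+1%:R by exact: truncnS_gt.
    rewrite ltr_pdivrMr// /gap -[_^-1 *+ N]mulr_natr => h.
    have -> : 2 * (C * (j.+1%:R^-1 * N%:R)) = 2 * C * N%:R / j.+1%:R by ring.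
    by rewrite ltr_pdivrMr// [ltRHS]mulrC.
  have j0 : 0 < j.+1%:R^-1 :> R by rewrite invr_gt0.
  have hq i : exists q : rat, `|Y w 0 i - ratr q| < j.+1%:R^-1.
    move: (_^-1) j0 => r r0; have [|q] := @rat_in_itvoo R (Y w 0 i - r) (Y w 0 i + r).
      by lra.
    by rewrite in_itv/= => /andP[q1 q2]; exists q; rewrite ltr_norml; lra.
  have [q hq'] := choice hq.
  have Fw : F (\row_i q i, j) w by move=> i _ /=; rewrite !mxE.
  exists (\row_i q i, j) => //; rewrite /S/= ifT//.
  have := hC (Y w) (pt (\row_i q i)); have := near_pt _ _ _ Fw.
  by have := nrm_le_add (Y w) (pt (\row_i q i)); move: hj; lra.
apply: countable_bigcupT_measurable => [|pj]; first exact: countableP.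
rewrite /S; case: ifPn => // _; apply: fin_bigcap_measurable => // i _.
have mf : measurable_fun setT (fun w => `|Y w 0 i - pt pj.1 0 i|).
  by apply: measurableT_comp => //; apply: measurable_funB.
have := mf measurableT _ (measurable_itv `]-oo, pj.2.+1%:R^-1[).
by rewrite setTI; congr measurable; apply/seteqP; split => w; rewrite /= in_itv.
Qed.

End norms.

Lemma lt_ereal_sup_segment {R : realType} (g : R -> R) (T e : R) :
  (e%:E < ereal_sup [set (g t)%:E | t in `[0%R, T]])%E <->
  exists2 t, 0 <= t <= T & e < g t.
Proof.
split=> [/ereal_sup_gt[_ [t tT <-]]|[t tT et]].
  by rewrite lte_fin => et; exists t => //; move: tT; rewrite /= in_itv.
apply: (@lt_le_trans _ _ (g t)%:E); first by rewrite lte_fin.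
by apply: ereal_sup_ubound; exists t => //; rewrite /= in_itv.
Qed.

Section path_right_constant.
Context {R : realType} {N : nat}.
Variables (m : lob R N).
Hypothesis hm : lob_axioms m.
Context {d : measure_display} {Omega : measurableType d}.
Variables (P : probability Omega R) (X : primitives R Omega N).
Hypothesis hX : primitives_axioms m P X.
Variable Q : nat -> R -> Omega -> 'rV[R]_N.
Hypothesis hQ : forall n, (0 < n)%N -> queue_process m P X n (Q n).

(** The service count is constant just after its clock reading at t, and the clock is nondecreasing
    with speed at most [n * mo_rate m], so it stays in that window for a positive time. *)
Lemma ae_departures_right_constant n i : (0 < n)%N -> {ae P, forall w, forall t,
  0 <= t -> \forall s \near t^'+, departures m X n (Q n) i s w = departures m X n (Q n) i t w}.
Proof.
move=> n0; have [_ pX _ _] := prim_Nm hX i.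
apply: filterS2 pX (ae_queue_path hm hX hQ n0) => w [_ _ hr] hq t t0.
have n1 : 0 < n%:R :> R by rewrite ltr0n.
pose u s := n%:R * cum_serv m (path_of Q n w) i s.
have u0 : 0 <= u t.
  by rewrite mulr_ge0 ?(ltW n1)//; case/andP: (cum_serv_bounds hm hq i t0).
have [r /= r0 hr'] := hr _ u0.
have M0 := mo_rate_gt0 hm.
have tlt : t < t + r / (n%:R * mo_rate m) by rewrite ltrDl divr_gt0// mulr_gt0.
near=> s.
have ts : t < s by near: s; exact: nbhs_right_gt.
have sr : s < t + r / (n%:R * mo_rate m) by near: s; exact: nbhs_right_lt.
have t0s : 0 <= t <= s by rewrite t0 ltW.
have /andP[c1 c2] := cum_serv_incr hm hq i t0s (lexx s).
have us : u t <= u s by rewrite ler_pM2l//; lra.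
have usr : u s - u t < r.
  rewrite -mulrBr; apply: (@le_lt_trans _ _ (n%:R * (mo_rate m * (s - t)))).
    by rewrite ler_pM2l.
  by rewrite mulrA mulrC -ltr_pdivlMr ?mulr_gt0//; lra.
have : Nm X i (u s) w = Nm X i (u t) w.
  move: us; rewrite le_eqVlt => /predU1P[<-//|us]; apply: hr' => //=.
  by rewrite ltr0_norm; lra.
by rewrite /departures /cum_services -/(u s) -/(u t) /u /cum_serv /path_of => ->.
Unshelve. all: by end_near. Qed.

(** All driving counts are constant just after t. This is stronger than right-continuity: only the
    limit path moves between t and a nearby rational time. *)
Lemma ae_path_right_constant n : (0 < n)%N -> {ae P, forall w, forall t,
  0 <= t -> \forall s \near t^'+, path_of Q n w s = path_of Q n w t}.
Proof.
move=> n0; have [_ _ Qeq] := hQ n0.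
have hN : {ae P, forall w, forall i t, 0 <= t -> \forall s \near t^'+, Nd X n i s w = Nd X n i t w}.
  apply: filter_forall => i; have [_ pX _ _] := prim_Nd hX i n0.
  by apply: filterS pX => w [].
have [_ pN _ _] := prim_No hX n0.
have hD : {ae P, forall w, forall i t, 0 <= t -> \forall s \near t^'+,
    departures m X n (Q n) i s w = departures m X n (Q n) i t w}.
  by apply: filter_forall => i; exact: ae_departures_right_constant.
have := ae_and (ae_and hN hD) (ae_and pN Qeq).
apply: filterS => w [[hd hD'] [[_ _ ho] qeq]] t t0.
have hd' : \forall s \near t^'+, forall i, Nd X n i s w = Nd X n i t w.
  by apply: filter_forall => i; exact: hd.
have hD'' : \forall s \near t^'+, forall i,
    departures m X n (Q n) i s w = departures m X n (Q n) i t w.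
  by apply: filter_forall => i; exact: hD'.
near=> s; rewrite /path_of /rescaled; congr (_ *: _); apply/rowP => i.
have ts : t < s by near: s; exact: nbhs_right_gt.
have s0 : 0 <= s := le_trans t0 (ltW ts).
have e1 : Nd X n i s w = Nd X n i t w by move: (i); near: s.
have e2 : departures m X n (Q n) i s w = departures m X n (Q n) i t w by move: (i); near: s.
have e3 : No X n s w = No X n t w by near: s; exact: ho.
by rewrite (qeq s i s0) (qeq t i t0) /ded_arrivals /inv_arrivals e1 e2 e3.
Unshelve. all: by end_near. Qed.

Variable nrm : 'rV[R]_N -> R.
Hypothesis hnrm : norm_axioms nrm.
Variable Fil : R -> set (set Omega).
Hypothesis hFil : usual_filtration P Fil.
Variables (y : R -> 'rV[R]_N) (L : R).
Hypothesis hL : forall s t, 0 <= s <= t -> ldist (y t) (y s) <= L * (t - s).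

(* By right-continuity of the paths the supremum runs over rational times off a
   null set, and the filtration makes P complete. *)
Lemma measurable_sup_gt n T e : (0 < n)%N -> 0 < T ->
  measurable [set w | (e%:E < ereal_sup
    [set (nrm (path_of Q n w t - y t))%:E | t in `[0%R, T]])%E].
Proof.
move=> n0 T0; have [C C0 hC] := nrm_le_ldist hnrm.
set E := [set w | _].
pose G t := [set w | e < nrm (path_of Q n w t - y t)].
have mG t : 0 <= t -> measurable (G t).
  move=> t0; apply: (measurable_nrm_gt hnrm) => i; rewrite /path_of /rescaled.
  under eq_fun => w do rewrite !mxE.
  apply: measurable_funB => //; apply: measurable_funM => //.
  exact: queue_measurable (hQ n0) _ _ t0.
(* T has an event of its own, since no time of the segment lies to its right. *)
pose U := G T `|` \bigcup_(r : rat) (if 0 <= (ratr r : R) <= T then G (ratr r) else set0).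
have mU : measurable U.
  apply: measurableU; first by apply: mG; exact: ltW.
  apply: bigcupT_measurable_rat => r.
  by case: ifPn => // /andP[r0 _]; exact: mG.
have EP w : E w <-> exists2 t, 0 <= t <= T & G t w by exact: lt_ereal_sup_segment.
have UE : U `<=` E.
  move=> w [Gw|[r _]]; first by apply/EP; exists T => //; rewrite lexx ltW.
  by case: ifPn => // rT Gw; apply/EP; exists (ratr r).
have null : P.-negligible (E `\` U).
  have [A [mA PA hA]] := ae_path_right_constant n0.
  exists A; split => // w [/EP[t /andP[t0 tT] Gw] nU]; apply: hA => /= hr.
  apply: nU; move: tT; rewrite le_eqVlt => /predU1P[tE|tT]; first by left; rewrite -tE.
  have [r /= r0 hr'] := hr t t0.
  have L1 : 0 < `|L| + 1 by rewrite ltr_pwDr.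
  have g0 : 0 < nrm (path_of Q n w t - y t) - e by rewrite subr_gt0.
  have CL : 0 < C * (`|L| + 1) by rewrite mulr_gt0.
  (* Within h the limit path moves in norm by less than the margin above e; [|L| + 1] is a positive
     Lipschitz constant. *)
  pose h := (nrm (path_of Q n w t - y t) - e) / (C * (`|L| + 1)).
  have h0 : 0 < h by rewrite divr_gt0.
  have [|q] := @rat_in_itvoo R t (Num.min T (Num.min (t + r) (t + h))).
    by rewrite !lt_min tT !ltrDl r0.
  rewrite in_itv/= !lt_min => /and4P[tq qT qr qh]; right; exists q => //.
  have q0 : 0 <= (ratr q : R) by rewrite (le_trans t0) ?ltW.
  rewrite q0 ltW//= /G/= hr' //=; last by rewrite ltr0_norm; lra.
  have := hC (y (ratr q)) (y t).
  have tq' : 0 <= t <= ratr q by rewrite t0 ltW.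
  have := hL tq'; set D := ldist _ _ => hD hCD.
  have := nrm_le_add hnrm (path_of Q n w t - y t) (path_of Q n w t - y (ratr q)).
  rewrite (_ : _ - _ - (_ - _) = y (ratr q) - y t); last first.
    by rewrite opprB addrC addrA subrK.
  have : C * D < nrm (path_of Q n w t - y t) - e.
    have -> : nrm (path_of Q n w t - y t) - e = C * ((`|L| + 1) * h).
      by rewrite /h; field; rewrite (gt_eqF C0) (gt_eqF L1).
    rewrite ltr_pM2l//; apply: (le_lt_trans hD).
    apply: (@le_lt_trans _ _ (`|L| * (ratr q - t))).
      by rewrite ler_wpM2r ?ler_norm// subr_ge0 ltW.
    apply: (@le_lt_trans _ _ ((`|L| + 1) * (ratr q - t))).
      by rewrite ler_wpM2r ?lerDl// subr_ge0 ltW.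
    by rewrite ltr_pM2l//; lra.
  lra.
have -> : E = U `|` (E `\` U) by rewrite setUDr setDv setD0 setUidr.
apply: measurableU => //.
exact: (fil_sub hFil (lexx 0)) _ (fil_complete hFil null).
Qed.

End path_right_constant.

Lemma approx_lipschitz_ldist (R : realType) (N : nat) (m : lob R N) (q0 : 'rV[R]_N)
  (q : R -> 'rV[R]_N) : lob_axioms m ->
  (forall T e, 0 <= T -> 0 < e -> approx_solution m q0 T e q) ->
  exists L, forall s t, 0 <= s <= t -> ldist (q t) (q s) <= L * (t - s).
Proof.
move=> hm hq; have [C hC] := approx_lipschitz hm hq.
exists (C *+ N) => s t st; rewrite mulrnAl -[N in _ *+ N]card_ord -sumr_const.
by apply: ler_sum => i _; exact: hC.
Qed.

(** * Convergence of the rescaled queues to the fluid limit *)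

Unset Implicit Arguments.

Theorem theorem3p5 (R : realType) (N : nat) (hN : (0 < N)%N)
  (nrm : 'rV[R]_N -> R) (hnrm : norm_axioms nrm)
  (m : lob R N) (hm : lob_axioms m)
  (d : measure_display) (Omega : measurableType d) (P : probability Omega R)
  (Fil : R -> set (set Omega)) (hFil : usual_filtration P Fil)
  (X : primitives R Omega N) (hX : primitives_axioms m P X)
  (Q : nat -> R -> Omega -> 'rV[R]_N)
  (hQ : forall n, (0 < n)%N -> queue_process m P X n (Q n))
  (Qstar : 'rV[R]_N) (hQstar : stationary_point m Qstar)
  (Q0 : 'rV[R]_N) (hQ0 : forall i, 0 < Q0 0 i)
  (hi : decreasing_density m Q0 Qstar)
  (hii : moderate_traffic m)
  (hiii : initial_convergence P Q Q0)
  (hiv : no_dominated_venue m) :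
  exists Qlim : R -> 'rV[R]_N,
    ucp_converges P nrm (fun n => rescaled n (Q n)) Qlim /\
    fluid_equations m Q0 Qlim.
Proof.
have [f fd fdec] := hi.
have [[Qstar_ge0 Qstar_bal] _] := hQstar.
have [a a0 aE] := a_minus_minE hN hm.
have [b1 [b2 [b10 b20 w1 w2 wb]]] := weight_bounds hm hN.
have Q0_ge0 : nonnegv Q0 by move=> i; exact: ltW.
have WQ0 : 0 < dotv (weight m) Q0.
  rewrite /dotv (bigD1 (Ordinal hN))//= ltr_pwDl//.
    by rewrite mulr_gt0// weight_gt0.
  by apply: sumr_ge0 => i _; rewrite mulr_ge0// ltW// weight_gt0.
have kappaE : kappa m Q0 Qstar <=
    b1 / b2 * Num.min (dotv (weight m) Q0) (dotv (weight m) Qstar).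
  by rewrite /kappa w1 w2.
have kappa0 : 0 < kappa m Q0 Qstar.
  rewrite /kappa w1 w2 mulr_gt0 ?divr_gt0// lt_min WQ0.
  exact: (balanced_gt0 hm hN Qstar_ge0 Qstar_bal).
have Fuc := type_cdf_uniform_continuous fd.
have Flip : exists L : R, forall x y, a * kappa m Q0 Qstar <= x ->
    a * kappa m Q0 Qstar <= y -> `|type_cdf m x - type_cdf m y| <= L * `|x - y|.
  exists (f (a * kappa m Q0 Qstar)); apply: (type_cdf_lipschitz fd).
    exact: mulr_gt0.
  by move=> x y zx xy; apply: fdec => //; rewrite aE -EFinM lee_fin.
have happrox T delta : 0 <= T -> 0 < delta ->
    whp P (fun n w => approx_solution m Q0 T delta (path_of Q n w)).
  exact: (whp_approx_solution hm hX hQ hN a0 aE Fuc hiii).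
have [q hq] : exists q, forall T e, 0 <= T -> 0 < e -> approx_solution m Q0 T e q.
  have pk k : exists p, approx_solution m Q0 k%:R k.+1%:R^-1 p.
    have k0 : 0 < k.+1%:R^-1 :> R by rewrite invr_gt0.
    have [n [w [_ h]]] := whp_ex (happrox k%:R _ (ler0n _ _) k0).
    by exists (path_of Q n w).
  have [p hp] := choice pk.
  exact: (approx_limit hm hN a0 aE kappa0 Qstar_ge0 Qstar_bal Q0_ge0 Fuc Flip b10 b20 wb
    kappaE hp).
exists q; split; last exact: approx_fluid_equations hq.
have [L hL] := approx_lipschitz_ldist hm hq.
move=> T e T0 e0 E.
have mE n : (0 < n)%N -> measurable (E n).
  by move=> n0; exact: (measurable_sup_gt hm hX hQ hnrm hFil hL).
split=> //.
have [C C0 hC] := nrm_le_ldist hnrm.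
have eC : 0 < e / C by rewrite divr_gt0.
have [delta delta0 hdelta] := approx_stability hm hN a0 aE kappa0 Qstar_ge0 Qstar_bal
  Q0_ge0 Fuc Flip b10 b20 wb kappaE (ltW T0) eC.
(* Off the bad event the queue path and q are both approximate solutions with tolerance delta, hence
   within [e / C] in l1 distance and within e in norm. *)
have small eta : 0 < eta -> \forall n \near \oo, (P (E n) <= eta%:E)%E.
  move=> eta0; apply: filterS2 (nbhs_infty_gt 0) (happrox _ _ (ltW T0) delta0 _ eta0).
  move=> n n0 [B [mB PB hB]].
  have EB : E n `<=` B.
    move=> w /lt_ereal_sup_segment[t tT]; apply: contraPP => nB; apply/negP; rewrite -leNgt.
    apply: (le_trans (hC _ _)); rewrite mulrC -ler_pdivlMr//.
    exact: (hdelta _ _ (hB _ nB) (hq _ _ (ltW T0) delta0)).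
  apply: le_trans PB; apply: le_measure => //; rewrite inE//; exact: mE.
have finE n : (0 < n)%N -> P (E n) \is a fin_num.
  by move=> n0; apply: fin_num_measure; exact: mE.
apply/fine_cvgP; split; first by apply: filterS (nbhs_infty_gt 0) => n; exact: finE.
apply/cvgr0Pnorm_le => eta eta0.
apply: filterS2 (nbhs_infty_gt 0) (small _ eta0) => n n0 PE /=.
by rewrite ger0_norm ?fine_ge0// -lee_fin fineK// finE.
Qed.
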